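(* Let $\Gamma$ be a finite connected graph. For each $n,k\in\mathbb{N}$ there is a (non-canonical) isomorphism of abelian groups $$\mathrm{H}^n_{\mathrm{Grp}}\big(\mathrm{H}_1(\Gamma),\mathcal{R}^{2k}_{\mathrm{per}}(\Gamma)\big)\;\cong\;\bigoplus_{p+q=n+k}\mathrm{H}^p\big(I^{k,q}\mathfrak{C}^\bullet(\Gamma)\big),$$ where the right side is the cohomology of the pieces of the CKS complex.
   Context: A graph $\Gamma$ is a finite connected oriented multigraph, loops allowed: finite sets $V$, $E$ and maps $h,t:E\to V$. A bond is a minimal set of edges whose removal increases the number of connected components. $F_p(\Gamma)$ is the set of $p$-element subsets of $E$ containing no bond, $F_\bullet(\Gamma)=\bigcup_pF_p(\Gamma)$. $\Gamma\setminus S$ is deletion of the edges in $S$. $\mathrm{H}_1(\Gamma)=\ker(\mathbb{Z}^E\to\mathbb{Z}^V,\ e\mapsto h(e)-t(e))$ and $\mathrm{H}^1(\Gamma)$ is the cokernel of the transpose $\mathbb{Z}^V\to\mathbb{Z}^E$; $[e]\in \mathrm{H}^1(\Gamma)$ is the class of $e$; $\langle\gamma,e\rangle$ is the $e$-coordinate of $\gamma\in \mathrm{H}_1(\Gamma)$. CKS complex: $\mathfrak{C}^{2p,q,r}(\Gamma)=\bigoplus_{S\in F_p(\Gamma)}\bigwedge^q \mathrm{H}_1(\Gamma\setminus S)\otimes\bigwedge^r \mathrm{H}^1(\Gamma\setminus S)$, with differential $\mathfrak{C}^{2p,q,r}\to\mathfrak{C}^{2p+2,q-1,r}$ whose component from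 the summand of $S$ to that of $S\cup e$ (for $e\in E\setminus S$ with $S\cup e\in F_{p+1}(\Gamma)$) is the tensor product of the interior product $\iota_e:\bigwedge^q \mathrm{H}_1(\Gamma\setminus S)\to\bigwedge^{q-1}\mathrm{H}_1(\Gamma\setminus S\setminus e)$ with $[e]$ and the map induced by the natural projection $\mathrm{H}^1(\Gamma\setminus S)\to \mathrm{H}^1(\Gamma\setminus S\setminus e)$. $I^{k,\ell}\mathfrak{C}^\bullet(\Gamma)$ is the complex with $I^{k,\ell}\mathfrak{C}^p(\Gamma)=\mathfrak{C}^{2p,k-p,\ell}(\Gamma)$. The module $\mathcal{R}_{\mathrm{per}}$: let $E_{\mathrm{per}}=\mathbb{Z}\times E$, $e_i=(i,e)$, and let $F^{\mathrm{per}}_\bullet(\Gamma)$ be the set of subsets $S_I=\{e_{I_e}\mid e\in S\}$ for $S\in F_\bullet(\Gamma)$, $I\in\mathbb{Z}^S$. Let $\mathcal{SR}^{2k}_{\mathrm{per}}(\Gamma)$ be the infinite product of copies of $\mathbb{Z}$ indexed by the degree-$k$ monomials in the variables $e_i$ whose support lies in $F^{\mathrm{per}}_\bullet(\Gamma)$ (possibly infinite formal sums), with the multiplication of formal sums in which monomials with support not in $F^{\mathrm{per}}_\bullet(\Gamma)$ are $0$. $\mathcal{R}^{\bullet}_{\mathrm{per}}(\Gamma)$ is the cokernel of the multiplication map $\mathcal{SR}_{\mathrm{per}}^{\bullet-2}(\Gamma)\otimes \mathrm{H}_1(\Gamma)\to\mathcal{SR}_{\mathrm{per}}^\bullet(\Gamma)$,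 where $\gamma$ is sent to $\sum_{e}\langle\gamma,e\rangle\sum_{i\in\mathbb{Z}}e_i$. The group $\mathrm{H}_1(\Gamma)$ acts by the (infinite-sum-preserving) ring automorphisms $\gamma\cdot e_i=e_{i-\langle\gamma,e\rangle}$. $\mathrm{H}^n_{\mathrm{Grp}}$ denotes group cohomology. *)

(* Defs.v *)
From HB Require Import structures.
From mathcomp Require Import all_boot all_order all_algebra finmap.
From mathcomp Require Import boolp functions.
From mathcomp.multinomials Require Import monalg.

Set Implicit Arguments.
Unset Strict Implicit.
Unset Printing Implicit Defensive.

Import GRing.Theory.
Local Open Scope ring_scope.
Local Open Scope quotient_scope.

(** * Abelian groups *)

(** The subgroup of [A] generated by [R], and the quotient of [A] by it. *)
Section Quotient.
Variables (A : zmodType) (R : A -> Prop).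

Definition span : {pred A} :=
  fun x => `[< forall P : zmodClosed A, (forall r, R r -> r \in P) -> x \in P >].

Fact span_zmod_closed : zmod_closed span.
Proof.
split; first by apply/asboolP => P _; exact: rpred0.
move=> x y /asboolP xP /asboolP yP; apply/asboolP => P RP.
by rewrite rpredB ?xP ?yP.
Qed.
HB.instance Definition _ := GRing.isZmodClosed.Build A span span_zmod_closed.

Lemma mem_span r : R r -> r \in span.
Proof. by move=> Rr; apply/asboolP => P; apply. Qed.

Definition zquot : zmodType := Quotient.quot span.

Definition cls : A -> zquot := \pi_(Quotient.quot span).
HB.instance Definition _ := GRing.Additive.on cls.

Lemma cls_surj x : exists a, cls a = x.
Proof. by exists (repr (x : Quotient.quot span)); exact: reprK. Qed.

Lemma clsP a b : reflect (cls a = cls b) (a - b \in span).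
Proof. by rewrite Quotient.idealrBE; exact: eqP. Qed.

Lemma cls_rel r : R r -> cls r = 0.
Proof.
by move=> /mem_span Rr; rewrite -[RHS](raddf0 cls); apply/clsP; rewrite subr0.
Qed.

End Quotient.

(** The map induced on the quotient by a map which vanishes on [R]. *)
HB.lock Definition qlift (A : zmodType) (R : A -> Prop) (B : zmodType)
    (f : {additive A -> B}) (fR : forall r, R r -> f r = 0) (x : zquot R) : B :=
  f (repr (x : Quotient.quot (span R))).
Arguments qlift {A R B f} fR x.

Section Lift.
Variables (A : zmodType) (R : A -> Prop) (B : zmodType) (f : {additive A -> B}).
Hypothesis fR : forall r, R r -> f r = 0.

Lemma span_ker x : x \in span R -> f x = 0.
Proof.
move=> /asboolP xP; apply/eqP.
pose K : {pred A} := fun x => f x == 0.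
have Kz : zmod_closed K.
  split; first by rewrite unfold_in raddf0.
  by move=> u v; rewrite !unfold_in raddfB => /eqP-> /eqP->; rewrite subr0.
pose Kc := GRing.isZmodClosed.Build A K Kz.
pose KP : zmodClosed A := HB.pack K Kc.
by have := xP KP; apply => r /fR /eqP.
Qed.

Lemma qliftE a : qlift fR (cls R a) = f a.
Proof.
rewrite unlock; apply/eqP; rewrite -subr_eq0 -raddfB; apply/eqP/span_ker/clsP.
exact: reprK.
Qed.

Fact qlift_additive : zmod_morphism (qlift fR).
Proof.
move=> x y; have [a <-] := cls_surj x; have [b <-] := cls_surj y.
by rewrite -raddfB !qliftE raddfB.
Qed.
HB.instance Definition _ :=
  GRing.isZmodMorphism.Build (zquot R) B (qlift fR) qlift_additive.
End Lift.

(** Linear extension of a map from a basis to the free abelian group. *)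
Section Free.
Variables (K : choiceType) (B : zmodType) (f : K -> B).

Definition lin (g : {malg K}) : B := \sum_(k <- msupp g) f k *~ g@_k.

Lemma linEw (g : {malg K}) (d : {fset K}) : (msupp g `<=` d)%fset ->
  lin g = \sum_(k <- d) f k *~ g@_k.
Proof.
move=> le; rewrite /lin (big_fset_incl _ le) // => k _ /mcoeff_outdom ->.
by rewrite mulr0z.
Qed.

Fact lin_additive : zmod_morphism lin.
Proof.
move=> g h; rewrite (linEw (msuppB_le g h)) (linEw (fsubsetUl _ (msupp h))).
rewrite (linEw (fsubsetUr (msupp g) _)) -sumrB.
by apply: eq_bigr => k _; rewrite mcoeffB mulrzBr.
Qed.
HB.instance Definition _ :=
  GRing.isZmodMorphism.Build {malg K} B lin lin_additive.

Lemma linU k : lin << k >> = f k.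
Proof.
by rewrite /lin msuppU oner_eq0 big_seq_fset1 mcoeffUU.
Qed.
End Free.

Lemma free_ext (K : choiceType) (B : zmodType) (f g : {additive {malg K} -> B}) :
  (forall k, f << k >> = g << k >>) -> f =1 g.
Proof.
move=> fg x; rewrite (monalgEw (fsubset_refl (msupp x))) !raddf_sum.
by apply: eq_bigr => k _; rewrite -[x@_k]intz !raddfMz fg.
Qed.

Section Tensor.
Variables A B : zmodType.

Variant tensor_rel : {malg (A * B)%type} -> Prop :=
| TensorDl a a' b :
    tensor_rel (<< (a + a', b) >> - << (a, b) >> - << (a', b) >>)
| TensorDr a b b' :
    tensor_rel (<< (a, b + b') >> - << (a, b) >> - << (a, b') >>).

Definition tensor : zmodType := zquot tensor_rel.

Definition tens (a : A) (b : B) : tensor := cls tensor_rel << (a, b) >>.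

Section Lift.
Variables (C : zmodType) (f : A -> B -> C).
Hypotheses (fDl : forall b, {morph f^~ b : x y / x + y})
           (fDr : forall a, {morph f a : x y / x + y}).

Fact tensor_lift_rel r : tensor_rel r -> lin (fun ab => f ab.1 ab.2) r = 0.
Proof.
by case=> *; rewrite !raddfB /= !linU /= ?fDl ?fDr -addrA -opprD subrr.
Qed.

Definition tensor_lift : {additive tensor -> C} := qlift tensor_lift_rel.

Lemma tensor_liftE a b : tensor_lift (tens a b) = f a b.
Proof. by apply: etrans (qliftE _ _) _; rewrite /= linU. Qed.
End Lift.
End Tensor.

Lemma tensDl (A B : zmodType) (b : B) : {morph (@tens A B)^~ b : x y / x + y}.
Proof.
move=> x y; apply/eqP; rewrite -subr_eq0 opprD addrA -!raddfB; apply/eqP.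
exact/cls_rel/TensorDl.
Qed.

Lemma tensDr (A B : zmodType) (a : A) : {morph @tens A B a : x y / x + y}.
Proof.
move=> x y; apply/eqP; rewrite -subr_eq0 opprD addrA -!raddfB; apply/eqP.
exact/cls_rel/TensorDr.
Qed.

Lemma tensor_ext (A B C : zmodType) (f g : {additive tensor A B -> C}) :
  (forall a b, f (tens a b) = g (tens a b)) -> f =1 g.
Proof.
move=> fg x; have [u <-] := cls_surj x.
pose f' := [the {additive _ -> _} of f \o cls (@tensor_rel A B)].
pose g' := [the {additive _ -> _} of g \o cls (@tensor_rel A B)].
by rewrite -[LHS]/(f' u) -[RHS]/(g' u); apply: free_ext => -[a b]; exact: fg.
Qed.

Section TensorMap.
Variables (A B A' B' : zmodType).
Variables (f : {additive A -> A'}) (g : {additive B -> B'}).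

Fact tensor_mapDl b : {morph (fun a => tens (f a) (g b)) : x y / x + y}.
Proof. by move=> x y; rewrite raddfD tensDl. Qed.

Fact tensor_mapDr a : {morph (fun b => tens (f a) (g b)) : x y / x + y}.
Proof. by move=> x y; rewrite raddfD tensDr. Qed.

Definition tensor_map : {additive tensor A B -> tensor A' B'} :=
  tensor_lift tensor_mapDl tensor_mapDr.

Lemma tensor_mapE a b : tensor_map (tens a b) = tens (f a) (g b).
Proof. exact: tensor_liftE. Qed.
End TensorMap.

(** The degree [q] part of the tensor algebra of [M] modulo the ideal generated
    by the [x * x], as the free group on all words in [M] modulo: the words of
    length other than [q], multilinearity, and the words with two equal
    consecutive letters.  The degree is an [int] so that it vanishes for
    [q < 0]. *)
Section ExteriorPower.
Variables (M : zmodType).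

Variant ext_rel (q : int) : {malg (seq M)} -> Prop :=
| ExtSize s : (size s)%:Z != q -> ext_rel q << s >>
| ExtAdd s x y t : ext_rel q
    (<< s ++ (x + y) :: t >> - << s ++ x :: t >> - << s ++ y :: t >>)
| ExtAlt s x t : ext_rel q << s ++ [:: x, x & t] >>.

Definition ext_power (q : int) : zmodType := zquot (ext_rel q).

Definition wedge (q : int) (s : seq M) : ext_power q := cls (ext_rel q) << s >>.

Lemma wedge_size q s : (size s)%:Z != q -> wedge q s = 0.
Proof. by move=> sq; apply/cls_rel/ExtSize. Qed.

Lemma wedgeD q s x y t :
  wedge q (s ++ (x + y) :: t) = wedge q (s ++ x :: t) + wedge q (s ++ y :: t).
Proof.
apply/eqP; rewrite -subr_eq0 opprD addrA -!raddfB; apply/eqP.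
exact/cls_rel/ExtAdd.
Qed.

Lemma wedge_alt q s x t : wedge q (s ++ [:: x, x & t]) = 0.
Proof. exact/cls_rel/ExtAlt. Qed.
End ExteriorPower.

Section ExteriorMap.
Variables (M N : zmodType) (f : {additive M -> N}) (q : int).

Fact ext_map_rel r : ext_rel q r -> lin (fun s => wedge q (map f s)) r = 0.
Proof.
case=> [s sq|s x y t|s x t]; rewrite ?raddfB /= !linU.
- by rewrite wedge_size // size_map.
- by rewrite !map_cat /= raddfD wedgeD -addrA -opprD subrr.
- by rewrite map_cat /= wedge_alt.
Qed.

Definition ext_map : {additive ext_power M q -> ext_power N q} :=
  qlift ext_map_rel.

Lemma ext_mapE s : ext_map (wedge q s) = wedge q (map f s).
Proof. by apply: etrans (qliftE _ _) _; rewrite /= linU. Qed.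
End ExteriorMap.

(** Interior product with the functional [phi]; it is zero unless
    [q = q' + 1]. *)
Section Contraction.
Variables (M : zmodType) (phi : {additive M -> int}) (q q' : int).

Definition contract_word (s : seq M) : ext_power M q' :=
  if (size s)%:Z == q then
    \sum_(i < size s)
      wedge q' (take i s ++ drop i.+1 s) *~ ((-1) ^+ i * phi (nth 0 s i))
  else 0.

Fact contract_rel r : ext_rel q r -> lin contract_word r = 0.
Proof.
have sz (s t : seq M) (x y : M) : size (s ++ x :: t) = size (s ++ y :: t).
  by rewrite !size_cat.
case=> [s sq|s x y t|s x t]; rewrite ?raddfB /= !linU /contract_word.
- by rewrite (negPf sq).
- rewrite !(sz s t _ 0); case: ifP => _; last by rewrite !subr0.
  apply/eqP; rewrite -addrA -opprD subr_eq0; apply/eqP.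
  rewrite -big_split /=; apply: eq_bigr => i _.
  rewrite !nth_cat !take_cat !drop_cat.
  have [lt_is|le_si] := ltnP i (size s).
    have [lt_iss|le_sis] := ltnP i.+1 (size s).
      by rewrite !catA wedgeD mulrzDl.
    have -> : i.+1 = size s by apply/eqP; rewrite eqn_leq lt_is le_sis.
    by rewrite subnn !drop0 wedgeD mulrzDl.
  rewrite ltnNge (leq_trans le_si) //= subSn //.
  case: (i - size s)%N => [|j] /=; last first.
    by rewrite -!catA /= wedgeD mulrzDl.
  by rewrite raddfD mulrDr mulrzDr.
- case: ifP => // _; set u := s ++ _.
  pose F i := wedge q' (take i u ++ drop i.+1 u) *~ ((-1) ^+ i * phi (nth 0 u i)).
  have szu : size u = (size s + (size t).+2)%N by rewrite size_cat.
  rewrite -(big_mkord xpredT F) szu (@big_cat_nat _ _ _ (size s)) //=;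
    last by rewrite leq_addr.
  rewrite big_nat_cond big1 ?add0r => [|i /andP[/= lt_is _]]; last first.
    rewrite /F take_cat drop_cat lt_is.
    have [lt_iss|le_sis] := ltnP i.+1 (size s).
      by rewrite catA wedge_alt mul0rz.
    have -> : i.+1 = size s by apply/eqP; rewrite eqn_leq lt_is le_sis.
    by rewrite subnn drop0 wedge_alt mul0rz.
  rewrite -{1}[size s]add0n big_addn addKn.
  rewrite big_nat_recl // big_nat_recl // big1 ?addr0 => [|i _]; last first.
    rewrite /F take_cat ltnNge leq_addl /= addnK /=.
    by rewrite -!catA /= wedge_alt mul0rz.
  have nth_u j : nth 0 u (j + size s) = nth 0 [:: x, x & t] j.
    by rewrite nth_cat ltnNge leq_addl /= addnK.
  have take_u j : take (j + size s) u = s ++ take j [:: x, x & t].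
    by rewrite take_cat ltnNge leq_addl /= addnK.
  have drop_u j : drop (j + size s) u = drop j [:: x, x & t].
    by rewrite drop_cat ltnNge leq_addl /= addnK.
  rewrite /F -!addSn !nth_u !take_u !drop_u /= drop0 cats0 -catA /=.
  by rewrite add1n add0n exprS mulN1r mulNr mulrNz subrr.
Qed.

Definition contract : {additive ext_power M q -> ext_power M q'} :=
  qlift contract_rel.

Lemma contractE s :
  contract (wedge q s) =
  if (size s)%:Z == q then
    \sum_(i < size s)
      wedge q' (take i s ++ drop i.+1 s) *~ ((-1) ^+ i * phi (nth 0 s i))
  else 0.
Proof. by apply: etrans (qliftE _ _) _; rewrite /= linU. Qed.
End Contraction.

Section ExteriorMult.
Variables (M : zmodType) (x : M) (q : int).

Fact ext_mult_rel r :
  ext_rel q r -> lin (fun s => wedge (q + 1) (x :: s)) r = 0.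
Proof.
case=> [s sq|s y z t|s y t]; rewrite ?raddfB /= !linU.
- by rewrite wedge_size //= -addn1 PoszD (inj_eq (addIr _)).
- by rewrite -cat_cons wedgeD -addrA -opprD subrr.
- by rewrite -cat_cons wedge_alt.
Qed.

(** Left multiplication by [x]. *)
Definition ext_mult : {additive ext_power M q -> ext_power M (q + 1)} :=
  qlift ext_mult_rel.

Lemma ext_multE s : ext_mult (wedge q s) = wedge (q + 1) (x :: s).
Proof. by apply: etrans (qliftE _ _) _; rewrite /= linU. Qed.
End ExteriorMult.

Lemma ext_ext (M B : zmodType) q (f g : ext_power M q -> B) :
  zmod_morphism f -> zmod_morphism g ->
  (forall s, f (wedge q s) = g (wedge q s)) -> f =1 g.
Proof.
move=> fB gB fg x; have [u <-] := cls_surj x.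
pose F : {additive {malg (seq M)} -> B} := HB.pack (f \o cls (@ext_rel M q))
  (GRing.isZmodMorphism.Build {malg (seq M)} B (f \o cls (@ext_rel M q))
    (fun y z => etrans (congr1 f (raddfB _ y z)) (fB _ _))).
pose H : {additive {malg (seq M)} -> B} := HB.pack (g \o cls (@ext_rel M q))
  (GRing.isZmodMorphism.Build {malg (seq M)} B (g \o cls (@ext_rel M q))
    (fun y z => etrans (congr1 g (raddfB _ y z)) (gB _ _))).
exact: (@free_ext _ _ F H fg).
Qed.

(** The values of the interior product with [phi] are fixed by the map induced
    by [x |-> x - phi x * x0]; if [phi x0 = 1] this is a projection onto the
    kernel of [phi]. *)
Section ContractionKernel.
Variables (M : zmodType) (phi : {additive M -> int}) (x0 : M).
Variable (f : {additive M -> M}).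
Hypothesis fE : forall x, f x = x - x0 *~ phi x.

Let W (q : int) (s : seq M) : ext_power M q :=
  \sum_(i < size s)
    wedge q (take i s ++ drop i.+1 s) *~ ((-1) ^+ i * phi (nth 0 s i)).

Let W_cons q x s :
  W (q + 1) (x :: s) = wedge (q + 1) s *~ phi x - ext_mult x q (W q s).
Proof.
rewrite /W (raddf_sum (ext_mult x q)) -sumrN big_ord_recl; congr (_ + _).
  by rewrite /= drop0 mul1r.
apply: eq_bigr => i _.
by rewrite exprS mulN1r mulNr mulrNz (raddfMz (ext_mult x q)) ext_multE.
Qed.

Let multD q x y (w : ext_power M q) :
  ext_mult (x + y) q w = ext_mult x q w + ext_mult y q w.
Proof.
move: w; apply: ext_ext => [u v|u v|s]; first exact: raddfB.
  by rewrite !raddfB opprD addrACA.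
by rewrite !ext_multE (wedgeD _ [::]).
Qed.

Let multB q x y (w : ext_power M q) :
  ext_mult (x - y) q w = ext_mult x q w - ext_mult y q w.
Proof. by rewrite -[x in RHS](subrK y) multD addrK. Qed.

Let multMz q x n (w : ext_power M q) :
  ext_mult (x *~ n) q w = ext_mult x q w *~ n.
Proof.
pose h := GRing.isZmodMorphism.Build M (ext_power M (q + 1))
  (fun x => ext_mult x q w) (fun x y => multB x y w).
pose H : {additive M -> ext_power M (q + 1)} :=
  HB.pack (fun x => ext_mult x q w) h.
exact: (raddfMz H n x).
Qed.

Let multK q x (w : ext_power M q) :
  ext_mult x (q + 1) (ext_mult x q w) = 0.
Proof.
move: w; apply: (@ext_ext _ _ _ _ (fun=> 0)) => [u v|u v|s].
- by rewrite !raddfB.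
- by rewrite subr0.
- by rewrite !ext_multE (wedge_alt _ [::]).
Qed.

Let multC q x y (w : ext_power M q) :
  ext_mult x (q + 1) (ext_mult y q w) = - ext_mult y (q + 1) (ext_mult x q w).
Proof.
have := multK (x + y) w; rewrite multD (multD x y w).
rewrite (raddfD (ext_mult x (q + 1))) (raddfD (ext_mult y (q + 1))).
rewrite (multK x w) (multK y w) add0r addr0.
by move/eqP; rewrite addr_eq0 => /eqP.
Qed.


Let map_mult q x (w : ext_power M q) :
  ext_map f (q + 1) (ext_mult x q w) = ext_mult (f x) q (ext_map f q w).
Proof.
move: w; apply: ext_ext => [u v|u v|s]; [by rewrite !raddfB..|].
by rewrite ext_multE !ext_mapE ext_multE.
Qed.

Let wedge_map q s :
  wedge (q + 1) (map f s) = wedge (q + 1) s - ext_mult x0 q (W q s).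
Proof.
elim: s q => [|x s IHs] q.
  by rewrite /W big_ord0 (raddf0 (ext_mult x0 q)) subr0.
rewrite -(subrK 1 q) W_cons; move: (q - 1) => {}q /=.
rewrite -(ext_multE (f x)) IHs fE multB multMz.
have B (z : M) u v : ext_mult z (q + 1) (u - v)
  = ext_mult z (q + 1) u - ext_mult z (q + 1) v := raddfB (ext_mult z (q + 1)) u v.
rewrite (B x) (B x0 (wedge _ _) (ext_mult _ _ _)) multK subr0.
rewrite (B x0 (wedge _ _ *~ _)) (raddfMz (ext_mult x0 (q + 1)) (phi x)).
rewrite (multC x0 x) !ext_multE.
by rewrite opprK opprD addrA addrAC.
Qed.

Let map_W q s : ext_map f q (W q s) = W q s.
Proof.
elim: s q => [|x s IHs] q.
  by rewrite /W big_ord0 (raddf0 (ext_map f q)).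
rewrite -(subrK 1 q) W_cons; move: (q - 1) => {}q.
rewrite (raddfB (ext_map f (q + 1)) (_ *~ _)).
rewrite (raddfMz (ext_map f (q + 1)) (phi x)).
rewrite ext_mapE map_mult IHs wedge_map fE.
rewrite (multB x (x0 *~ phi x)).
rewrite multMz.
rewrite (mulrzBl _ (ext_mult x0 q (W q s))).
by rewrite opprB addrA subrK.
Qed.

Lemma ext_map_contract q q' w :
  ext_map f q' (contract phi q q' w) = contract phi q q' w.
Proof.
move: w; apply: ext_ext => [u v|u v|s]; [by rewrite !raddfB..|].
rewrite contractE; case: ifP => _.
  exact: map_W.
exact: raddf0.
Qed.
End ContractionKernel.
(** * Direct sums, complexes and group cohomology *)

Section DirectSum.
Variables (I : finType) (A : I -> zmodType).

Definition dsum := {dffun forall i, A i}.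
HB.instance Definition _ := Choice.on dsum.

Implicit Types x y : dsum.

Definition dsum_zero : dsum := finfun (fun i => 0 : A i).
Definition dsum_opp x : dsum := finfun (fun i => - x i).
Definition dsum_add x y : dsum := finfun (fun i => x i + y i).

Fact dsum_addA : associative dsum_add.
Proof. by move=> x y z; apply/ffunP => i; rewrite !ffunE addrA. Qed.
Fact dsum_addC : commutative dsum_add.
Proof. by move=> x y; apply/ffunP => i; rewrite !ffunE addrC. Qed.
Fact dsum_add0 : left_id dsum_zero dsum_add.
Proof. by move=> x; apply/ffunP => i; rewrite !ffunE add0r. Qed.
Fact dsum_addN : left_inverse dsum_zero dsum_opp dsum_add.
Proof. by move=> x; apply/ffunP => i; rewrite !ffunE addNr. Qed.
HB.instance Definition _ :=
  GRing.isZmodule.Build dsum dsum_addA dsum_addC dsum_add0 dsum_addN.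

Lemma dsumB x y i : (x - y) i = x i - y i.
Proof. by rewrite !ffunE. Qed.
End DirectSum.

Section Kernel.
Variables (A B : zmodType) (f : {additive A -> B}).

Definition kernel : {pred A} := fun x => f x == 0.

Fact kernel_zmod_closed : zmod_closed kernel.
Proof.
split; first by rewrite unfold_in raddf0.
by move=> x y; rewrite !unfold_in raddfB => /eqP-> /eqP->; rewrite subr0.
Qed.
HB.instance Definition _ := GRing.isZmodClosed.Build A kernel kernel_zmod_closed.

Record ker : Type := Ker { ker_val :> A; _ : ker_val \in kernel }.
HB.instance Definition _ := [isSub for ker_val].
HB.instance Definition _ := [Choice of ker by <:].
HB.instance Definition _ := [SubChoice_isSubZmodule of ker by <:].
End Kernel.

(** The identity [diff (diff x) = 0], which holds in the instances below, is not
    needed to form the cohomology groups. *)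
Record complex := Complex {
  ob :> nat -> zmodType;
  diff : forall n, {additive ob n -> ob n.+1}
}.

Definition coboundary (C : complex) (n : nat) : C n -> Prop :=
  match n with
  | 0 => fun x => x = 0
  | m.+1 => fun x => exists y : C m, x = diff C m y
  end.

Definition cohomology (C : complex) (n : nat) : zmodType :=
  zquot (fun z : ker (diff C n) => coboundary (ker_val z)).

(** Group cohomology of an abelian group [G], written additively, acting on
    [M], by inhomogeneous cochains. *)
Section GroupCohomology.
Variables (G M : zmodType) (act : G -> {additive M -> M}).

Definition cochain (n : nat) : zmodType := ('I_n -> G) -> M.

(** [(g_0, .., g_n) |-> (g_0, .., g_i + g_(i+1), .., g_n)] *)
Definition merge n (i : 'I_n) (g : 'I_n.+1 -> G) : 'I_n -> G := fun j =>
  if (j < i)%N then g (widen_ord (leqnSn n) j)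
  else if j == i then g (widen_ord (leqnSn n) j) + g (lift ord0 j)
  else g (lift ord0 j).

Definition cochain_diff n (f : cochain n) : cochain n.+1 := fun g =>
  act (g ord0) (f (fun i => g (lift ord0 i)))
  + \sum_(i < n) f (merge i g) *~ (-1) ^+ i.+1
  + f (fun i => g (widen_ord (leqnSn n) i)) *~ (-1) ^+ n.+1.

Fact cochain_diff_additive n : zmod_morphism (@cochain_diff n).
Proof.
move=> f f'; apply/funext => g; rewrite /cochain_diff.
have subE m (u v : cochain m) h : (u - v) h = u h - v h by [].
rewrite !subE raddfB mulrzBl.
under eq_bigr => i _ do rewrite subE mulrzBl.
by rewrite sumrB !opprD [RHS]addrACA [X in _ = X + _]addrACA.
Qed.
HB.instance Definition _ n :=
  GRing.isZmodMorphism.Build (cochain n) (cochain n.+1) (@cochain_diff n)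
    (@cochain_diff_additive n).

Definition cochain_complex : complex :=
  Complex (fun n => @cochain_diff n : {additive cochain n -> cochain n.+1}).

Definition group_cohomology (n : nat) : zmodType := cohomology cochain_complex n.
End GroupCohomology.

(** * Graphs *)

Record graph := Graph {
  vertex : finType;
  edge : finType;
  head_of : edge -> vertex;
  tail_of : edge -> vertex
}.

Definition delete (G : graph) (S : {set edge G}) : graph :=
  @Graph (vertex G) {e : edge G | e \notin S}
    (fun e => head_of (val e)) (fun e => tail_of (val e)).

Definition adjacent (G : graph) : rel (vertex G) := fun v w =>
  [exists e : edge G, ((tail_of e == v) && (head_of e == w))
                      || ((tail_of e == w) && (head_of e == v))].

Definition num_components (G : graph) : nat := n_comp (@adjacent G) predT.

Definition connected (G : graph) : Prop := num_components G = 1%N.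

Definition bond (G : graph) (B : {set edge G}) : bool :=
  minset (fun S => num_components G < num_components (delete S))%N B.

(** [faces G p] is F_p(G). *)
Definition faces (G : graph) (p : nat) : {set {set edge G}} :=
  [set S : {set edge G} | (#|S| == p) && [forall B : {set edge G}, bond B ==> ~~ (B \subset S)]].

Section Homology.
Variable G : graph.

Definition boundary (c : {ffun edge G -> int}) : {ffun vertex G -> int} :=
  \sum_e [ffun v => c e * ((head_of e == v)%:R - (tail_of e == v)%:R)].

Fact boundary_additive : zmod_morphism boundary.
Proof.
move=> c d; rewrite /boundary -sumrB; apply: eq_bigr => e _.
by apply/ffunP => v; rewrite !ffunE mulrBl.
Qed.
HB.instance Definition _ := GRing.isZmodMorphism.Build
  {ffun edge G -> int} {ffun vertex G -> int} boundary boundary_additive.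

Definition H1 : zmodType := ker boundary.

Definition pairing (e : edge G) (c : H1) : int := ker_val c e.

Fact pairing_additive e : zmod_morphism (pairing e).
Proof. by move=> c d; rewrite /pairing /= !ffunE. Qed.
HB.instance Definition _ e :=
  GRing.isZmodMorphism.Build H1 int (pairing e) (pairing_additive e).

Definition cobound (g : {ffun vertex G -> int}) : {ffun edge G -> int} :=
  [ffun e => g (head_of e) - g (tail_of e)].

Definition coH1 : zmodType := zquot (fun c => exists g, c = cobound g).
End Homology.

(** * The CKS complex *)

Section CKS.
Variable G : graph.
Implicit Types S T : {set edge G}.

(** The map from Z^(E \ S) to Z^(E \ T) given by extension by zero and
    restriction. *)
Definition transport S T (c : {ffun edge (delete S) -> int}) :
    {ffun edge (delete T) -> int} :=
  [ffun e => oapp c 0 (insub (val e))].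

Fact transport_additive S T : zmod_morphism (@transport S T).
Proof.
move=> c d; apply/ffunP => e; rewrite !ffunE.
by case: insub => [e'|] /=; rewrite ?ffunE ?subr0.
Qed.
HB.instance Definition _ S T := GRing.isZmodMorphism.Build
  {ffun edge (delete S) -> int} {ffun edge (delete T) -> int}
  (@transport S T) (@transport_additive S T).

(** The inclusion of H_1(G \ T) in H_1(G \ S), for S contained in T. *)
Definition H1_incl S T (c : H1 (delete T)) : H1 (delete S) :=
  if S \subset T then insubd 0 (transport S (ker_val c)) else 0.

Lemma sum_edge_delete S (F : edge G -> int) :
  \sum_(e : edge (delete S)) F (val e) = \sum_(e | e \notin S) F e.
Proof.
rewrite [RHS](reindex_omap (val : edge (delete S) -> edge G) insub) /=.
  by apply: eq_bigl => e; rewrite valK eqxx (valP e).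
by move=> e eS; rewrite (insubT (fun e => e \notin S) eS).
Qed.

Lemma boundary_transport S T (c : {ffun edge (delete T) -> int}) :
  (forall e, val e \in S -> c e = 0) -> boundary (transport S c) = boundary c.
Proof.
move=> cS; apply/ffunP => v; rewrite /boundary !sum_ffunE.
pose F e : int := oapp c 0 (insub e)
  * ((head_of e == v)%:R - (tail_of e == v)%:R).
transitivity (\sum_(e : edge (delete S)) F (val e)).
  by apply: eq_bigr => e _; rewrite !ffunE.
transitivity (\sum_(e : edge (delete T)) F (val e)); last first.
  by apply: eq_bigr => e _; rewrite ffunE /F valK.
rewrite !sum_edge_delete !(big_mkcond (fun e => e \notin _)) /=.
apply: eq_bigr => e _; rewrite /F.
have [eT|nT] := boolP (e \in T).
  by rewrite insubF ?eT // mul0r if_same.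
rewrite (insubT (fun e => e \notin T) nT) /=; case: ifP => // /negbFE eS.
by rewrite cS ?mul0r.
Qed.

Lemma boundary_transport_sub S T (c : {ffun edge (delete T) -> int}) :
  S \subset T -> boundary (transport S c) = boundary c.
Proof.
move=> /subsetP sST; apply: boundary_transport => e /sST.
by rewrite (negPf (valP e)).
Qed.

Lemma H1_inclE S T (c : H1 (delete T)) :
  S \subset T -> ker_val (H1_incl S c) = transport S (ker_val c).
Proof.
move=> sST; rewrite /H1_incl sST; apply: insubdK.
rewrite unfold_in; apply/eqP/(etrans (boundary_transport_sub _ sST)).
by apply/eqP; case: c.
Qed.

Fact H1_incl_additive S T : zmod_morphism (@H1_incl S T).
Proof.
move=> c d; have [sST|nsST] := boolP (S \subset T); last first.
  by rewrite /H1_incl (negPf nsST) subr0.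
by apply/val_inj; rewrite raddfB /= !H1_inclE // !raddfB.
Qed.
HB.instance Definition _ S T := GRing.isZmodMorphism.Build
  (H1 (delete T)) (H1 (delete S)) (@H1_incl S T) (@H1_incl_additive S T).

(** The projection from H^1(G \ S) to H^1(G \ T), for S contained in T. *)
Definition coH1_proj_cochain S T (c : {ffun edge (delete S) -> int}) :
    coH1 (delete T) :=
  if S \subset T then cls _ (transport T c) else 0.

Fact coH1_proj_cochain_additive S T : zmod_morphism (@coH1_proj_cochain S T).
Proof.
move=> c d; rewrite /coH1_proj_cochain; case: ifP => _; last by rewrite subr0.
by rewrite !raddfB.
Qed.
HB.instance Definition _ S T := GRing.isZmodMorphism.Build
  {ffun edge (delete S) -> int} (coH1 (delete T))
  (@coH1_proj_cochain S T) (@coH1_proj_cochain_additive S T).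

Fact coH1_proj_rel S T (c : {ffun edge (delete S) -> int}) :
  (exists g, c = cobound g) -> coH1_proj_cochain T c = 0.
Proof.
case=> g ->; rewrite /coH1_proj_cochain; case: ifP => // sST.
apply: cls_rel; exists g; apply/ffunP => e; rewrite !ffunE.
have eS : val e \notin S by apply: contra (valP e); apply: (subsetP sST).
by rewrite (insubT (fun e => e \notin S) eS) /= ffunE.
Qed.

Definition coH1_proj S T : {additive coH1 (delete S) -> coH1 (delete T)} :=
  qlift (@coH1_proj_rel S T).

(** The functional [<_, e>] on H_1(G \ S). *)
Definition edge_pairing S (e : edge G) (c : H1 (delete S)) : int :=
  oapp (ker_val c) 0 (insub e).

Fact edge_pairing_additive S e : zmod_morphism (@edge_pairing S e).
Proof.
move=> c d; rewrite /edge_pairing /=.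
by case: insub => [e'|] /=; rewrite ?ffunE ?subr0.
Qed.
HB.instance Definition _ S e := GRing.isZmodMorphism.Build
  (H1 (delete S)) int (@edge_pairing S e) (@edge_pairing_additive S e).

Definition is_interior S T e q q'
    (f : {additive ext_power (H1 (delete S)) q -> ext_power (H1 (delete T)) q'}) :=
  forall x, ext_map (@H1_incl S T) q' (f x) = contract (@edge_pairing S e) q q' x.

(** The interior product with [e], which takes its values in the exterior power
    of the subgroup H_1(G \ T) of H_1(G \ S), where T = S + e.  Such a map
    exists and is unique as soon as some [c] in H_1(G \ S) has [<c, e> = 1], see
    [interiorP] and [interior_unique], i.e., when [e] is not a bridge of
    G \ S. *)
Definition interior S T e q q' :
    {additive ext_power (H1 (delete S)) q -> ext_power (H1 (delete T)) q'} :=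
  if pselect (exists f, @is_interior S T e q q' f) is left ex_f
  then projT1 (cid ex_f) else \0.

Section InteriorExists.
Variables (S : {set edge G}) (e : edge G) (c0 : H1 (delete S)).
Hypothesis (c0e : edge_pairing e c0 = 1).
Let T := e |: S.
Let sST : S \subset T := subsetUr _ _.

Let retract_val (c : H1 (delete S)) : H1 (delete S) :=
  c - c0 *~ edge_pairing e c.

Let retract (c : H1 (delete S)) : H1 (delete T) :=
  insubd 0 (transport T (ker_val (retract_val c))).

Let retractK c : H1_incl S (retract c) = retract_val c.
Proof.
have val0 : edge_pairing e (retract_val c) = 0.
  rewrite /retract_val raddfB raddfMz /=.
  by rewrite c0e intz subrr.
have vT (e' : edge (delete S)) : val e' \in T -> ker_val (retract_val c) e' = 0.
  rewrite !inE (negPf (valP e')) orbF => /eqP e'E.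
  by move: val0; rewrite /edge_pairing -e'E valK.
have cT : transport T (ker_val (retract_val c)) \in kernel (@boundary (delete T)).
  rewrite unfold_in; apply/eqP/(etrans (boundary_transport vT)).
  by apply/eqP; case: (retract_val c).
apply/val_inj; rewrite /= H1_inclE //.
rewrite (insubdK _ cT : ker_val (retract c) = _).
apply/ffunP => e'; rewrite ffunE.
have [eT|nT] := boolP (val e' \in T); first by rewrite insubF ?eT //= vT.
by rewrite (insubT (fun e => e \notin T) nT) /= ffunE /= valK.
Qed.

Let H1_incl_inj : injective (@H1_incl S T).
Proof.
move=> c d /(congr1 (@ker_val _ _ _)); rewrite !H1_inclE // => cd.
apply/val_inj/ffunP => e'.
have e'S : val e' \notin S by apply: contra (valP e'); apply: (subsetP sST).
have := congr1 (fun u : {ffun edge (delete S) -> int} => u (Sub (val e') e'S)) cd.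
by rewrite !ffunE /= valK.
Qed.

Let retract_additive : zmod_morphism retract.
Proof.
move=> c d; apply: H1_incl_inj; rewrite raddfB /= !retractK /retract_val.
rewrite (raddfB (@edge_pairing S e)) /= mulrzBr !opprD !opprK.
by rewrite addrACA.
Qed.

Let retractA : {additive H1 (delete S) -> H1 (delete T)} :=
  HB.pack retract (GRing.isZmodMorphism.Build
    (H1 (delete S)) (H1 (delete T)) retract retract_additive).

Lemma interiorP q q' : is_interior e (interior S T e q q').
Proof.
rewrite /interior; case: pselect => [ex_f|[]]; first by case: (cid ex_f).
exists [the {additive _ -> _} of
  ext_map retractA q' \o contract (@edge_pairing S e) q q'] => x.
pose f := [the {additive _ -> _} of @H1_incl S T \o retractA].
have fE c : f c = c - c0 *~ edge_pairing e c := retractK c.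
apply: etrans (ext_map_contract fE q' x).
rewrite -[LHS]/(ext_map (@H1_incl S T) q' (ext_map retractA q' (contract _ _ _ _))).
move: (contract _ _ _ _) => y; move: y.
apply: (@ext_ext _ _ _
  (fun y => ext_map (@H1_incl S T) q' (ext_map retractA q' y)) (ext_map f q')).
- move=> u v; rewrite (raddfB (ext_map retractA q')).
  exact: (raddfB (ext_map (@H1_incl S T) q')).
- exact: raddfB.
by move=> s; rewrite !ext_mapE; congr (wedge _ _); rewrite -map_comp.
Qed.

Lemma interior_unique q q'
    (f g : {additive ext_power (H1 (delete S)) q -> ext_power (H1 (delete T)) q'}) :
  is_interior e f -> is_interior e g -> f =1 g.
Proof.
move=> fP gP x; have incl_inj : cancel (ext_map (@H1_incl S T) q') (ext_map retractA q').
  apply: (@ext_ext _ _ _ (fun y => ext_map retractA q' (ext_map _ q' y)) id).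
  - move=> u v; rewrite (raddfB (ext_map (@H1_incl S T) q')).
    exact: (raddfB (ext_map retractA q')).
  - by [].
  move=> s; rewrite !ext_mapE -map_comp; congr wedge; apply: map_id_in => c _ /=; apply: H1_incl_inj.
  have c_e : edge_pairing e (H1_incl S c) = 0.
    rewrite /edge_pairing; case: insubP => //= e' _ e'E.
    rewrite H1_inclE // ffunE insubF //.
    apply/negbTE; rewrite negbK; have : e \in T by rewrite !inE eqxx.
    by rewrite -[X in X \in T]e'E.
  by rewrite retractK /retract_val c_e mulr0z subr0.
by apply: (can_inj incl_inj); rewrite fP gP.
Qed.
End InteriorExists.

(** The group C^(2p,q,r). *)
Definition cks (p : nat) (q r : int) : zmodType :=
  dsum (fun S : {S | S \in faces G p} =>
    tensor (ext_power (H1 (delete (val S))) q)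
           (ext_power (coH1 (delete (val S))) r)).

(** The differential from C^(2p,q,r) to C^(2p+2,q',r); it is only of interest
    for [q' = q - 1], being zero otherwise. *)
Definition cks_diff (p : nat) (q q' r : int) (x : cks p q r) : cks p.+1 q' r :=
  finfun (fun T : {T | T \in faces G p.+1} =>
    \sum_(S : {S | S \in faces G p})
      \sum_(e | (e \notin val S) && (val T == e |: val S))
        tensor_map (interior (val S) (val T) e q q')
                   (ext_map (coH1_proj (val S) (val T)) r) (x S)).

Fact cks_diff_additive p q q' r : zmod_morphism (@cks_diff p q q' r).
Proof.
move=> x y; apply/ffunP => T; rewrite dsumB !ffunE -sumrB.
apply: eq_bigr => S _; rewrite -sumrB; apply: eq_bigr => e _.
by rewrite dsumB raddfB.
Qed.
HB.instance Definition _ p q q' r := GRing.isZmodMorphism.Build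
  (cks p q r) (cks p.+1 q' r) (@cks_diff p q q' r) (@cks_diff_additive p q q' r).

(** The complex I^(k,l). *)
Definition cks_piece (k l : nat) : complex :=
  @Complex (fun p => cks p (k%:Z - p%:Z) l)
    (fun p => @cks_diff p (k%:Z - p%:Z) (k%:Z - p.+1%:Z) l).
End CKS.

(** * The periodic face ring *)

Section Periodic.
Variable G : graph.

(** Monomials in the variables [e_i], encoded as [(i, e)]. *)
Definition permon : choiceType := {cmonom (int * edge G)%type}.

(** The support is [{e_(I e) | e in S}] for some face [S] and some [I]. *)
Definition per_face (m : permon) : Prop :=
  exists p S (I : edge G -> int), S \in faces G p /\
    forall i e, ((i, e) \in finsupp m) = (e \in S) && (i == I e).

Definition per_index (k : int) : pred permon :=
  fun m => ((mdeg m)%:Z == k) && `[< per_face m >].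

(** The group SR^(2k), a formal sum being the function giving its coefficients;
    it vanishes for [k < 0]. *)
Definition SRper (k : int) : zmodType := {m | per_index k m} -> int.

(** The coefficient of an arbitrary monomial. *)
Definition SRcoef k (f : SRper k) (m : permon) : int := oapp f 0 (insub m).

(** The coefficient of [m] in the product of [f] with
    [\sum_e <c, e> \sum_i e_i] is the sum of [<c, e> * f_(m / e_i)] over the
    [e_i] dividing [m]. *)
Definition mulH1 k (f : SRper (k - 1)) (c : H1 G) : SRper k := fun m =>
  \sum_(v <- finsupp (val m : permon))
    pairing v.2 c * SRcoef f (divcm (val m) (ucm v)).

Lemma SRcoefD k (f g : SRper k) m : SRcoef (f + g) m = SRcoef f m + SRcoef g m.
Proof. by rewrite /SRcoef; case: insub => //=; rewrite addr0. Qed.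

Lemma SRcoefB k (f g : SRper k) m : SRcoef (f - g) m = SRcoef f m - SRcoef g m.
Proof. by rewrite /SRcoef; case: insub => //=; rewrite subr0. Qed.

Fact mulH1Dl k c : {morph (@mulH1 k)^~ c : f g / f + g}.
Proof.
move=> f g; apply/funext => m; rewrite -[RHS]/(mulH1 f c m + mulH1 g c m).
rewrite /mulH1 -big_split /=.
by apply: eq_bigr => v _; rewrite SRcoefD mulrDr.
Qed.

Fact mulH1Dr k f : {morph @mulH1 k f : c d / c + d}.
Proof.
move=> c d; apply/funext => m; rewrite -[RHS]/(mulH1 f c m + mulH1 f d m).
rewrite /mulH1 -big_split /=.
by apply: eq_bigr => v _; rewrite raddfD mulrDl.
Qed.

Definition mulH1_tensor k : {additive tensor (SRper (k - 1)) (H1 G) -> SRper k} :=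
  tensor_lift (@mulH1Dl k) (@mulH1Dr k).

Lemma mulH1_tensorE k f c : mulH1_tensor k (tens f c) = mulH1 f c.
Proof. exact: tensor_liftE. Qed.

(** The group R^(2k). *)
Definition Rper (k : int) : zmodType :=
  zquot (fun x : SRper k => exists t, x = mulH1_tensor k t).

(** The image of [m] under [e_i |-> e_(i - <c, e>)], whose exponent at [e_i] is
    that of [m] at [e_(i + <c, e>)]. *)
Definition translate (c : H1 G) (m : permon) : permon :=
  [cmonom m ((v.1 + pairing v.2 c)%R, v.2)
    | v in [fset ((w.1 - pairing w.2 c)%R, w.2) | w in finsupp m]]%M.

(** [c] maps the sum of the [f_m * m] to the sum of the [f_m * translate c m]. *)
Definition SRact k (c : H1 G) (f : SRper k) : SRper k := fun m =>
  SRcoef f (translate (- c) (val m)).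

Lemma translateE c m v : translate c m v = m (v.1 + pairing v.2 c, v.2).
Proof.
rewrite cmE fsfun_fun; case: ifP => // /negbT nv; apply/esym/eqP.
rewrite cmE_eq0; apply: contra nv => mv; apply/imfsetP; exists (v.1 + pairing v.2 c, v.2) => //=.
by rewrite addrK; case: v {mv}.
Qed.

Lemma mem_translate c m v :
  (v \in finsupp (translate c m)) = ((v.1 + pairing v.2 c, v.2) \in finsupp m).
Proof. by rewrite -!cmE_neq0 translateE. Qed.

Lemma translateK c : cancel (translate c) (translate (- c)).
Proof.
move=> m; apply/eqP/cmP => -[i e]; rewrite !translateE /= raddfN.
by rewrite addrNK.
Qed.

Lemma sum_translate (A : nmodType) c m (F : int * edge G -> A) :
  \sum_(v <- finsupp (translate c m)) F v =
  \sum_(v <- finsupp m) F (v.1 - pairing v.2 c, v.2).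
Proof.
have -> : finsupp (translate c m) =
    [fset (w.1 - pairing w.2 c, w.2) | w in finsupp m]%fset.
  apply/fsetP => v; rewrite mem_translate; apply/idP/imfsetP => /= [mv|[w mw ->]].
    by exists (v.1 + pairing v.2 c, v.2) => //=; rewrite addrK; case: v {mv}.
  by rewrite /= subrK; case: w mw.
rewrite big_imfset //= => -[i e] [j e'] _ _ [/[swap] ->].
by move=> /addIr ->.
Qed.

Lemma per_face_translate c m : per_face m -> per_face (translate c m).
Proof.
move=> [p [S [I [SF mE]]]]; exists p, S, (fun e => I e - pairing e c).
split=> // i e; rewrite mem_translate mE /=.
by rewrite eq_sym -subr_eq eq_sym.
Qed.

Lemma per_index_translate k c m : per_index k (translate c m) = per_index k m.
Proof.
have mdegE : mdeg (translate c m) = mdeg m.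
  rewrite /mdeg sum_translate; apply: eq_bigr => -[i e] _.
  by rewrite translateE /= subrK.
rewrite /per_index mdegE; congr andb; apply/asboolP/asboolP.
  by move=> /(@per_face_translate (- c)); rewrite translateK.
exact: per_face_translate.
Qed.

Fact SRact_additive k c : zmod_morphism (@SRact k c).
Proof.
by move=> f g; apply/funext => m; rewrite /SRact SRcoefB.
Qed.
HB.instance Definition _ k c := GRing.isZmodMorphism.Build
  (SRper k) (SRper k) (@SRact k c) (@SRact_additive k c).

Lemma SRcoef_act k c (f : SRper k) m :
  SRcoef (SRact c f) m = SRcoef f (translate (- c) m).
Proof.
rewrite {1}/SRcoef; case: insubP => [m' _ <- //|nm] /=.
by rewrite /SRcoef insubF // per_index_translate; apply: negbTE.
Qed.

Lemma SRact_mulH1 k c (f : SRper (k - 1)) d :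
  SRact c (mulH1 f d) = mulH1 (SRact c f) d.
Proof.
apply/funext => m; rewrite /SRact {1}/SRcoef.
have tm : per_index k (translate (- c) (val m)).
  by rewrite per_index_translate (valP m).
rewrite (insubT _ tm) /= /mulH1 /= sum_translate; apply: eq_bigr => -[i e] _ /=.
rewrite SRcoef_act; congr (_ * SRcoef f _); apply/eqP/cmP => -[j e'].
rewrite translateE !divcmE translateE !ucmE /= !xpair_eqE /=.
case: (e =P e') => [<-|]; last by rewrite !andbF.
by rewrite !andbT subr_eq.
Qed.

Fact SRact_rel k c (x : SRper k) :
  (exists t, x = mulH1_tensor k t) ->
  (cls (fun x : SRper k => exists t, x = mulH1_tensor k t) \o @SRact k c) x = 0.
Proof.
case=> t ->; rewrite /=; apply: cls_rel.
exists (tensor_map (@SRact (k - 1) c) idfun t).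
pose f := [the {additive _ -> _} of @SRact k c \o mulH1_tensor k].
pose g := [the {additive _ -> _} of mulH1_tensor k \o tensor_map (@SRact (k - 1) c) idfun].
rewrite -[LHS]/(f t) -[RHS]/(g t); apply: tensor_ext => a b.
rewrite -[LHS]/(SRact c (mulH1_tensor k (tens a b))) mulH1_tensorE.
rewrite -[RHS]/(mulH1_tensor k (tensor_map (@SRact (k - 1) c) idfun (tens a b))).
rewrite tensor_mapE mulH1_tensorE.
exact: SRact_mulH1.
Qed.

(** The action of H_1(G) on R^(2k). *)
Definition Ract k (c : H1 G) : {additive Rper k -> Rper k} :=
  qlift (@SRact_rel k c).
End Periodic.

(* Main.v *)
From HB Require Import structures.
From mathcomp Require Import all_boot all_order all_algebra finmap.
From mathcomp Require Import zify ring lra.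
From mathcomp Require Import boolp functions.
From mathcomp.multinomials Require Import monalg.
Require Import Defs.

Set Implicit Arguments.
Unset Strict Implicit.
Unset Printing Implicit Defensive.

Import Order.TTheory GRing.Theory Num.Theory.
Local Open Scope ring_scope.

(** * Creation and annihilation operators *)

(** Put X = Z^E, let L = H_1(G) act on functions on X by translation, and fix [k]. A set of edges
    contains no bond exactly when its complement is connected ([facesE], [conn]). For such a face S
    the exterior powers of H_1(G \ S) are realised inside the exterior algebra of Z^E, as the
    multivectors killed by contraction with the edges of S and with the coboundaries of the vertices
    ([inO], [form_ofK], [of_formK]).

    Both sides of the theorem are compared with a double complex W. An element of W is a function on
    X which has, for every face S and every set A of edges outside S, a value in the exterior power
    of degree k - |S| of H_1(G \ S). The differential [total_diff] adds the interior products from S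
    \ e to S and a Koszul differential built from difference operators on X attached to the edges
    outside S. The total degree is |S| + |A|.

    W resolves R^(2k), placed in degree [k]. For fixed S the Koszul complex has cohomology only at A
    empty, where it consists of functions of the coordinates in S ([column_exact], [noA_inv]). So W
    has the cohomology of a complex of families of multivectors indexed by the periodic faces, with
    the interior products as differential. This is exact for |S| < k by an induction in the style of
    deletion and contraction ([dB_exact]). Its cokernel at |S| = k is R^(2k): it is the square-free
    part of the Koszul complex of SR_per over H_1(G), and a Koszul chain whose boundary is
    square-free can be made square-free by adding a boundary ([koszul_square_free], whence
    [sq_onto], [sq_boundary], [sq_diff]).

    Each term of W is a module of functions on X with L acting by translations, and X has an
    equivariant retraction onto L. Such modules are acyclic for group cohomology
    ([cochain_acyclic]), so H^n(L, R^(2k)) is the cohomology in degree n + k of the L-invariants of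
    W ([periodic_relation]).

    Invariant elements are functions on X / L, which the boundary map embeds in Z^V. There the
    operator attached to an edge is the difference of two operators attached to its ends, so for
    fixed S the complex becomes a Koszul complex in the directions of the vertex coboundaries. Its
    cohomology is the exterior algebra on E \ S modulo these coboundaries, that is, the exterior
    algebra of H^1(G \ S) with coefficients in multivectors ([invariant_column], [kos_cut_linear],
    [theta_ker]). Hence evaluation at the origin followed by [theta] is a surjective chain map from
    the invariants onto the CKS pieces, with acyclic kernel ([theta_cks_diff], [theta_cks_onto],
    [kernel_exact]). In total degree n + k the faces with p edges have |A| = n + k - p, which is the
    index q. The root vertex and the chosen chains make the isomorphism non-canonical. *)

Section Sign.
Variable E : finType.
Implicit Types (e f : E) (C : {set E}).

Definition ltE e f := (enum_rank e < enum_rank f)%N.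

Definition before e C := #|[set c in C | ltE c e]|.

(** The sign of moving [e] from the front of the sorted product of [C] to its place. *)
Definition sg e C : int := (-1) ^+ before e C.

Lemma sg_sq e C : sg e C * sg e C = 1.
Proof. by rewrite /sg -expr2 sqrr_sign. Qed.

Lemma before_setU1 e f C : f \notin C -> before e (f |: C) = (ltE f e + before e C)%N.
Proof.
move=> fC; rewrite /before.
have -> : [set c in f |: C | ltE c e] =
  if ltE f e then f |: [set c in C | ltE c e] else [set c in C | ltE c e].
  apply/setP => x; case: ifP => lfe; rewrite !inE; case: eqP => [->|_] //=;
    by rewrite ?lfe ?andbT ?andbF.
by case: ifP => lfe; rewrite ?cardsU1 ?inE ?(negPf fC) ?lfe.
Qed.

Lemma sg_setU1 e f C : f \notin C -> sg e (f |: C) = (-1) ^+ ltE f e * sg e C.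
Proof. by move=> fC; rewrite /sg before_setU1 // exprD. Qed.

Lemma sg_setU1id e C : sg e (e |: C) = sg e C.
Proof.
rewrite /sg /before; congr (_ ^+ _); apply: eq_card => x; rewrite !inE.
by case: eqP => [->|_] //=; rewrite /ltE ltnn andbF.
Qed.

Lemma sg_setD1 e f C : f \in C -> sg e C = (-1) ^+ ltE f e * sg e (C :\ f).
Proof. by move=> fC; rewrite -{1}(setD1K fC) sg_setU1 // !inE eqxx. Qed.

Lemma sg_setD1id e C : sg e (C :\ e) = sg e C.
Proof.
have [eC|eC] := boolP (e \in C); first by rewrite -{2}(setD1K eC) sg_setU1id.
by rewrite (_ : C :\ e = C) //; apply/setP => x; rewrite !inE; case: eqP => // ->; rewrite (negPf eC).
Qed.

Lemma ltE_swap e f : e != f -> (-1) ^+ ltE e f = - (-1) ^+ ltE f e :> int.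
Proof.
move=> ef; rewrite /ltE; by case: ltngtP => // /val_inj/enum_rank_inj/eqP; rewrite (negPf ef).
Qed.
End Sign.

(** Off-diagonal terms cancel in pairs. The diagonal is a separate hypothesis because
    anticommutation only gives that twice the square is zero. *)
Lemma sum_anti_sq (I : Type) (M : zmodType) (T : I -> {additive M -> M}) (r : seq I) :
  (forall i j x, T i (T j x) = - T j (T i x)) -> (forall i x, T i (T i x) = 0) ->
  forall x, \sum_(i <- r) T i (\sum_(j <- r) T j x) = 0.
Proof.
move=> TT T2; elim: r => [|a r IH] x; first by rewrite big_nil.
rewrite big_cons.
under eq_bigr => i _ do rewrite big_cons raddfD.
rewrite big_split /= IH addr0 big_cons raddfD T2 add0r raddf_sum -big_split big1 // => i _.
by rewrite /= (TT a i) ?addNr ?addrN.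
Qed.

Section Fock.
Variables (E : finType) (V : zmodType).
Implicit Types (e f : E) (C : {set E}) (w : {set E} -> V).

(** A function on the subsets of [E] stands for an element of the exterior algebra of Z^E with
    coefficients in [V], its value at [C] being the coefficient of the sorted product of [C]. Then
    [ann e] is contraction with the coordinate [e] and [cre e] is left multiplication by the basis
    vector [e]. *)
Definition ann e w : {set E} -> V := fun C =>
  if e \in C then 0 else w (e |: C) *~ sg e C.

Definition cre e w : {set E} -> V := fun C =>
  if e \in C then w (C :\ e) *~ sg e C else 0.

Fact ann_additive e : zmod_morphism (ann e).
Proof.
move=> w w'; apply/funext => C; rewrite /ann.
rewrite -[RHS]/(_ - _); case: ifP => _; first by rewrite subr0.
by rewrite -mulrzBl.
Qed.
HB.instance Definition _ e := GRing.isZmodMorphism.Build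
  ({set E} -> V) ({set E} -> V) (ann e) (ann_additive e).

Fact cre_additive e : zmod_morphism (cre e).
Proof.
move=> w w'; apply/funext => C; rewrite /cre.
rewrite -[RHS]/(_ - _); case: ifP => _; last by rewrite subr0.
by rewrite -mulrzBl.
Qed.
HB.instance Definition _ e := GRing.isZmodMorphism.Build
  ({set E} -> V) ({set E} -> V) (cre e) (cre_additive e).

Lemma ann_sq e w : ann e (ann e w) = 0.
Proof. by apply/funext => C; rewrite /ann setU11 mul0rz if_same. Qed.

Lemma cre_sq e w : cre e (cre e w) = 0.
Proof. by apply/funext => C; rewrite /cre !inE eqxx /= mul0rz if_same. Qed.

Lemma ann_anti e f w : ann e (ann f w) = - ann f (ann e w).
Proof.
have [->|ef] := eqVneq e f; first by rewrite ann_sq oppr0.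
apply/funext => C; rewrite -[RHS]/(- _) /ann !inE (negPf ef) eq_sym (negPf ef) /=.
case: ifP => eC; case: ifP => fC; rewrite ?mul0rz ?oppr0 //.
rewrite (setUCA [set f]) -!mulrzA -mulrNz; congr (_ *~ _).
by rewrite !sg_setU1 ?eC ?fC // (ltE_swap ef); ring.
Qed.

Lemma cre_anti e f w : cre e (cre f w) = - cre f (cre e w).
Proof.
have [->|ef] := eqVneq e f; first by rewrite cre_sq oppr0.
apply/funext => C; rewrite -[RHS]/(- _) /cre !inE (negPf ef) eq_sym (negPf ef) /=.
case: ifP => eC; case: ifP => fC; rewrite ?mul0rz ?oppr0 //.
rewrite (_ : C :\ e :\ f = C :\ f :\ e); last by rewrite !setDDl setUC.
rewrite -!mulrzA -mulrNz; congr (_ *~ _).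
rewrite (sg_setD1 e fC) (sg_setD1 f eC) (ltE_swap ef); ring.
Qed.

(** The Clifford relation between contraction and multiplication. *)
Lemma ann_cre e f w : ann e (cre f w) = (if e == f then w else 0) - cre f (ann e w).
Proof.
apply/funext => C; rewrite -[RHS]/(_ - _) /ann /cre; have [<-|ef] := eqVneq e f.
  have [eC|neC] := boolP (e \in C).
    by rewrite !inE eqxx /= setD1K // -mulrzA sg_setD1id sg_sq mulr1z subrr.
  by rewrite setU11 setU1K // -mulrzA sg_setU1id sg_sq mulr1z subr0.
rewrite -[(0 : {set E} -> V) C]/(0 : V) sub0r !inE ?(eq_sym f e) ?(negPf ef) /=.
have [eC|neC] := boolP (e \in C); have [fC|nfC] := boolP (f \in C);
  rewrite ?mul0rz ?oppr0 //.
have -> : (e |: C) :\ f = e |: (C :\ f).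
  apply/setP => x; rewrite !inE; case: (x =P f) => //= ->.
  by rewrite eq_sym (negPf ef).
rewrite -!mulrzA -mulrNz; congr (_ *~ _).
rewrite sg_setU1 // (sg_setD1 e fC) (ltE_swap ef).
have x2 : (-1) ^+ ltE f e * (-1) ^+ ltE f e = 1%R :> int by rewrite -expr2 sqrr_sign.
move: ((-1) ^+ ltE f e) x2 => t x2; rewrite -[RHS]mul1r -x2; ring.
Qed.

Lemma ann_creid e w : ann e (cre e w) = w - cre e (ann e w).
Proof. by rewrite ann_cre eqxx. Qed.

Lemma ann_creN e f w : e != f -> ann e (cre f w) = - cre f (ann e w).
Proof. by move=> ef; rewrite ann_cre (negPf ef) sub0r. Qed.

Lemma ann_eq0 w C : (forall e, e \in C -> ann e w = 0) -> C != set0 -> w C = 0.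
Proof.
move=> w0 /set0Pn[e eC]; have := congr1 (fun u => u (C :\ e)) (w0 e eC).
rewrite /ann !inE eqxx /= setD1K // => /(congr1 (fun v => v *~ sg e (C :\ e))).
by rewrite -mulrzA sg_sq mulr1z mul0rz.
Qed.

Definition vac (v : V) : {set E} -> V := fun C => if C == set0 then v else 0.

Fact vac_additive : zmod_morphism vac.
Proof.
move=> v v'; apply/funext => C; rewrite -[RHS]/(_ - _) /vac.
by case: ifP => _ //; rewrite subr0.
Qed.
HB.instance Definition _ := GRing.isZmodMorphism.Build
  V ({set E} -> V) vac vac_additive.

Lemma ann_vac e v : ann e (vac v) = 0.
Proof.
apply/funext => C; rewrite /ann /vac; case: ifP => // _; case: eqP => [C0|_].
  by have := setU11 e C; rewrite C0 inE.
by rewrite mul0rz.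
Qed.

Definition annv (phi : E -> int) w : {set E} -> V := \sum_e ann e w *~ phi e.
Definition crev (u : E -> int) w : {set E} -> V := \sum_e cre e w *~ u e.

Fact annv_additive phi : zmod_morphism (annv phi).
Proof. by move=> w w'; rewrite /annv -sumrB; apply: eq_bigr => e _; rewrite raddfB mulrzBl. Qed.
HB.instance Definition _ phi := GRing.isZmodMorphism.Build
  ({set E} -> V) ({set E} -> V) (annv phi) (annv_additive phi).

Fact crev_additive u : zmod_morphism (crev u).
Proof. by move=> w w'; rewrite /crev -sumrB; apply: eq_bigr => e _; rewrite raddfB mulrzBl. Qed.
HB.instance Definition _ u := GRing.isZmodMorphism.Build
  ({set E} -> V) ({set E} -> V) (crev u) (crev_additive u).

Lemma ann_annv e phi w : ann e (annv phi w) = - annv phi (ann e w).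
Proof.
rewrite /annv raddf_sum -sumrN; apply: eq_bigr => f _.
by rewrite raddfMz /= ann_anti mulNrz.
Qed.

Lemma cre_crev e u w : cre e (crev u w) = - crev u (cre e w).
Proof.
rewrite /crev raddf_sum -sumrN; apply: eq_bigr => f _.
by rewrite raddfMz /= cre_anti mulNrz.
Qed.

Lemma ann_crev e u w : ann e (crev u w) = w *~ u e - crev u (ann e w).
Proof.
rewrite /crev raddf_sum -sumrN /= (bigD1 e) //= [in RHS](bigD1 e) //= addrA; congr (_ + _).
  by rewrite raddfMz /= ann_creid mulrzBl.
by apply: eq_bigr => f fe; rewrite raddfMz /= ann_creN 1?eq_sym // mulNrz.
Qed.

Lemma annv_crev phi u w :
  annv phi (crev u w) = w *~ (\sum_e phi e * u e) - crev u (annv phi w).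
Proof.
rewrite [LHS]/annv.
under eq_bigr => e _ do rewrite ann_crev mulrzBl -mulrzA mulrC.
rewrite sumrB mulrz_sumr; congr (_ - _).
by rewrite /annv raddf_sum; apply: eq_bigr => e _; rewrite raddfMz.
Qed.

Lemma annv_cre phi e w : annv phi (cre e w) = w *~ phi e - cre e (annv phi w).
Proof.
rewrite /annv (bigD1 e) //= [in RHS](bigD1 e) //= raddfD /= opprD addrA; congr (_ + _).
  by rewrite raddfMz ann_creid mulrzBl.
rewrite raddf_sum -sumrN; apply: eq_bigr => f fe.
by rewrite raddfMz ann_creN // mulNrz.
Qed.

Lemma crev_anti u u' w : crev u (crev u' w) = - crev u' (crev u w).
Proof.
rewrite [LHS]/crev.
under eq_bigr => e _ do rewrite cre_crev mulNrz.
rewrite sumrN; congr (- _); rewrite [crev u w]/crev raddf_sum.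
by apply: eq_bigr => e _; rewrite raddfMz.
Qed.

Lemma crev_sq u w : crev u (crev u w) = 0.
Proof.
(* Each summand is written as [crev] of a vector supported at [e], so that anticommutation is an
   instance of [crev_anti]. *)
pose T e := [the {additive _ -> _} of fun w => crev (fun f => (f == e)%:R * u e) w].
have TE e x : T e x = cre e x *~ u e.
  rewrite /T /= /crev (bigD1 e) //= eqxx mul1r big1 ?addr0 // => f /negPf->.
  by rewrite mul0r mulr0z.
have T0 : crev u w = \sum_e T e w by apply: eq_bigr => e _; rewrite TE.
rewrite {1}/crev T0; under eq_bigr => e _ do rewrite -TE.
apply: sum_anti_sq => [e f x|e x]; first exact: crev_anti.
by rewrite !TE raddfMz /= cre_sq !mul0rz.
Qed.
End Fock.

(** * Cycles, cuts and faces *)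

Section GraphLemmas.
Variable G : graph.
Local Notation E := (edge G).
Local Notation X := {ffun E -> int}.
Implicit Types (S T : {set E}) (e : E) (v : vertex G) (c : X).

Definition inc v e : int := (head_of e == v)%:R - (tail_of e == v)%:R.

Lemma boundaryE c v : boundary c v = \sum_e c e * inc v e.
Proof. by rewrite /boundary sum_ffunE; apply: eq_bigr => e _; rewrite ffunE. Qed.

Definition delt e : X := [ffun x => (x == e)%:R].

Lemma boundary_delt e v : boundary (delt e) v = inc v e.
Proof.
rewrite boundaryE (bigD1 e) //= ffunE eqxx mul1r big1 ?addr0 // => f fe.
by rewrite ffunE (negPf fe) mul0r.
Qed.

Definition off S c := forall e, e \in S -> c e = 0.

Local Notation adj S := (@adjacent (delete S)).

Lemma adjP S v w : reflect (exists2 e, e \notin S &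
  (tail_of e = v /\ head_of e = w) \/ (tail_of e = w /\ head_of e = v)) (adj S v w).
Proof.
apply: (iffP existsP) => [[[e eS] /= /orP[]/andP[/eqP<- /eqP<-]]|[e eS]].
- by exists e => //; left.
- by exists e => //; right.
by move=> H; exists (Sub e eS); apply/orP; case: H => -[/= -> ->]; rewrite !eqxx; [left|right].
Qed.

Lemma adj_sym S : symmetric (adj S).
Proof. by move=> v w; apply/adjP/adjP => -[e eS] [] H; exists e => //; [right|left|right|left]. Qed.

Lemma connect_adj_sym S : connect_sym (adj S).
Proof. exact/sym_connect_sym/adj_sym. Qed.

Definition conn S : bool := [forall v, forall w, connect (adj S) v w].

Lemma connP S : reflect (forall v w, connect (adj S) v w) (conn S).
Proof.
by apply: (iffP forallP) => [H v|H v]; [exact/forallP|exact/forallP].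
Qed.

Lemma connect_adj_mono S T : T \subset S -> subrel (connect (adj S)) (connect (adj T)).
Proof.
move=> TS; apply: connect_sub => v w /adjP[e eS H]; apply: connect1; apply/adjP.
by exists e => //; apply: contra eS; exact: (subsetP TS).
Qed.

Lemma conn_mono S T : T \subset S -> conn S -> conn T.
Proof. by move=> TS /connP H; apply/connP => v w; exact: connect_adj_mono (H v w). Qed.

Lemma connect_chain S v w : connect (adj S) v w -> exists2 c, off S c &
  forall x, boundary c x = (x == w)%:R - (x == v)%:R.
Proof.
case/connectP => p; elim: p v => [|u p IH] v /=.
  move=> _ ->; exists 0 => [e _|x]; first by rewrite ffunE.
  by rewrite raddf0 ffunE subrr.
case/andP => /adjP[e eS H] /IH{IH}IH /IH[c cS cb].
case: H => -[te he].
  exists (c + delt e) => [f fS|x].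
    rewrite !ffunE cS // add0r; case: eqP fS => // ->; by rewrite (negPf eS).
  rewrite raddfD ffunE /= cb boundary_delt /inc te he.
  by rewrite [x == u]eq_sym [x == v]eq_sym; ring.
exists (c - delt e) => [f fS|x].
  rewrite !ffunE cS // add0r; case: eqP fS => [->|]; by rewrite ?(negPf eS) ?oppr0.
rewrite raddfB !ffunE /= cb boundary_delt /inc te he.
by rewrite [x == u]eq_sym [x == v]eq_sym; ring.
Qed.

(** The functional [e] is a combination of the functionals in [S] and of the
    coboundaries of the vertices. *)
Definition dependent S e := exists g : {ffun vertex G -> int},
  forall x, x \notin S -> cobound g x = (x == e)%:R.

(** A chain from the head to the tail that avoids [e] is closed up by [e] itself. *)
Lemma ends_connect_cycle S e : connect (adj (e |: S)) (head_of e) (tail_of e) ->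
  exists c, [/\ boundary c = 0, off (S :\ e) c & c e = 1].
Proof.
case/connect_chain => c cS cb; exists (c + delt e); split.
- apply/ffunP => x; rewrite raddfD /= ffunE cb boundary_delt /inc ffunE.
  by rewrite [x == head_of e]eq_sym [x == tail_of e]eq_sym; ring.
- move=> f; rewrite !inE => /andP[fe fS].
  by rewrite !ffunE (negPf fe) cS ?addr0 // !inE fS orbT.
- by rewrite !ffunE eqxx cS ?add0r // setU11.
Qed.

(** The potential is the indicator of the component of the head: among the edges outside [S], only
    [e] leaves that component. *)
Lemma ends_disconnect_dependent S e : ~~ connect (adj (e |: S)) (head_of e) (tail_of e) ->
  dependent S e.
Proof.
move=> nc; exists [ffun v => (connect (adj (e |: S)) (head_of e) v)%:R] => x xS.
rewrite !ffunE; case: (x =P e) => [->|xe]; first by rewrite connect0 (negPf nc) subr0.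
rewrite -(@same_connect_r _ _ (@connect_adj_sym _) (tail_of x)) ?subrr //.
apply: connect1; apply/adjP; exists x; last by left.
by rewrite !inE negb_or xS andbT; apply/eqP.
Qed.

Lemma dependent_or_cycle S e :
  dependent S e \/ exists c, [/\ boundary c = 0, off (S :\ e) c & c e = 1].
Proof.
have [/ends_connect_cycle H|/ends_disconnect_dependent H] :=
  boolP (connect (adj (e |: S)) (head_of e) (tail_of e)); [by right|by left].
Qed.

Lemma sum_cobound (g : {ffun vertex G -> int}) c :
  \sum_e c e * cobound g e = \sum_v g v * boundary c v.
Proof.
under [RHS]eq_bigr => v _ do rewrite boundaryE mulr_sumr.
rewrite exchange_big; apply: eq_bigr => e _.
rewrite ffunE /inc.
have pick w : g w = \sum_v g v * (w == v)%:R.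
  rewrite (bigD1 w) //= eqxx mulr1 big1 ?addr0 // => v vw.
  by rewrite eq_sym (negPf vw) mulr0.
rewrite (pick (head_of e)) (pick (tail_of e)) -sumrB mulr_sumr.
by apply: eq_bigr => v _; ring.
Qed.

(** In the pairing of the cycle with the coboundary that witnesses dependence, which is zero, only
    the coordinate at [e] survives. *)
Lemma dependent_cycle S e c : dependent S e -> boundary c = 0 -> off S c -> c e = 0.
Proof.
case=> g gE cb cS; have := sum_cobound g c; rewrite cb.
rewrite [RHS]big1 => [|v _]; last by rewrite ffunE mulr0.
have [eS _|eS] := boolP (e \in S); first exact: cS.
rewrite (bigD1 e) //= gE // eqxx mulr1 big1 ?addr0 // => f fe.
have [fS|fS] := boolP (f \in S); first by rewrite cS // mul0r.
by rewrite gE // (negPf fe) mulr0.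
Qed.

Lemma dependent_trans S e f : dependent S e -> e \notin S -> dependent (e |: S) f -> dependent S f.
Proof.
move=> [g gE] eS [g' gE']; have [->|fe] := eqVneq f e; first by exists g.
(* Subtracting this multiple of [g] clears the coordinate at [e], the only one outside [S] on which
   [g'] is not controlled. *)
exists (g' - [ffun v => g v * cobound g' e]) => x xS.
have cE y : cobound (g' - [ffun v => g v * cobound g' e]) y
    = cobound g' y - cobound g y * cobound g' e by rewrite !ffunE; ring.
rewrite cE gE //; have [->|xe] := eqVneq x e.
  by rewrite mul1r subrr eq_sym (negPf fe).
by rewrite mul0r subr0 gE' // !inE negb_or xe.
Qed.

(** An edge lying on a cycle is not a bridge, so every path through it can be rerouted between its
    two ends. *)
Lemma conn_setU1 S e c : conn S -> boundary c = 0 -> off S c -> c e = 1 -> conn (e |: S).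
Proof.
move=> cS cb co ce.
have ht : connect (adj (e |: S)) (head_of e) (tail_of e).
  apply: contraT => /ends_disconnect_dependent/dependent_cycle/(_ cb co).
  by rewrite ce.
apply/connP => v w; move/connP: cS => /(_ v w); apply: connect_sub v w => v w /adjP[f fS H].
have [fe|fe] := eqVneq f e; last first.
  by apply: connect1; apply/adjP; exists f => //; rewrite !inE negb_or fe.
case: H => -[<- <-]; rewrite fe ?ht //.
by rewrite connect_adj_sym.
Qed.

Lemma conn_cycle S e : conn (e |: S) -> e \notin S ->
  exists c, [/\ boundary c = 0, off S c & c e = 1].
Proof.
move=> /connP/(_ (head_of e) (tail_of e))/ends_connect_cycle[c [cb co ce]] eS.
exists c; split=> // f fS; apply: co; rewrite !inE fS andbT.
by apply: contraNneq eS => <-.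
Qed.

Lemma nconn_dependent S e : conn S -> ~~ conn (e |: S) -> e \notin S -> dependent S e.
Proof.
move=> cS nc eS; case: (dependent_or_cycle S e) => // -[c [cb co ce]].
case/negP: nc; apply: (conn_setU1 cS cb _ ce) => f fS; apply: co.
by rewrite !inE fS andbT; apply: contraNneq eS => <-.
Qed.

Lemma conn_dual_cycle S e : conn S -> e \in S ->
  exists c, [/\ boundary c = 0, off (S :\ e) c & c e = 1].
Proof.
by move=> cS eS; apply: conn_cycle; rewrite ?setD1K // !inE eqxx.
Qed.

Lemma conn_n_comp S (v0 : vertex G) : conn S = (num_components (delete S) == 1)%N.
Proof.
rewrite /num_components; apply/connP/eqP => [H|H v w].
  rewrite -(n_comp_connect (@connect_adj_sym S) v0).
  by apply: eq_n_comp_r => w; rewrite !inE (H v0 w).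
apply/(fingraph.rootP (@connect_adj_sym S)).
have /card_le1_eqP H1 : (#|predI (roots (adj S)) predT| <= 1)%N.
  by rewrite -[X in (X <= 1)%N]/(n_comp (adj S) predT) H.
apply: H1.
- by rewrite !inE roots_root //; exact: connect_adj_sym.
- by rewrite !inE roots_root //; exact: connect_adj_sym.
Qed.

Lemma adj_set0 : @adjacent G =2 adj set0.
Proof.
move=> v w; apply/existsP/adjP => [[e /orP[]/andP[/eqP<- /eqP<-]]|[e _ H]].
- by exists e; rewrite ?inE //; left.
- by exists e; rewrite ?inE //; right.
by exists e; apply/orP; case: H => -[/= -> ->]; rewrite !eqxx; [left|right].
Qed.

Hypothesis G_connected : connected G.

Lemma connected_vertex : exists v : vertex G, True.
Proof.
have : num_components G != 0%N by rewrite G_connected.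
rewrite /num_components /n_comp_mem.
by rewrite -lt0n => /card_gt0P[v _]; exists v.
Qed.

Lemma connected_conn0 : conn set0.
Proof.
have [v0 _] := connected_vertex; rewrite (conn_n_comp _ v0) -G_connected.
by apply/eqP/esym/eq_n_comp/eq_connect/adj_set0.
Qed.

(** A set whose deletion disconnects the graph contains a minimal such set, which is a bond;
    conversely deletion of a bond disconnects. *)
Lemma facesE p S : (S \in faces G p) = (#|S| == p) && conn S.
Proof.
have [v0 _] := connected_vertex; rewrite inE; congr andb.
apply/forallP/idP => [H|cS B]; last first.
  apply/implyP => /minsetP[nB _]; apply/negP => BS.
  have := conn_mono BS cS; rewrite (conn_n_comp _ v0) => /eqP cB.
  by move: nB; rewrite cB G_connected.
apply: contraT => ncS.
have [|B BP BS] := @minset_exists _ (fun S => num_components G < num_components (delete S))%N S.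
  rewrite G_connected ltn_neqAle eq_sym -(conn_n_comp _ v0) ncS /=.
  rewrite /num_components /n_comp_mem; apply/card_gt0P; exists (fingraph.root (adj S) v0).
  by rewrite inE /= roots_root //; exact: connect_adj_sym.
by have := H B; rewrite /bond BP BS.
Qed.
End GraphLemmas.

(** * Exactness of the complex of multivectors on the faces *)

Section Multivectors.
Variable G : graph.
Local Notation E := (edge G).
Local Notation X := {ffun E -> int}.
Local Notation Om := ({set E} -> int).
Implicit Types (S T A U C : {set E}) (e f : E) (w : Om) (p c : X).

(** For a face [S], these are the multivectors of H_1(G \ S). *)
Definition inO S w := (forall e, e \in S -> ann e w = 0) /\
  (forall v : vertex G, annv (inc v) w = 0).

Lemma inO0 S : inO S 0.
Proof. by split=> *; rewrite raddf0. Qed.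

Lemma inOB S w w' : inO S w -> inO S w' -> inO S (w - w').
Proof.
move=> [H1 H2] [H1' H2']; split=> [e eS|v]; rewrite raddfB /=.
  by rewrite H1 // H1' // subrr.
by rewrite H2 H2' subrr.
Qed.

Lemma inOD S w w' : inO S w -> inO S w' -> inO S (w + w').
Proof. by move=> H H'; rewrite -[w']opprK; apply: inOB => //; rewrite -sub0r; apply: inOB => //; exact: inO0. Qed.

Lemma inO_sum S (I : Type) (r : seq I) (P : pred I) (F : I -> Om) :
  (forall i, P i -> inO S (F i)) -> inO S (\sum_(i <- r | P i) F i).
Proof. by move=> H; elim/big_ind: _ => //; [exact: inO0|exact: inOD]. Qed.

Lemma inOMz S w n : inO S w -> inO S (w *~ n).
Proof.
move=> [H1 H2]; split=> [e eS|v]; rewrite raddfMz /=.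
  by rewrite H1 ?mul0rz.
by rewrite H2 mul0rz.
Qed.

Lemma inO_sub S T w : S \subset T -> inO T w -> inO S w.
Proof. by move=> ST [H1 H2]; split=> // e eS; apply/H1/(subsetP ST). Qed.

Lemma inO_ann S e w : inO S w -> inO (e |: S) (ann e w).
Proof.
move=> [H1 H2]; split=> [f|v].
  rewrite !inE => /orP[/eqP->|fS]; first exact: ann_sq.
  by rewrite ann_anti H1 // raddf0 oppr0.
by have := ann_annv e (inc v) w; rewrite H2 raddf0 => /eqP; rewrite eq_sym oppr_eq0 => /eqP.
Qed.

(** The functional [e] is a combination of vertex coboundaries and of functionals in [S], and
    contraction with each of these kills [w]. *)
Lemma inO_dependent S e w : dependent S e -> inO S w -> ann e w = 0.
Proof.
move=> [g gE] [H1 H2]; have [/H1 //|eS] := boolP (e \in S).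
have : \sum_v annv (inc v) w *~ g v = 0 by rewrite big1 // => v _; rewrite H2 mul0rz.
rewrite /annv; under eq_bigr => v _ do rewrite mulrz_suml.
rewrite exchange_big (bigD1 e) //= [X in _ + X]big1 ?addr0 => [|f fe].
  under eq_bigr => v _ do rewrite -mulrzA.
  rewrite -mulrz_sumr => H; rewrite -[LHS]mulr1z -[RHS]H; congr (_ *~ _); apply/esym.
  apply: etrans (_ : cobound g e = _); last by rewrite gE // eqxx.
  apply/esym; rewrite -[LHS]mul1r.
  have := sum_cobound g (delt e).
  rewrite (bigD1 e) //= big1 ?addr0 => [|f fe]; last by rewrite ffunE (negPf fe) mul0r.
  by rewrite ffunE eqxx => ->; apply: eq_bigr => v _; rewrite boundary_delt mulrC.
have [/H1 ->|fS] := boolP (f \in S); first by rewrite big1 // => v _; rewrite !mul0rz.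
under eq_bigr => v _ do rewrite -mulrzA.
rewrite -mulrz_sumr (_ : \sum_v _ = 0) ?mulr0z //.
apply: etrans (_ : cobound g f = _); last by rewrite gE // (negPf fe).
apply/esym; rewrite -[LHS]mul1r.
have := sum_cobound g (delt f).
rewrite (bigD1 f) //= [X in _ + X]big1 ?addr0 => [|h hf]; last by rewrite ffunE (negPf hf) mul0r.
by rewrite ffunE eqxx => ->; apply: eq_bigr => v _; rewrite boundary_delt mulrC.
Qed.

Lemma inO_crev S c w : boundary c = 0 -> off S c -> inO S w -> inO S (crev c w).
Proof.
move=> cb cS [H1 H2]; split=> [e eS|v].
  by rewrite ann_crev cS // mulr0z H1 // raddf0 subrr.
rewrite annv_crev H2 raddf0 subr0 (_ : \sum_e _ = 0) ?mulr0z //.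
transitivity (boundary c v); last by rewrite cb ffunE.
rewrite boundaryE.
by apply: eq_bigr => e _; rewrite mulrC.
Qed.

(** This is the map induced on multivectors by the projection of cycles along [c] onto those with
    zero coordinate at [e]. *)
Lemma crev_ann_inO S e c w : boundary c = 0 -> off S c -> c e = 1 ->
  inO S w -> inO (e |: S) (w - crev c (ann e w)).
Proof.
move=> cb cS ce wS; split=> [f|v].
  rewrite !inE raddfB /= ann_crev => /orP[/eqP->|fS].
    by rewrite ce mulr1z ann_sq raddf0 subr0 subrr.
  case: wS => H1 H2; rewrite cS // mulr0z H1 // (ann_anti f e) H1 //.
  by rewrite !(raddf0, oppr0, subrr).
rewrite raddfB /=; case: (wS) => _ ->.
have [_ H] := inO_crev cb cS (inO_sub (subsetUr [set e] S) (inO_ann e wS)).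
by rewrite H subrr.
Qed.

(** ** The complex *)

(** By [fc_inv], [y S] is a function of the labels in Z^S only, so a face cochain is a family of
    multivectors indexed by the periodic faces. Its degree is [#|S|], and [k] is a weight preserved
    by [dB]. *)
Record face_cochain k (y : {set E} -> X -> Om) : Prop := FaceCochain {
  fc_in : forall S p, inO S (y S p);
  fc_deg : forall S p C, y S p C != 0 -> conn S && (#|C| + #|S| == k)%N;
  fc_inv : forall S e p, e \notin S -> y S (p + delt e) = y S p }.

Definition dB (y : {set E} -> X -> Om) : {set E} -> X -> Om := fun S p =>
  \sum_(e in S) ann e (y (S :\ e) p).

Lemma dBB y y' : dB (y - y') = dB y - dB y'.
Proof.
apply/funext => S; apply/funext => p; rewrite -[RHS]/(_ - _) /dB -sumrB.
by apply: eq_bigr => e _; rewrite -raddfB.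
Qed.

Lemma dB0 : dB 0 = 0.
Proof. by rewrite -[0 in LHS]subr0 dBB subrr. Qed.

Lemma dBD y y' : dB (y + y') = dB y + dB y'.
Proof. by rewrite -{1}[y']opprK dBB -[- y']sub0r dBB dB0 sub0r opprK. Qed.

Lemma dB_sq y : dB (dB y) = 0.
Proof.
apply/funext => S; apply/funext => p; rewrite /dB.
under eq_bigr => e _ do rewrite raddf_sum.
have Q : \sum_(e in S) \sum_(f in S :\ e) ann e (ann f (y (S :\ e :\ f) p)) =
  - \sum_(e in S) \sum_(f in S :\ e) ann e (ann f (y (S :\ e :\ f) p)).
  rewrite [LHS](exchange_big_dep (mem S)) /=; last by move=> e f _ /setD1P[].
  rewrite -sumrN; apply: eq_bigr => f fS; rewrite -sumrN; apply: eq_big => [e|e _].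
    by rewrite !inE fS andbT andbC eq_sym.
  by rewrite ann_anti (_ : S :\ e :\ f = S :\ f :\ e) // !setDDl setUC.
set Q0 := (X in X = - _) in Q; rewrite -/Q0.
apply/funext => C; have QC := congr1 (fun w => w C) Q.
by change (Q0 C = - (Q0 C)) in QC; change (Q0 C = 0%R :> int); lia.
Qed.

Lemma inv_translate (T : Type) (h : X -> T) e :
  (forall p, h (p + delt e) = h p) -> forall p (n : int), h (p + delt e *~ n) = h p.
Proof.
move=> H p; elim/int_rect => [|n IH|n IH]; first by rewrite mulr0z addr0.
  by rewrite -addn1 PoszD mulrzDr addrA H.
by rewrite -[LHS]H -addn1 PoszD opprD mulrzDr mulrN1z !addrA subrK.
Qed.

Lemma ffun_mulrz c n x : (c *~ n) x = c x *~ n.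
Proof. by case: n => n; rewrite ?NegzE ?mulrNz -!pmulrn ?ffunE ffunMnE. Qed.

(** Precomposition with it makes a function independent of the coordinate [e], as [fc_inv] demands
    at sets that do not contain [e]. *)
Definition reset e p : X := p - delt e *~ p e.

Lemma resetE e p x : reset e p x = if x == e then 0 else p x.
Proof.
rewrite !ffunE ffun_mulrz !ffunE; case: eqP => [->|_]; rewrite ?mul0rz ?subr0 //.
by rewrite intz subrr.
Qed.

Lemma reset_delt e p : reset e (p + delt e) = reset e p.
Proof. by apply/ffunP => x; rewrite !resetE !ffunE; case: (x == e); rewrite // addr0. Qed.

Lemma reset_deltC e f p : f != e -> reset e (p + delt f) = reset e p + delt f.
Proof.
move=> fe; apply/ffunP => x; rewrite resetE [RHS]ffunE resetE !ffunE.
by case: (x =P e) => [->|//]; rewrite eq_sym (negPf fe).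
Qed.

Lemma fc_reset k y S e p : face_cochain k y -> e \notin S -> y S (reset e p) = y S p.
Proof. by move=> yk eS; rewrite /reset -mulrNz; apply: inv_translate => q; exact: (fc_inv yk). Qed.

Definition min_card j (y : {set E} -> X -> Om) := forall S p C, y S p C != 0 -> (j <= #|C|)%N.

Section Exactness.
Variables A U : {set E}.

Definition range S := (A \subset S) && (S \subset A :|: U).

(** Exactness in positive multivector degree, restricted to an interval of the lattice of edge sets
    so that the size of [U] can be used for induction. The primitive has degree at least 2 because
    [dB] contracts once. *)
Definition exact_range := forall k (y : {set E} -> X -> Om), face_cochain k y ->
  min_card 1 y ->
  (forall S, ~~ range S -> y S = 0) -> (forall S, range S -> dB y S = 0) ->
  exists y', [/\ face_cochain k y', min_card 2 y', (forall S, ~~ range S -> y' S = 0) &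
                 forall S, range S -> dB y' S = y S].
End Exactness.

Lemma face_cochain0 k : face_cochain k 0.
Proof. by split=> // S p; exact: inO0. Qed.

Lemma face_cochainD k y y' : face_cochain k y -> face_cochain k y' -> face_cochain k (y + y').
Proof.
move=> H H'; split=> [S p|S p C|S e p eS].
- exact: inOD (fc_in H _ _) (fc_in H' _ _).
- rewrite -[(y + y') S p C]/(y S p C + y' S p C) => n0.
  have [y0|] := eqVneq (y S p C) 0; last exact: (fc_deg H).
  by apply: (fc_deg H' (p := p)); move: n0; rewrite y0 add0r.
- by rewrite -[LHS]/(y S _ + y' S _) (fc_inv H) // (fc_inv H').
Qed.

Lemma face_cochain_sub k (Q : pred {set E}) y : face_cochain k y ->
  face_cochain k (fun S p => if Q S then y S p else 0).
Proof.
move=> H; split=> [S p|S p C|S e p eS]; case: ifP => _.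
- exact: fc_in H _ _.
- exact: inO0.
- exact: fc_deg H _ _ _.
- by rewrite eqxx.
- by rewrite (fc_inv H).
- by [].
Qed.

(** Contraction with any edge kills the only component of [y], and a multivector of positive degree
    with this property is zero. *)
Lemma exact_range0 A : (forall e, e \notin A -> dependent A e) -> exact_range A set0.
Proof.
move=> dA k y yk y0 ysup _; exists 0; split=> // [|S]; first exact: face_cochain0.
rewrite /range setU0 -eqEsubset => /eqP<- {S}.
rewrite dB0; apply/funext => p; apply/funext => C; apply/esym.
have [->|C0] := eqVneq C set0.
  by apply/eqP; apply: contraT => /y0; rewrite cards0.
apply: ann_eq0 => // e _; have [eA|/dA eA] := boolP (e \in A).
  by case: (fc_in yk A p) => H _; exact: H.
exact: inO_dependent (fc_in yk A p).
Qed.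

Lemma range_D1 A U e S : e \notin A -> e \in U ->
  range A U S = if e \in S then range (e |: A) (U :\ e) S else range A (U :\ e) S.
Proof.
move=> eA eU; rewrite /range; case: ifPn => eS.
  rewrite subUset sub1set eS /=; congr andb; apply/idP/idP => /subsetP H; apply/subsetP => x /H;
  rewrite !inE; case: (x =P e) => [->|_] //=; by rewrite eU orbT.
congr andb; apply/idP/idP => /subsetP H; apply/subsetP => x xS; have := H _ xS;
  rewrite !inE; case: (x =P e) xS => [->|_ _] //=; by rewrite (negPf eS).
Qed.

Lemma dB_support A U y S : (forall S, ~~ range A U S -> y S = 0) ->
  ~~ (A \subset S) -> dB y S = 0.
Proof.
move=> ysup AS; apply/funext => p; rewrite /dB big1 // => e eS.
rewrite ysup ?raddf0 // /range negb_and; apply/orP; left.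
by apply: contra AS => /subset_trans; apply; exact: subsetDl.
Qed.

Lemma face_cochainB k y y' : face_cochain k y -> face_cochain k y' -> face_cochain k (y - y').
Proof.
move=> H H'; split=> [S p|S p C|S e p eS].
- exact: inOB (fc_in H _ _) (fc_in H' _ _).
- rewrite -[(y - y') S p C]/(y S p C - y' S p C) => n0.
  have [y0|] := eqVneq (y S p C) 0; last exact: (fc_deg H).
  by apply: (fc_deg H' (p := p)); move: n0; rewrite y0 sub0r oppr_eq0.
- by rewrite -[LHS]/(y S _ - y' S _) (fc_inv H) // (fc_inv H').
Qed.

Lemma ann_neq0 e w C : ann e w C != 0 -> e \notin C /\ w (e |: C) != 0.
Proof.
rewrite /ann; case: ifP => // eC n0; split=> //; apply: contraNneq n0 => ->.
by rewrite mul0rz.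
Qed.

Lemma dB_neq0 y S p C : dB y S p C != 0 ->
  exists2 e, e \in S & ann e (y (S :\ e) p) C != 0.
Proof.
rewrite /dB fct_sumE => n0.
have [e /andP[eS en0]|H] := pickP (fun e => (e \in S) && (ann e (y (S :\ e) p) C != 0)).
  by exists e.
case/eqP: n0; rewrite big1 // => e eS; apply/eqP; apply: contraFT (H e) => ->.
by rewrite eS.
Qed.

Lemma face_cochain_dB k y : face_cochain k y -> face_cochain k (dB y).
Proof.
move=> H; split=> [S p|S p C|S e p eS].
- apply: inO_sum => e eS.
  by have := inO_ann e (fc_in H (S :\ e) p); rewrite setD1K.
- case/dB_neq0 => e eS n0; have [eC yn0] := ann_neq0 n0.
  have /andP[cS /eqP<-] := fc_deg H yn0; rewrite cardsU1 eC (cardsD1 e S) eS.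
  rewrite addnA [(#|C| + _)%N]addnC eqxx andbT.
  apply: contraNT n0 => ncS; rewrite (inO_dependent (S := S :\ e)) //; last exact: (fc_in H).
  by apply: nconn_dependent; rewrite ?setD1K // !inE eqxx.
- apply: eq_bigr => f fS; congr ann; rewrite (fc_inv H) //.
  by rewrite !inE (negPf eS) andbF.
Qed.

Lemma min_card_dB j y : min_card j.+1 y -> min_card j (dB y).
Proof.
move=> H S p C /dB_neq0[e eS /ann_neq0[eC /H]].
by rewrite cardsU1 eC.
Qed.

Lemma min_cardD j y y' : min_card j y -> min_card j y' -> min_card j (y + y').
Proof.
move=> H H' S p C; rewrite -[(y + y') S p C]/(y S p C + y' S p C) => n0.
have [y0|/H //] := eqVneq (y S p C) 0; apply: (H' S p).
by move: n0; rewrite y0 add0r.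
Qed.

Lemma min_cardB j y y' : min_card j y -> min_card j y' -> min_card j (y - y').
Proof.
move=> H H' S p C; rewrite -[(y - y') S p C]/(y S p C - y' S p C) => n0.
have [y0|/H //] := eqVneq (y S p C) 0; apply: (H' S p).
by move: n0; rewrite y0 sub0r oppr_eq0.
Qed.

Lemma min_card_sub j (Q : pred {set E}) y : min_card j y ->
  min_card j (fun S p => if Q S then y S p else 0).
Proof. by move=> H S p C; case: ifP => _; [exact: H|rewrite eqxx]. Qed.

(** The sets containing [e] form a subcomplex and those without [e] the quotient; exactness of both
    gives exactness of the interval. *)
Lemma exact_range_dep A U e : e \notin A -> e \in U ->
  exact_range A (U :\ e) -> exact_range (e |: A) (U :\ e) -> exact_range A U.
Proof.
move=> eA eU IH1 IH2 k y yk y0 ysup dy.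
have rE := range_D1 _ eA eU.
pose y1 : {set E} -> X -> Om := fun S p => if e \notin S then y S p else 0.
have [||S|S|y1' [y1k y1m y1sup dy1]] := IH1 k y1.
- exact: face_cochain_sub.
- by apply: (@min_card_sub 1 (fun S => e \notin S)).
- rewrite /y1 => nS; apply/funext => p; case: ifP => // eS; rewrite ysup //.
  by rewrite rE (negPf eS).
- have [eS|eS] := boolP (e \in S).
    by rewrite /range => /andP[_ /subsetP/(_ _ eS)]; rewrite !inE eqxx (negPf eA).
  move=> rS; rewrite -(dy S); last by rewrite rE (negPf eS).
  by apply/funext => p; apply: eq_bigr => f fS; rewrite /y1 !inE (negPf eS) andbF.
(* After subtraction of [dB y1'] nothing remains on the sets of the interval without [e], so the
   rest is closed on those containing [e]. *)
pose y2 : {set E} -> X -> Om := fun S p => if range (e |: A) (U :\ e) S then (y - dB y1') S p else 0.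
have eAS S : range (e |: A) (U :\ e) S -> e \in S.
  by case/andP => /subsetP/(_ e); rewrite setU11 => ->.
have rA S : range A (U :\ e) S -> e \notin S.
  by case/andP => _ /subsetP/(_ e) H; apply/negP => /H; rewrite !inE eqxx (negPf eA).
have [||S|S rS|y2' [y2k y2m y2sup dy2]] := IH2 k y2.
- by apply: face_cochain_sub; apply: face_cochainB => //; exact: face_cochain_dB.
- by apply: min_card_sub; apply: min_cardB => //; exact: min_card_dB.
- by rewrite /y2 => /negPf nS; apply/funext => p; rewrite nS.
- have eS := eAS _ rS; have rS' : range A U S by rewrite rE eS.
  have dd : dB (y - dB y1') S = 0 by rewrite dBB dB_sq subr0; exact: dy.
  rewrite -dd; apply/funext => p; apply: eq_bigr => f fS; congr ann; rewrite /y2.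
  have AS : A \subset S by case/andP: rS; rewrite subUset => /andP[].
  have [fA|fA] := boolP (f \in A).
    have nAS : ~~ (A \subset S :\ f).
      by apply/negP => /subsetP/(_ _ fA); rewrite !inE eqxx.
    rewrite ifN; last by rewrite /range subUset negb_and negb_and nAS orbT.
    rewrite -[RHS]/(y (S :\ f) p - _) (dB_support y1sup) // ysup ?subrr //.
    by rewrite /range (negPf nAS).
  have [fe|fe] := eqVneq f e; last first.
    rewrite ifT //; case/andP: rS => /subsetP H1 H2; apply/andP; split.
      apply/subsetP => x xA; rewrite !inE H1 // andbT; move: xA; rewrite !inE.
      by apply: contraTneq => ->; rewrite negb_or fe.
    exact: subset_trans (subsetDl _ _) H2.
  subst f; rewrite ifN; last by apply/negP => /eAS; rewrite !inE eqxx.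
  have r : range A (U :\ e) (S :\ e).
    case/andP: rS => H1 /subsetP H2; apply/andP; split.
      by rewrite subsetD1 AS.
    apply/subsetP => x; rewrite !inE => /andP[xe /H2]; rewrite !inE (negPf xe) /=.
    by [].
  rewrite -[RHS]/(y (S :\ e) p - _) dy1 // /y1 !inE eqxx /= subrr //.
exists (y1' + y2'); split.
- exact: face_cochainD.
- exact: min_cardD.
- move=> S; rewrite rE => nr; rewrite -[LHS]/(y1' S + y2' S).
  move: nr; case: ifPn => eS nr.
    by rewrite y2sup // y1sup ?addr0 //; apply: contraL eS => /rA.
  by rewrite y1sup // y2sup ?addr0 //; apply: contraNN eS => /eAS.
- move=> S; rewrite dBD rE => r; rewrite -[LHS]/(dB y1' S + dB y2' S).
  move: r; case: ifPn => eS r.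
    rewrite dy2 // /y2; apply/funext => p; rewrite r -[LHS]/(dB y1' S p + (y S p - dB y1' S p)).
    by rewrite addrC subrK.
  rewrite dy1 // (dB_support y2sup) ?addr0; last by rewrite subUset sub1set (negPf eS).
  by apply/funext => p; rewrite /y1 eS.
Qed.

Lemma crev_neq0 u w C : crev u w C != 0 -> exists2 f, f \in C & w (C :\ f) != 0.
Proof.
rewrite /crev fct_sumE => n0.
have [f /andP[fC fn0]|H] := pickP (fun f => (f \in C) && (w (C :\ f) != 0)); first by exists f.
case/eqP: n0; rewrite big1 // => f _; have := H f.
have mz (w' : Om) n : (w' *~ n) C = w' C *~ n.
  by case: n => n; rewrite ?NegzE ?mulrNz -!pmulrn -?[(- _) C]/(- _) natmulfctE.
rewrite mz /cre; case: ifP => //= fC; last by rewrite mul0rz.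
by move=> /negbFE/eqP ->; rewrite !mul0rz.
Qed.

(** Multiplication by the cycle [c] is almost a contracting homotopy between the sets with and
    without [e]. It leaves two errors: at sets containing [e], the dependence on the label of [e];
    at sets without [e], the multivectors that also avoid [e]. Both are cocycles on the interval
    above [e |: A], where the induction hypothesis applies. *)
Lemma exact_range_cycle A U e c : e \notin A -> e \in U ->
  boundary c = 0 -> off (A :|: U :\ e) c -> c e = 1 ->
  exact_range (e |: A) (U :\ e) -> exact_range A U.
Proof.
move=> eA eU cb co ce IH k y yk y0 ysup dy.
have rE := range_D1 _ eA eU.
have rA S : range A (U :\ e) S -> e \notin S.
  by case/andP => _ /subsetP/(_ e) H; apply/negP => /H; rewrite !inE eqxx (negPf eA).
have eAS S : range (e |: A) (U :\ e) S -> e \in S.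
  by case/andP => /subsetP/(_ e); rewrite setU11 => ->.
have rU S : e \notin S -> range A (U :\ e) S = range (e |: A) (U :\ e) (e |: S).
  move=> eS; rewrite /range; congr andb.
    apply/idP/idP => /subsetP H; apply/subsetP => x.
      by rewrite !inE => /orP[->//|/H->]; rewrite orbT.
    move=> xA; have := H x; rewrite !inE xA orbT => /(_ isT).
    by case: eqP xA => [->|//]; rewrite (negPf eA).
  apply/idP/idP => /subsetP H; apply/subsetP => x; have := H x; rewrite !inE;
    case: (x =P e) => [->|] //=.
  by rewrite (negPf eS).
have offS S : range A (U :\ e) S -> off S c.
  by case/andP => _ /subsetP H f /H; exact: co.
(* The label of [e] is reset because [h S] must not depend on it when [e] is outside [S]. *)
pose h : {set E} -> X -> Om := fun S p =>
  if range A (U :\ e) S then crev c (y (e |: S) (reset e p)) else 0.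
have hk : face_cochain k h.
  split=> [S p|S p C|S f p fS]; rewrite /h; case: ifP => r.
  - apply: inO_crev (offS _ r) _ => //.
    exact: inO_sub (subsetUr _ _) (fc_in yk _ _).
  - exact: inO0.
  - case/crev_neq0 => f fC /(fc_deg yk)/andP[/(conn_mono (subsetUr _ _)) -> /eqP<-].
    by rewrite cardsU1 (negPf (rA _ r)) (cardsD1 f C) fC /=; apply/eqP; lia.
  - by rewrite eqxx.
  - have [->|fe] := eqVneq f e; first by rewrite reset_delt.
    by rewrite reset_deltC // (fc_inv yk) // !inE negb_or fe.
  - by [].
have hm : min_card 2 h.
  move=> S p C; rewrite /h; case: ifP => // r.
  by case/crev_neq0 => f fC /y0; rewrite (cardsD1 f C) fC.
have hsup S : ~~ range A U S -> h S = 0.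
  move=> nr; apply/funext => p; rewrite /h ifN //; apply: contraNN nr => r.
  by rewrite rE (negPf (rA _ r)).
pose y2 := y - dB h.
have y2k : face_cochain k y2 by apply: face_cochainB => //; exact: face_cochain_dB.
have y2m : min_card 1 y2 by apply: min_cardB => //; exact: min_card_dB.
have dy2 S : range A U S -> dB y2 S = 0 by rewrite dBB dB_sq subr0; exact: dy.
have y2e S p : e \in S -> range A U S -> y2 S p = y S p - y S (reset e p).
  move=> eS rS; rewrite -[LHS]/(y S p - dB h S p); congr (_ - _).
  rewrite /dB (bigD1 e) //= big1 ?addr0 => [|f /andP[fS fe]]; last first.
    rewrite /h ifN ?raddf0 //; apply/negP => /rA; rewrite !inE eq_sym (negPf fe) /=.
    by rewrite eS.
  rewrite /h rU ?setD1K ?inE ?eqxx //; have := rS; rewrite rE eS => ->.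
  rewrite ann_crev ce mulr1z; case: (fc_in yk S (reset e p)) => -> // _.
  by rewrite raddf0 subr0.
have y2n S p : e \notin S -> range A U S -> y2 S p = y S p - crev c (ann e (y S p)).
  move=> eS; rewrite rE (negPf eS) => rS; rewrite -[LHS]/(y S p - dB h S p); congr (_ - _).
  have dye : dB y (e |: S) (reset e p) = 0 by rewrite dy // rE setU11 -rU.
  move: dye; rewrite /dB big_setU1 //= setU1K // (fc_reset _ yk eS) => /eqP.
  rewrite addr_eq0 => /eqP ->; rewrite raddfN (raddf_sum (crev c)) -sumrN; apply: eq_bigr => f fS.
  have fe : f != e by apply: contraNneq eS => <-.
  have DU : (e |: S) :\ f = e |: (S :\ f).
    by apply/setP => x; rewrite !inE; case: (x =P e) => // ->; rewrite eq_sym fe.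
  rewrite DU /h; case: ifPn => r.
    by rewrite ann_crev co ?mulr0z ?sub0r //; case/andP: rS => _ /subsetP; apply.
  rewrite raddf0 ysup; first by rewrite !(raddf0, oppr0).
  rewrite rE setU11 -rU ?r // !inE negb_and; apply/orP; right; exact: eS.
have y2sup S : ~~ (A \subset S) -> y2 S = 0.
  move=> nA; rewrite -[LHS]/(y S - dB h S) (dB_support hsup) // ysup ?subrr //.
  by rewrite /range (negPf nA).
have rAS S : range (e |: A) (U :\ e) S -> A \subset S.
  by case/andP; rewrite subUset => /andP[].
have nAD S f : f \in A -> ~~ (A \subset S :\ f).
  by move=> fA; apply/negP => /subsetP/(_ _ fA); rewrite !inE eqxx.
have nrA S f : f \in e |: A -> ~~ range (e |: A) (U :\ e) (S :\ f).
  by move=> fA; apply/negP => /andP[/subsetP/(_ _ fA)]; rewrite !inE eqxx.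
have rD S f : range (e |: A) (U :\ e) S -> f \notin e |: A ->
    range (e |: A) (U :\ e) (S :\ f).
  case/andP => H1 H2 fA; apply/andP; split; first by rewrite subsetD1 H1.
  exact: subset_trans (subsetDl _ _) H2.
have DC S f g : S :\ f :\ g = S :\ g :\ f by rewrite !setDDl setUC.
(* The error at sets containing [e]. It is closed by itself since the components of [y2] at sets
   without [e] are now killed by [ann e]. *)
pose ya : {set E} -> X -> Om := fun S p => if range (e |: A) (U :\ e) S then y2 S p else 0.
have [||S rS|S rS|ya' [yak yam yasup dya]] := IH k ya.
- exact: face_cochain_sub.
- exact: min_card_sub.
- by apply/funext => p; rewrite /ya (negPf rS).
- have eS := eAS _ rS; have rS' : range A U S by rewrite rE eS.
  rewrite -(dy2 S rS'); apply/funext => p; apply: eq_bigr => f fS; rewrite /ya.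
  have [->|fe] := eqVneq f e.
    rewrite (ifN _ _ (nrA _ _ (setU11 _ _))) raddf0 y2n ?inE ?eqxx //; last first.
      by rewrite rE !inE eqxx /= rU ?setD1K // !inE eqxx.
    by rewrite raddfB /= ann_crev ce mulr1z ann_sq raddf0 subr0 subrr.
  have [fA|fA] := boolP (f \in A).
    by rewrite y2sup ?nAD //; case: ifP.
  by rewrite ifT // rD // !inE negb_or fe.
(* The error at sets without [e] consists of multivectors avoiding [e], so it can be placed at
   [e |: S]; adding an edge to the set raises the weight to [k.+1]. *)
pose yb : {set E} -> X -> Om := fun S p =>
  if range (e |: A) (U :\ e) S then y2 (S :\ e) p else 0.
have [|S p C|S rS|S rS|yb' [ybk ybm ybsup dyb]] := IH k.+1 yb.
- split=> [S p|S p C|S f p fS]; rewrite /yb; case: ifP => r.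
  + have eS := eAS _ r; have r' : range A (U :\ e) (S :\ e) by rewrite rU ?setD1K // !inE eqxx.
    rewrite y2n ?inE ?eqxx //; last by rewrite rE !inE eqxx.
    rewrite -{1}(setD1K eS); apply: crev_ann_inO => //; first exact: offS.
    exact: (fc_in yk).
  + exact: inO0.
  + have eS := eAS _ r; have r' : range A (U :\ e) (S :\ e) by rewrite rU ?setD1K // !inE eqxx.
    case/(fc_deg y2k)/andP => cS /eqP <-; rewrite (cardsD1 e S) eS addnCA eqxx andbT.
    by have := conn_setU1 cS cb (offS _ r') ce; rewrite setD1K.
  + by rewrite eqxx.
  + by rewrite (fc_inv y2k) // !inE (negPf fS) andbF.
  + by [].
- by rewrite /yb; case: ifP => [_ /y2m|]; rewrite ?eqxx.
- by apply/funext => p; rewrite /yb (negPf rS).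
- have eS := eAS _ rS; have r' : range A (U :\ e) (S :\ e) by rewrite rU ?setD1K // !inE eqxx.
  have rS' : range A U (S :\ e) by rewrite rE !inE eqxx.
  rewrite -(dy2 _ rS'); apply/funext => p; rewrite /dB (big_setD1 e) //=.
  rewrite {1}/yb (ifN _ _ (nrA _ _ (setU11 _ _))) raddf0 add0r; apply: eq_bigr => f; rewrite !inE => /andP[fe fS].
  rewrite /yb DC; have [fA|fA] := boolP (f \in A).
    by rewrite [in RHS]DC y2sup ?nAD //; case: ifP => //; rewrite DC y2sup ?nAD.
  by rewrite ifT 1?DC // rD // !inE negb_or fe.
(* The primitive of [yb] is moved back to the sets without [e]. *)
pose yc : {set E} -> X -> Om := fun S p => if e \notin S then yb' (e |: S) (reset e p) else 0.
have yck : face_cochain k yc.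
  split=> [S p|S p C|S f p fS]; rewrite /yc; case: ifP => eS.
  - exact: inO_sub (subsetUr _ _) (fc_in ybk _ _).
  - exact: inO0.
  - case/(fc_deg ybk)/andP => /(conn_mono (subsetUr _ _)) -> /eqP.
    by rewrite cardsU1 eS; move=> H; apply/eqP; lia.
  - by rewrite eqxx.
  - have [->|fe] := eqVneq f e; first by rewrite reset_delt.
    by rewrite reset_deltC // (fc_inv ybk) // !inE negb_or fe.
  - by [].
have ycm : min_card 2 yc.
  by move=> S p C; rewrite /yc; case: ifP => [_ /ybm|]; rewrite ?eqxx.
exists (h + ya' + yc); split.
- by apply: face_cochainD => //; exact: face_cochainD.
- by apply: min_cardD => //; exact: min_cardD.
- move=> S nr; rewrite -[LHS]/(h S + ya' S + yc S) hsup // yasup; last first.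
    by apply: contraNN nr => r; rewrite rE (eAS _ r).
  rewrite !add0r; apply/funext => p; rewrite /yc; case: ifP => // eS.
  by rewrite ybsup // -rU // -[range _ _ _]/(range A (U :\ e) S); move: nr; rewrite rE (negPf eS).
move=> S rS; rewrite !dBD; apply/funext => p.
rewrite -[LHS]/(dB h S p + dB ya' S p + dB yc S p).
have -> : dB h S p = y S p - y2 S p by rewrite -[y2 S p]/(y S p - dB h S p) subKr.
have [eS|eS] := boolP (e \in S).
  have r : range (e |: A) (U :\ e) S by move: rS; rewrite rE eS.
  rewrite dya // /ya r subrK {1}/dB big1 ?addr0 // => f fS; rewrite /yc !inE eS andbT.
  case: eqP => [<-|]; last by rewrite raddf0.
  by rewrite setD1K //; case: (fc_in ybk S (reset e p)) => -> .
have r : range A (U :\ e) S by move: rS; rewrite rE (negPf eS).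
rewrite (dB_support yasup); last by rewrite subUset sub1set (negPf eS).
have : dB yb' (e |: S) (reset e p) = y2 S p.
  have r1 : range (e |: A) (U :\ e) (e |: S) by rewrite -rU.
  by rewrite (dyb _ r1) /yb r1 (setU1K eS) (fc_reset _ y2k eS).
rewrite /dB big_setU1 //= setU1K // ybsup; last by apply: contraNN eS => /eAS.
rewrite raddf0 add0r => <-; rewrite addr0 -addrA [X in _ + X](_ : _ = 0) ?addr0 //.
apply/eqP; rewrite addrC subr_eq0; apply/eqP; apply: eq_bigr => f fS.
have fe : f != e by apply: contraNneq eS => <-.
rewrite /yc !inE (negPf eS) andbF /=; congr (ann f (yb' _ _)).
by apply/setP => x; rewrite !inE; case: (x =P e) => // ->; rewrite eq_sym fe.
Qed.

(** The hypothesis says that no cycle avoids all of [A :|: U]. Each edge of [U] is either dependent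
    on the remaining edges of [A :|: U], or lies on a cycle that avoids them; the two preceding
    lemmas treat the two cases. *)
Lemma exact_rangeP A U : (forall e, e \notin A :|: U -> dependent (A :|: U) e) ->
  [disjoint A & U] -> exact_range A U.
Proof.
have [n] := ubnP #|U|; elim: n => // n IH in A U *; rewrite ltnS => Un dep AU.
have [U0|/set0Pn[e eU]] := eqVneq U set0.
  by subst U; apply: exact_range0 => e eA; have := dep e; rewrite setU0; apply.
have eA : e \notin A by rewrite (disjointFl AU).
have UD : e |: (A :|: U :\ e) = A :|: U.
  by apply/setP => x; rewrite !inE; case: (x =P e) => [->|//]; rewrite eU orbT.
have AU' : A :|: U = (e |: A) :|: (U :\ e) by rewrite -UD setUA.
have Ue : (#|U :\ e| < n)%N by move: Un; rewrite (cardsD1 e U) eU.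
have disj : [disjoint A & U :\ e] by apply: disjointWr AU; exact: subsetDl.
have IH' : exact_range (e |: A) (U :\ e).
  apply: IH => //; first by rewrite -AU'.
  rewrite disjoint_subset; apply/subsetP => x; rewrite !inE.
  case: (x =P e) => //= _ xA; by rewrite (disjointFr AU).
case: (dependent_or_cycle (A :|: U :\ e) e) => [d|[c [cb co ce]]].
  apply: (exact_range_dep eA eU) => //; apply: IH => // f fn.
  have eAU : e \notin A :|: U :\ e by rewrite !inE negb_or eA eqxx.
  have [->//|fe] := eqVneq f e.
  apply: (dependent_trans d eAU); rewrite UD; apply: dep.
  by move: fn; rewrite !inE (negPf fe).
apply: (exact_range_cycle eA eU cb _ ce) => // f fAU; apply: co.
by rewrite in_setD1 fAU andbT; apply: contraTneq fAU => ->; rewrite !inE negb_or eA eqxx.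
Qed.

(** The case of all edge sets; [n < k] forces a positive multivector degree. *)
Lemma dB_exact k n y : face_cochain k y -> (n < k)%N ->
  (forall S p C, y S p C != 0 -> #|S| = n) -> dB y = 0 ->
  exists y', [/\ face_cochain k y', (forall S p C, y' S p C != 0 -> #|S|.+1 = n) & dB y' = y].
Proof.
move=> yk nk yn dy; have rT S : range set0 setT S by rewrite /range sub0set set0U subsetT.
have [|||S p C n0|S|S _|y' [y'k _ _ dy']] := @exact_rangeP set0 setT _ _ k y.
- by move=> e; rewrite set0U inE.
- by rewrite -setI_eq0 set0I.
- exact: yk.
- have /andP[_ /eqP kE] := fc_deg yk n0; have := yn _ _ _ n0; lia.
- by rewrite rT.
- by rewrite dy.
exists (fun S p => if #|S|.+1 == n then y' S p else 0); split.
- exact: (@face_cochain_sub k (fun S => #|S|.+1 == n) y').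
- by move=> S p C; case: ifP => [/eqP //|]; rewrite eqxx.
apply/funext => S; apply/funext => p; have [Sn|Sn] := eqVneq #|S| n.
  rewrite -dy' //; apply: eq_bigr => e eS.
  by rewrite ifT // -Sn (cardsD1 e S) eS.
transitivity (0 : Om).
  rewrite /dB big1 // => e eS; rewrite ifN ?raddf0 //.
  by apply: contraNN Sn; rewrite (cardsD1 e S) eS.
by apply/funext => C; apply/eqP; rewrite eq_sym; apply: contraNT Sn => /yn ->.
Qed.
End Multivectors.

Lemma fct_mulrz (T : Type) (V : zmodType) (f : T -> V) (n : int) x : (f *~ n) x = f x *~ n.
Proof. by case: n => n; rewrite ?NegzE ?mulrNz -!pmulrn -?[(- _) x]/(- _) natmulfctE. Qed.

(** * Group cohomology of modules of functions *)

Section ShiftModule.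
Variables (L X V : zmodType) (i0 : {additive L -> X}).

Definition shift (g : L) (f : X -> V) : X -> V := fun x => f (x + i0 g).

Fact shift_additive g : zmod_morphism (shift g).
Proof. by []. Qed.
HB.instance Definition _ g := GRing.isZmodMorphism.Build
  (X -> V) (X -> V) (shift g) (shift_additive g).

Local Notation coch := (cochain L (X -> V)).
Local Notation delta := (@cochain_diff L (X -> V) (fun g => shift g) _).

Definition consn n (a : L) (g : 'I_n -> L) : 'I_n.+1 -> L :=
  fun i => oapp g a (unlift ord0 i).

Lemma consn0 n a (g : 'I_n -> L) : consn a g ord0 = a.
Proof. by rewrite /consn unlift_none. Qed.

Lemma consnS n a (g : 'I_n -> L) i : consn a g (lift ord0 i) = g i.
Proof. by rewrite /consn liftK. Qed.

Lemma consn_lift n a (g : 'I_n -> L) : (fun i => consn a g (lift ord0 i)) = g.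
Proof. by apply/funext => i; rewrite consnS. Qed.

Lemma consn_eta n (g : 'I_n.+1 -> L) : g = consn (g ord0) (fun i => g (lift ord0 i)).
Proof. by apply/funext => i; case: (unliftP ord0 i) => [j ->|->]; rewrite ?consnS ?consn0. Qed.

Lemma widen_ord0 n (le : (n.+1 <= n.+2)%N) : widen_ord le ord0 = ord0.
Proof. exact: val_inj. Qed.

Lemma widen_lift n (le : (n.+1 <= n.+2)%N) (le' : (n <= n.+1)%N) j :
  widen_ord le (lift ord0 j) = lift ord0 (widen_ord le' j).
Proof. exact: val_inj. Qed.

Lemma consn_widen n a (g : 'I_n.+1 -> L) (le : (n.+1 <= n.+2)%N) (le' : (n <= n.+1)%N) :
  (fun i => consn a g (widen_ord le i)) = consn a (fun i => g (widen_ord le' i)).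
Proof.
apply/funext => i; case: (unliftP ord0 i) => [j ->|->].
  by rewrite (widen_lift le le') !consnS.
by rewrite widen_ord0 !consn0.
Qed.

Lemma merge_consn0 n a (g : 'I_n.+1 -> L) :
  merge ord0 (consn a g) = consn (a + g ord0) (fun i => g (lift ord0 i)).
Proof.
apply/funext => j; rewrite /merge /=; case: (unliftP ord0 j) => [i ->|->] //=.
  by rewrite !consnS.
by rewrite widen_ord0 !consn0 consnS.
Qed.

Lemma merge_consnS n a (g : 'I_n.+1 -> L) i :
  merge (lift ord0 i) (consn a g) = consn a (merge i g).
Proof.
apply/funext => j; case: (unliftP ord0 j) => [l ->|->].
  rewrite consnS /merge (inj_eq (@lift_inj _ ord0)) !lift0 ltnS.
  rewrite (widen_lift _ (leqnSn n)) !consnS.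
  by [].
by rewrite consn0 /merge lift0 /= widen_ord0 consn0.
Qed.

(** Prepending the coordinate in [L] of the point of evaluation is a contracting
    homotopy. *)
Section Homotopy.
Variable r : X -> L.
Hypothesis rD : forall x g, r (x + i0 g) = r x + g.

Definition homot n (c : coch n.+1) : coch n := fun g x =>
  c (consn (r x) g) (x - i0 (r x)).

Lemma homotP n (c : coch n.+1) : delta (homot c) + homot (delta c) = c.
Proof.
apply/funext => g; apply/funext => x.
rewrite -[LHS]/(delta (homot c) g x + homot (delta c) g x).
rewrite {2}/homot /cochain_diff.
rewrite -![(_ + _ : X -> V) _]/(_ + _) !fct_sumE consn0 consn_lift.
rewrite big_ord_recl merge_consn0 !fct_mulrz.
have sh g' f y : (shift g' : {additive _ -> _}) f y = f (y + i0 g') by [].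
rewrite !sh subrK {1}/homot.
have Ex : x + i0 (g ord0) - (i0 (r x) + i0 (g ord0)) = x - i0 (r x).
  by rewrite opprD addrACA subrr addr0.
rewrite rD (raddfD i0) Ex.
rewrite (consn_widen _ _ _ (leqnSn n)).
under eq_bigr => i _ do rewrite fct_mulrz /homot.
under [X in _ + (_ + (_ + X) + _)]eq_bigr => i _ do
  rewrite fct_mulrz lift0 merge_consnS exprS mulN1r mulrNz.
have -> : (-1) ^+ (ord0 : 'I_n.+1).+1 = -1 :> int by [].
rewrite sumrN mulrN1z [(-1) ^+ n.+2]exprS mulN1r mulrNz /homot.
have zE (M : zmodType) (a b d e : M) : a + b + d + (e + (- a - b) - d) = e.
  by rewrite -opprD -(addrA e) -opprD addrCA subrr addr0.
exact: zE.
Qed.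

Lemma homot0 n : homot (0 : coch n.+1) = 0.
Proof. by []. Qed.

Lemma cochain_diff_invariant (c : coch 0) :
  (forall g f, c f = shift g (c f)) -> delta c = 0.
Proof.
move=> cI; apply/funext => g; rewrite /cochain_diff big_ord0 addr0 expr1 mulrN1z /= -cI.
by rewrite -[RHS](subrr (c (fun i => g (widen_ord (leqnSn 0) i)))); congr (c _ - _); apply/funext => -[].
Qed.

Let homot_diff n (a : coch n.+1) : homot (delta a) = a - delta (homot a).
Proof. by apply/eqP; rewrite eq_sym subr_eq addrC eq_sym homotP. Qed.

Lemma homot_diff_sq0 (c : coch 0) : homot (delta (delta c)) = 0.
Proof.
rewrite homot_diff.
suff -> : homot (delta c) = c - (fun g x => c g (x - i0 (r x))).
  rewrite (raddfB (@cochain_diff _ _ (fun g => shift g) 0)).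
  rewrite [X in _ - (_ - X)]cochain_diff_invariant ?subr0 ?subrr // => f g.
  apply/funext => x; rewrite /shift rD (raddfD i0).
  by congr (c _ _); rewrite opprD addrACA subrr addr0.
apply/funext => g; apply/funext => x; rewrite /homot /cochain_diff big_ord0 addr0.
rewrite expr1 mulrN1z consn0 -[LHS]/(c _ (x - i0 (r x) + i0 (r x)) - c _ _) subrK.
by congr (c _ _ - c _ _); apply/funext => -[].
Qed.

Lemma homot_diff_sqS n (c : coch n.+1) :
  (forall b : coch n, delta (delta b) = 0) -> homot (delta (delta c)) = 0.
Proof.
move=> H; rewrite !homot_diff (raddfB (@cochain_diff _ _ (fun g => shift g) n.+1)) /= H.
by rewrite subr0 subrr.
Qed.
End Homotopy.

Variable r : X -> L.
Hypothesis rD : forall x g, r (x + i0 g) = r x + g.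

(** Derived from the homotopy identity rather than from a double sum. If [r] is shifted so as to
    vanish at [y], the values of [homot] on the orbit of [y] recover all values at [y] of the
    cochain, so it suffices that these homotopies kill [delta (delta c)]; this follows by induction
    on the arity. *)
Lemma cochain_diff_sq n (c : coch n) : delta (delta c) = 0.
Proof.
suff H : forall r', (forall x g, r' (x + i0 g) = r' x + g) -> homot r' (delta (delta c)) = 0.
  apply/funext => g; apply/funext => y.
  have rD' x a : r (x + i0 a) - r y = r x - r y + a by rewrite rD addrAC.
  have := congr1 (fun u => u (fun i => g (lift ord0 i)) (y + i0 (g ord0))) (H _ rD').
  by rewrite /homot rD' subrr add0r addrK -consn_eta.
elim: n c => [|n IH] c r' rD'; first exact: homot_diff_sq0.
apply: homot_diff_sqS => // b; apply/funext => g; apply/funext => y.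
have rD2 x a : r (x + i0 a) - r y = r x - r y + a by rewrite rD addrAC.
have := congr1 (fun u => u (fun i => g (lift ord0 i)) (y + i0 (g ord0))) (IH b _ rD2).
by rewrite /homot rD2 subrr add0r addrK -consn_eta.
Qed.

Lemma cochain_acyclic n (c : coch n.+1) : delta c = 0 -> c = delta (homot r c).
Proof. by move=> dc; rewrite -{1}(homotP rD c) dc homot0 addr0. Qed.
End ShiftModule.

(** * Group cohomology from a complex of acyclic modules *)

Section Hyper.
Variables (L X V : zmodType) (i0 : {additive L -> X}).
Variable r : X -> L.
Hypothesis rD : forall x g, r (x + i0 g) = r x + g.
Local Notation W := (X -> V).
Local Notation coch := (cochain L W).
Local Notation delta := (@cochain_diff L W (fun g => shift i0 g) _).

Variable d : {additive W -> W}.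
Hypothesis d_sq : forall w, d (d w) = 0.
Hypothesis d_shift : forall g w, d (shift i0 g w) = shift i0 g (d w).

Variable degV : int -> V -> Prop.
Hypothesis degV0 : forall n, degV n 0.
Hypothesis degVB : forall n v v', degV n v -> degV n v' -> degV n (v - v').
Hypothesis degV_neg : forall n v, n < 0 -> degV n v -> v = 0.

Definition deg n (w : W) := forall x, degV n (w x).

Hypothesis deg_d : forall n w, deg n w -> deg (n + 1) (d w).

Variable k : int.
Hypothesis exact : forall n z, deg n z -> d z = 0 -> n != k ->
  exists2 y, deg (n - 1) y & z = d y.

Variables (R : zmodType) (actR : L -> {additive R -> R}).
(** [rho z s] stands for: [s] is the class of the cocycle [z] under an identification of the degree
    [k] cohomology of [d] with [R]. A relation avoids choosing representatives equivariantly. *)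
Variable rho : W -> R -> Prop.
Hypothesis rho_cycle : forall z s, rho z s -> deg k z /\ d z = 0.
Hypothesis rhoB : forall z s z' s', rho z s -> rho z' s' -> rho (z - z') (s - s').
Hypothesis rho_tot : forall z, deg k z -> d z = 0 -> exists s, rho z s.
Hypothesis rho_onto : forall s, exists z, rho z s.
Hypothesis rho_act : forall g z s, rho z s -> rho (shift i0 g z) (actR g s).
Hypothesis rho_bnd : forall z, rho z 0 -> exists2 y, deg (k - 1) y & z = d y.
Hypothesis bnd_rho : forall y, deg (k - 1) y -> rho (d y) 0.
Hypothesis rho0 : forall s, rho 0 s -> s = 0.

Lemma deg0 n : deg n 0.
Proof. by move=> x; exact: degV0. Qed.

Lemma degB n w w' : deg n w -> deg n w' -> deg n (w - w').
Proof. by move=> H H' x; exact: degVB. Qed.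

Lemma degN n w : deg n w -> deg n (- w).
Proof. by move=> H; rewrite -sub0r; apply: degB => //; exact: deg0. Qed.

Lemma degD n w w' : deg n w -> deg n w' -> deg n (w + w').
Proof. by move=> H H'; rewrite -[w']opprK; apply: degB => //; exact: degN. Qed.

Lemma deg_sign n w j : deg n w -> deg n (w *~ (-1) ^+ j).
Proof.
by move=> H; rewrite -signr_odd; case: odd; rewrite ?expr0 ?mulr1z // expr1 mulrN1z; exact: degN.
Qed.

Lemma deg_shift n g w : deg n w -> deg n (shift i0 g w).
Proof. by move=> H x; exact: H. Qed.

Lemma deg_sum n (I : Type) (s : seq I) (F : I -> W) :
  (forall i, deg n (F i)) -> deg n (\sum_(i <- s) F i).
Proof. by move=> H; elim/big_ind: _ => //; exact: degD. Qed.

Lemma deg_delta n m (c : coch m) : (forall g, deg n (c g)) -> forall g, deg n (delta c g).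
Proof.
move=> H g; apply: degD; first apply: degD.
- exact/deg_shift/H.
- by apply: deg_sum => i; exact/deg_sign/H.
- exact/deg_sign/H.
Qed.

Lemma rhoN z s : rho z s -> rho (- z) (- s).
Proof.
by move=> H; rewrite -(sub0r z) -(sub0r s); apply: rhoB => //; rewrite -(subrr z) -(subrr s); exact: rhoB.
Qed.

Lemma rhoD z s z' s' : rho z s -> rho z' s' -> rho (z + z') (s + s').
Proof. by move=> H H'; rewrite -(opprK z') -(opprK s'); apply: rhoB => //; exact: rhoN. Qed.

Lemma rho_sign z s j : rho z s -> rho (z *~ (-1) ^+ j) (s *~ (-1) ^+ j).
Proof.
by move=> H; rewrite -signr_odd; case: odd; rewrite ?expr0 ?mulr1z // expr1 !mulrN1z; exact: rhoN.
Qed.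

Lemma rho00 : rho 0 0.
Proof. by rewrite -(raddf0 d); apply: bnd_rho; exact: deg0. Qed.

Lemma rho_delta n (c : coch n) (b : cochain L R n) :
  (forall g, rho (c g) (b g)) -> forall g, rho (delta c g) (cochain_diff actR b g).
Proof.
move=> H g; apply: rhoD; first apply: rhoD.
- exact: rho_act.
- by elim/big_rec2: _ => [|i y z _ Hy]; [exact: rho00|apply: rhoD => //; exact: rho_sign].
- exact: rho_sign.
Qed.

Lemma deltaB n (c c' : coch n) : delta (c - c') = delta c - delta c'.
Proof. exact: (raddfB (@cochain_diff _ _ (fun g => shift i0 g) n)). Qed.

Lemma delta0 n : delta (0 : coch n) = 0.
Proof. exact: (raddf0 (@cochain_diff _ _ (fun g => shift i0 g) n)). Qed.

Definition dcoch n (c : coch n) : coch n := fun g => d (c g).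

Lemma delta_dcoch n (c : coch n) : delta (dcoch c) = dcoch (delta c).
Proof.
apply/funext => g; rewrite /dcoch /cochain_diff !raddfD raddf_sum raddfMz /=.
congr (_ + _ + _); first by rewrite d_shift.
by apply: eq_bigr => i _; rewrite raddfMz.
Qed.

Lemma dcochB n (c c' : coch n) : dcoch (c - c') = dcoch c - dcoch c'.
Proof. by apply/funext => g; rewrite -[RHS]/(d _ - d _) -raddfB. Qed.

(** Total cochains are families of cochains of all arities. *)
Definition tot (x : forall m, coch m) m : coch m :=
  match m with
  | 0 => dcoch (x 0%N)
  | m'.+1 => delta (x m') + dcoch (x m'.+1) *~ (-1) ^+ m'.+1
  end.

Arguments tot x m : clear implicits, simpl nomatch.

Definition homogeneous N (x : forall m, coch m) := forall m g, deg (N - m%:Z) (x m g).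

Lemma tot_sq x m : tot (tot x) m = 0.
Proof.
case: m => [|m]; first by apply/funext => g; exact: d_sq.
case: m => [|m] /=.
  apply/funext => g; rewrite delta_dcoch expr1 mulrN1z.
  rewrite -[LHS]/(dcoch (delta (x 0%N)) g - d (delta (x 0%N) g + (dcoch (x 1%N) *~ -1) g)).
  by rewrite (raddfD d) fct_mulrz (raddfMz d) /dcoch d_sq mul0rz addr0 subrr.
rewrite raddfD /= (cochain_diff_sq rD) add0r raddfMz /= delta_dcoch.
apply/funext => g.
rewrite -[LHS]/((dcoch (delta (x m.+1)) *~ (-1) ^+ m.+1) g + (dcoch (delta (x m.+1) + dcoch (x m.+2) *~ (-1) ^+ m.+2) *~ (-1) ^+ m.+2) g).
rewrite !fct_mulrz {2}/dcoch (raddfD d) fct_mulrz (raddfMz d) {2}/dcoch d_sq mul0rz addr0 /dcoch.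
by rewrite -mulrzDr [(-1) ^+ m.+2]exprS mulN1r subrr mulr0z.
Qed.

Lemma totB x y m : tot (fun m => x m - y m) m = tot x m - tot y m.
Proof.
case: m => [|m] /=; first exact: dcochB.
by rewrite deltaB dcochB mulrzBl addrACA -opprD.
Qed.

Lemma eq_tot x y : (forall m, x m = y m) -> forall m, tot x m = tot y m.
Proof. by move=> H [|m] /=; rewrite !H. Qed.

Lemma homogeneousB N x y : homogeneous N x -> homogeneous N y ->
  homogeneous N (fun m => x m - y m).
Proof. by move=> H H' m g; exact: degB. Qed.

Lemma homogeneous_tot N x : homogeneous N x -> homogeneous (N + 1) (tot x).
Proof.
move=> H [|m] g.
  have := deg_d (H 0%N g); rewrite (_ : N - 0%:Z + 1 = N + 1 - 0%:Z) //; lia.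
have E : N + 1 - m.+1%:Z = N - m%:Z by lia.
apply: degD; first by rewrite E; apply: deg_delta => g'; exact: H.
rewrite fct_mulrz; apply: deg_sign.
have := deg_d (H m.+1 g); rewrite (_ : N - m.+1%:Z + 1 = N + 1 - m.+1%:Z) //; lia.
Qed.

Lemma homogeneous_tot1 N x : homogeneous (N - 1) x -> homogeneous N (tot x).
Proof. by move=> /homogeneous_tot; rewrite subrK. Qed.

Definition single m0 (c : coch m0) m : coch m :=
  if @eqP _ m0 m is ReflectT E then ecast i (coch i) E c else 0.
Arguments single [m0] c m.

Lemma single_id m (c : coch m) : single c m = c.
Proof. by rewrite /single; case: eqP => // E; rewrite eq_axiomK. Qed.

Lemma single_ne m0 (c : coch m0) m : m0 != m -> single c m = 0.
Proof. by rewrite /single; case: eqP. Qed.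

Lemma homogeneous_single N m0 (c : coch m0) :
  (forall g, deg (N - m0%:Z) (c g)) -> homogeneous N (single c).
Proof.
move=> H m; have [E|ne] := eqVneq m0 m; first by subst m => g; rewrite single_id.
by move=> g; rewrite single_ne //; exact: deg0.
Qed.

Lemma dcoch0 n : dcoch (0 : coch n) = 0.
Proof. by apply/funext => g; rewrite /dcoch raddf0. Qed.

Lemma tot_single_lt m0 (c : coch m0) m : (m < m0)%N -> tot (single c) m = 0.
Proof.
case: m => [|m] mm /=; first by rewrite single_ne ?dcoch0 // neq_ltn mm orbT.
rewrite !single_ne ?neq_ltn ?mm ?orbT //; last by rewrite (ltnW mm) orbT.
by rewrite dcoch0 mul0rz delta0 addr0.
Qed.

Lemma tot_single_id m (c : coch m) : tot (single c) m = dcoch c *~ (-1) ^+ m.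
Proof.
case: m c => [|m] c /=; first by rewrite single_id expr0 mulr1z.
by rewrite single_id single_ne ?delta0 ?add0r // neq_ltn ltnSn orbT.
Qed.

Lemma tot_singleS m (c : coch m) : tot (single c) m.+1 = delta c.
Proof.
by rewrite /= single_id single_ne ?dcoch0 ?mul0rz ?addr0 // neq_ltn ltnSn.
Qed.

Lemma tot_single_gt m0 (c : coch m0) m : (m0.+1 < m)%N -> tot (single c) m = 0.
Proof.
case: m => // m mm /=; have mm' : (m0 < m)%N by exact: mm.
have n1 : m0 != m by rewrite neq_ltn mm'.
have n2 : m0 != m.+1 by rewrite neq_ltn ltnS (ltnW mm').
by rewrite (single_ne c n1) (single_ne c n2) dcoch0 mul0rz delta0 addr0.
Qed.

Lemma homogeneous_neg N x m : homogeneous N x -> N < m%:Z -> x m = 0.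
Proof.
move=> H Nm; apply/funext => g; apply/funext => p.
by apply: (degV_neg (n := N - m%:Z)); [lia|exact: H].
Qed.

Lemma tot0 x m : (forall m, x m = 0) -> tot x m = 0.
Proof.
by move=> x0; case: m => [|m] /=; rewrite !x0 dcoch0 ?mul0rz ?delta0 ?addr0.
Qed.

Definition addf (x y : forall m, coch m) : forall m, coch m := fun m => x m + y m.

Lemma totD x y m : tot (addf x y) m = tot x m + tot y m.
Proof.
have N : tot (fun m => 0 - y m) m = - tot y m.
  by rewrite (totB (fun=> 0)) (@tot0 (fun=> 0)) // sub0r.
rewrite -[tot y m]opprK -N -totB; apply: eq_tot => j.
by rewrite sub0r opprK.
Qed.

(** Cochains that are cocycles in positive arities are cohomologous to cochains
    concentrated in arity zero, by acyclicity. *)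
Lemma concentrate N x : homogeneous N x -> (forall m, tot x m.+1 = 0) ->
  exists2 Y, homogeneous (N - 1) Y & forall m, x m.+1 - tot Y m.+1 = 0.
Proof.
(* Negative degrees vanish, so only finitely many arities occur; the top one is removed
   repeatedly. *)
move=> xN dx; have [M Mx] : exists M : nat, forall m, (M < m)%N -> x m = 0.
  by exists `|N|%N => m mN; apply: homogeneous_neg xN _; lia.
elim: M x xN dx Mx => [|M IH] x xN dx Mx.
  exists (fun=> 0) => [m g|m]; first exact: deg0.
  by rewrite Mx // tot0 // subr0.
have dxM : delta (x M.+1) = 0.
  by have := dx M.+1; rewrite /= (Mx M.+2) // dcoch0 mul0rz addr0.
have /= E := cochain_acyclic rD dxM.
pose Y1 := single (homot i0 r (x M.+1)).
have Y1N : homogeneous (N - 1) Y1.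
  apply: homogeneous_single => g p; rewrite /homot.
  by have := xN M.+1 (consn (r p) g) (p - i0 (r p)); rewrite (_ : N - M.+1%:Z = N - 1 - M%:Z) //; lia.
have [||m mM|Y2 Y2N dY2] := IH (fun m => x m - tot Y1 m).
- apply: homogeneousB => //; rewrite -[N](subrK 1); exact: homogeneous_tot.
- by move=> m; rewrite totB dx tot_sq subrr.
- case: m mM => // m; rewrite ltnS leq_eqVlt => /orP[/eqP<-|mM].
    by rewrite tot_singleS -E subrr.
  by rewrite Mx ?ltnS // tot_single_gt ?subrr // ltnS.
exists (addf Y2 Y1) => [m g|m]; first exact: degD (Y2N _ _) (Y1N _ _).
rewrite -[cochain_diff _ _ + _]/(tot (addf Y2 Y1) m.+1).
by rewrite totD addrC -[RHS](dY2 m) [tot Y2 _ + _]addrC opprD addrC addrA.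
Qed.

Lemma clear_step N x j : homogeneous N x -> (forall m, (m < j)%N -> x m = 0) ->
  (forall g, exists2 y, deg (N - j%:Z - 1) y & x j g = d y) ->
  exists2 Y, homogeneous (N - 1) Y & forall m, (m <= j)%N -> x m - tot Y m = 0.
Proof.
move=> xN xj xb.
have /choice[y yP] : forall g, exists y, deg (N - j%:Z - 1) y /\ x j g = d y.
  by move=> g; have [y] := xb g; exists y.
(* The sign cancels the one that [tot] puts on [d] in arity [j]. *)
pose Y := single ((fun g => y g *~ (-1) ^+ j) : coch j).
exists Y => [|m].
  apply: homogeneous_single => g; apply: deg_sign.
  by have [] := yP g; rewrite addrAC.
rewrite leq_eqVlt => /orP[/eqP->|mj]; last by rewrite xj // tot_single_lt // subrr.
rewrite tot_single_id; apply/eqP; rewrite subr_eq0; apply/eqP/funext => g.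
by rewrite fct_mulrz /dcoch (raddfMz d) -mulrzA -expr2 sqrr_sign mulr1z; case: (yP g).
Qed.

(** Exactness pushes a total cocycle up to the arity of the cohomology [R]. *)
Lemma clear_below N x j : homogeneous N x ->
  (forall m, (m < j)%N -> tot x m = 0) -> (forall m, (m < j)%N -> N - m%:Z != k) ->
  exists2 Y, homogeneous (N - 1) Y & forall m, (m < j)%N -> x m - tot Y m = 0.
Proof.
move=> xN; elim: j => [|j IH] dx Nk; first by exists (fun=> 0) => // m g; exact: deg0.
have [m mj|m mj|Y YN xY] := IH; [by apply: dx; exact: leqW|by apply: Nk; exact: leqW|].
pose x1 m := x m - tot Y m.
have x1N : homogeneous N x1.
  apply: homogeneousB => //; rewrite -[N](subrK 1); exact: homogeneous_tot.
have dx1 : dcoch (x1 j) = 0.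
  have : tot x1 j = 0 by rewrite totB dx // tot_sq subrr.
  case: (j) xY x1N => [|i] xY x1N //=; rewrite [x1 i]xY // delta0 add0r => E.
  by rewrite -[LHS]mulr1z -(sqrr_sign _ i.+1) expr2 mulrzA E mul0rz.
have [//|g|Y1 Y1N xY1] := @clear_step N x1 j x1N.
  by apply: exact; [exact: x1N|exact: (congr1 (fun u => u g) dx1)|exact: Nk].
exists (addf Y Y1) => [m g|m mj]; first exact: degD (YN _ _) (Y1N _ _).
by rewrite totD opprD addrA; exact: xY1.
Qed.

(** Once the degree in [W] is below [k], exactness applies in each further arity, and negative
    degrees end the recursion. *)
Lemma clear_above N x j : homogeneous N x -> (forall m, tot x m = 0) ->
  (forall m, (m < j)%N -> x m = 0) -> N - j%:Z < k ->
  exists2 Y, homogeneous (N - 1) Y & forall m, x m = tot Y m.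
Proof.
have [c] : exists c : nat, N - j%:Z < c%:Z by exists `|N - j%:Z|.+1%N; lia.
elim: c j x => [|c IH] j x Nc xN dx xj Nk.
  exists (fun=> 0) => [m g|m]; first exact: deg0.
  rewrite tot0 //; have [/xj //|jm] := ltnP m j; apply: homogeneous_neg xN _; lia.
have dx1 : dcoch (x j) = 0.
  move: (dx j); case: (j) xj => [|i] xj //=; rewrite xj // delta0 add0r => E.
  by rewrite -[LHS]mulr1z -(sqrr_sign _ i.+1) expr2 mulrzA E mul0rz.
have [//|g|Y YN xY] := @clear_step N x j xN.
  apply: exact; [exact: xN|exact: (congr1 (fun u => u g) dx1)|lia].
have [|||m mj||Y1 Y1N xY1] := IH j.+1 (fun m => x m - tot Y m).
- lia.
- apply: homogeneousB => //; rewrite -[N](subrK 1); exact: homogeneous_tot.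
- by move=> m; rewrite totB dx tot_sq subrr.
- exact: xY.
- lia.
exists (addf Y Y1) => [m g|m]; first exact: degD (YN _ _) (Y1N _ _).
by rewrite totD -xY1 addrC subrK.
Qed.

Let subACA (M : zmodType) (a b c e : M) : a - b - (c - e) = a - c - (b - e).
Proof. by rewrite !opprB addrACA [RHS]addrACA [- b - c]addrC. Qed.

Definition invariant (w : W) := forall g, shift i0 g w = w.

Definition const0 (w : W) : forall m, coch m := single ((fun=> w) : coch 0).
Arguments const0 w m : clear implicits.

Lemma delta_const (w : W) : invariant w -> delta ((fun=> w) : coch 0) = 0.
Proof.
by move=> wI; apply/funext => g; rewrite /cochain_diff big_ord0 addr0 expr1 mulrN1z /= wI subrr.
Qed.

Lemma tot_const0 w m : invariant w -> tot (const0 w) m = const0 (d w) m.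
Proof.
move=> wI; case: m => [|[|m]].
- by rewrite /const0 tot_single_id expr0 mulr1z single_id.
- by rewrite /const0 tot_singleS delta_const // single_ne.
- by rewrite /const0 tot_single_gt // single_ne.
Qed.

(** The cochain [c] with values in [R] and the invariant [z] are the two ends of
    the same total cocycle. *)
Definition hyper_rel n (c : cochain L R n) (z : W) := exists x Y,
  [/\ homogeneous (n%:Z + k) x, forall m, tot x m = 0,
     forall m, (m < n)%N -> x m = 0, forall g, rho (x n g) (c g) &
     homogeneous (n%:Z + k - 1) Y /\ forall m, x m - tot Y m = const0 z m].

Lemma hyper_relB n (c c' : cochain L R n) z z' :
  hyper_rel c z -> hyper_rel c' z' -> hyper_rel (c - c') (z - z').
Proof.
move=> [x [Y [xN dx xn xc [YN xY]]]] [x' [Y' [xN' dx' xn' xc' [YN' xY']]]].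
exists (fun m => x m - x' m), (fun m => Y m - Y' m); split.
- exact: homogeneousB.
- by move=> m; rewrite totB dx dx' subrr.
- by move=> m mn; rewrite xn // xn' // subrr.
- by move=> g; exact: rhoB (xc g) (xc' g).
split=> [|m]; first exact: homogeneousB.
by rewrite totB subACA xY xY'; case: m => [|m]; rewrite /const0 ?single_id // !single_ne // subrr.
Qed.

Lemma const0_0 z : const0 z 0%N = fun=> z.
Proof. by rewrite /const0 single_id. Qed.

Lemma const0_S z m : const0 z m.+1 = 0.
Proof. by rewrite /const0 single_ne. Qed.

Lemma invariantP z : delta ((fun=> z) : coch 0) = 0 -> invariant z.
Proof.
move=> dz g; have := congr1 (fun u => u (fun=> g)) dz.
rewrite /cochain_diff big_ord0 addr0 expr1 mulrN1z => /eqP.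
by rewrite subr_eq0 => /eqP.
Qed.

Lemma eq_const0 x : (forall m, x m.+1 = 0) -> forall m, x m = const0 (x 0%N (fun=> 0)) m.
Proof.
move=> xS [|m]; last by rewrite xS const0_S.
by rewrite const0_0; apply/funext => g; congr (x 0%N _); apply/funext => -[].
Qed.

Lemma homogeneous_const0 N z : deg N z -> homogeneous N (const0 z).
Proof. by move=> zN; apply: homogeneous_single => _; rewrite subr0. Qed.

Lemma tot_const0_eq0 z : (forall m, tot (const0 z) m = 0) -> d z = 0 /\ invariant z.
Proof.
move=> H; split.
  have := H 0%N; rewrite /= const0_0 => /(congr1 (fun u => u (fun=> 0))).
  by [].
apply: invariantP; have := H 1%N; rewrite /const0 tot_singleS.
by [].
Qed.

(** A total cocycle concentrated in arity zero is an invariant [d]-cocycle. At the other end, the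
    equation in arity [n.+1] exhibits [delta (x n)] as a [d]-boundary, so its class, the coboundary
    of [c], is zero. *)
Lemma hyper_rel_invariant n (c : cochain L R n) z : hyper_rel c z ->
  [/\ cochain_diff actR c = 0, deg (n%:Z + k) z, d z = 0 & invariant z].
Proof.
move=> [x [Y [xN dx xn xc [YN xY]]]].
have H m : tot (const0 z) m = 0.
  by rewrite -(eq_tot xY) totB dx tot_sq subrr.
have [dz zI] := tot_const0_eq0 H; split=> //.
  apply/funext => g; apply: rho0.
  have E : delta (x n) g = d (- x n.+1 g *~ (-1) ^+ n.+1).
    have := congr1 (fun u => u g) (dx n.+1); rewrite /=.
    rewrite -[(_ + _) g]/(delta (x n) g + (dcoch (x n.+1) *~ (-1) ^+ n.+1) g).
    rewrite fct_mulrz => /eqP; rewrite addr_eq0 => /eqP ->.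
    by rewrite (raddfMz d) raddfN mulNrz.
  rewrite -(subrr (delta (x n) g)) -[X in rho _ X]subr0; apply: rhoB.
    exact: rho_delta.
  rewrite E; apply: bnd_rho; rewrite mulNrz; apply/degN/deg_sign.
  by have := xN n.+1 g; rewrite (_ : n%:Z + k - n.+1%:Z = k - 1) //; lia.
have := homogeneousB xN (homogeneous_tot1 YN) (m := 0%N) (fun=> 0).
by rewrite xY const0_0 subr0.
Qed.

Lemma dcoch_eq0 j (w : coch j) i : dcoch w *~ (-1) ^+ i = 0 -> dcoch w = 0.
Proof.
by move=> E; rewrite -[LHS]mulr1z -(sqrr_sign _ i) expr2 mulrzA E mul0rz.
Qed.

(** In arities below [n] the degree in [W] exceeds [k], so exactness pushes the cocycle from arity
    zero up to arity [n], where it has a class in [R]. *)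
Lemma hyper_rel_onto n z : deg (n%:Z + k) z -> d z = 0 -> invariant z ->
  exists c : cochain L R n, hyper_rel c z.
Proof.
move=> zN dz zI; have dz0 m : tot (const0 z) m = 0.
  by rewrite tot_const0 // dz; case: m => [|m]; rewrite ?const0_0 ?const0_S.
have [||Y YN zY] := @clear_below (n%:Z + k) (const0 z) n (homogeneous_const0 zN).
- by [].
- by move=> m mn; lia.
pose x m := const0 z m - tot Y m.
have xN : homogeneous (n%:Z + k) x.
  by apply: homogeneousB; [exact: homogeneous_const0|exact: homogeneous_tot1].
have dx m : tot x m = 0 by rewrite totB dz0 tot_sq subrr.
have dxn : dcoch (x n) = 0.
  move: (dx n); case: (n) zY => [|i] zY //=; rewrite [x i]zY // delta0 add0r.
  exact: dcoch_eq0.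
have /choice[c cP] : forall g, exists s, rho (x n g) s.
  move=> g; apply: rho_tot; last exact: (congr1 (fun u => u g) dxn).
  by have := xN n g; rewrite addrAC subrr add0r.
exists c, x, (fun m => - Y m); split=> //; split=> [m g|m]; first exact/degN/YN.
have -> : tot (fun m => - Y m) m = - tot Y m.
  have := @totB (fun=> 0) Y m; rewrite (@tot0 (fun=> 0)) // sub0r => <-.
  by apply: eq_tot => j; rewrite sub0r.
by rewrite opprK subrK.
Qed.

(** The values of [c] are lifted to cocycles in [W], and the lift is completed to a total cocycle
    one arity at a time, the error being each time a [d]-boundary. Acyclicity then moves this
    cocycle to arity zero. *)
Lemma hyper_rel_total n (c : cochain L R n) : cochain_diff actR c = 0 ->
  exists z, hyper_rel c z.
Proof.
move=> dc; pose N := n%:Z + k.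
suff [x [xN xn xc dx]] : exists x, [/\ homogeneous N x, forall m, (m < n)%N -> x m = 0,
    forall g, rho (x n g) (c g) & forall m, tot x m = 0].
  have [|Y YN xY] := concentrate xN; first by move=> m; exact: dx.
  have E m : x m - tot Y m = const0 (x 0%N (fun=> 0) - tot Y 0%N (fun=> 0)) m.
    exact: (@eq_const0 (fun m => x m - tot Y m)).
  by exists (x 0%N (fun=> 0) - tot Y 0%N (fun=> 0)), x, Y; split.
(* Beyond arity [j + n] the total differential lies in negative degrees, so finitely many
   corrections suffice. *)
have [j Nj] : exists j : nat, k < j%:Z by exists `|k|.+1%N; lia.
suff [x [xN xn xc dx]] : exists x, [/\ homogeneous N x, forall m, (m < n)%N -> x m = 0,
    forall g, rho (x n g) (c g) & forall m, (m <= j + n)%N -> tot x m = 0].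
  exists x; split=> // m; have [/dx //|nm] := leqP m (j + n).
  by apply: (homogeneous_neg (homogeneous_tot xN)); rewrite /N; lia.
elim: (j) => {j Nj} [|j [x [xN xn xc dx]]].
  have /choice[z zP] : forall g, exists z, rho z (c g) by move=> g; exact: rho_onto.
  exists (single (z : coch n)); split=> [|m mn|g|m].
  - apply: homogeneous_single => g; rewrite /N addrAC subrr add0r.
    by case: (rho_cycle (zP g)).
  - by rewrite single_ne // gtn_eqF.
  - by rewrite single_id.
  rewrite add0n leq_eqVlt => /orP[/eqP->|mn]; last by rewrite tot_single_lt.
  rewrite tot_single_id (_ : dcoch _ = 0) ?mul0rz //; apply/funext => g.
  by case: (rho_cycle (zP g)).
pose m1 := (j + n).+1.
have du g : d (tot x m1 g) = 0.
  have := tot_sq x m1; rewrite /m1 /= dx // delta0 add0r => /dcoch_eq0.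
  by move/(congr1 (fun u => u g)).
have uN g : deg (k - j%:Z) (tot x m1 g).
  by have := homogeneous_tot xN (m := m1) g; rewrite (_ : N + 1 - m1%:Z = k - j%:Z) // /N /m1; lia.
have /choice[y yP] : forall g, exists y, deg (k - j%:Z - 1) y /\ tot x m1 g = d y.
  move=> g; have [j0|j0] := posnP j; last first.
    by have [|y] := exact (uN g) (du g); [lia|exists y].
  (* The first error has degree [k], where exactness fails; it is a boundary because its class is
     the coboundary of [c], which vanishes. *)
  subst j; have [y] : exists2 y, deg (k - 1) y & tot x m1 g = d y.
    apply: rho_bnd; rewrite /m1 /=.
    rewrite -[(_ + _) g]/(delta (x n) g + (dcoch (x n.+1) *~ (-1) ^+ n.+1) g).
    rewrite (_ : (0 : R) = 0 + 0); last by rewrite addr0.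
    apply: rhoD.
      have := @rho_delta n (x n) c xc g; by rewrite dc.
    rewrite fct_mulrz /dcoch -(raddfMz d); apply: bnd_rho; apply: deg_sign.
    by have := xN n.+1 g; rewrite (_ : N - n.+1%:Z = k - 1) // /N; lia.
  by rewrite -{1}(subr0 k); exists y.
pose Y := single ((fun g => y g *~ (-1) ^+ m1) : coch m1).
have YN : homogeneous N Y.
  apply: homogeneous_single => g; apply: deg_sign; case: (yP g).
  by rewrite (_ : k - j%:Z - 1 = N - m1%:Z) // /N /m1; lia.
exists (fun m => x m - Y m); split=> [|m mn|g|m].
- exact: homogeneousB.
- by rewrite xn // /Y single_ne ?subr0 // /m1 gtn_eqF // ltnS ltnW // ltn_addl.
- by rewrite /Y single_ne ?subr0 // /m1 gtn_eqF // ltnS leq_addl.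
rewrite addSn leq_eqVlt totB => /orP[/eqP->|mn]; last first.
  by rewrite dx // tot_single_lt ?subrr.
rewrite -/m1 /Y tot_single_id; apply/eqP; rewrite subr_eq0; apply/eqP/funext => g.
by rewrite fct_mulrz /dcoch (raddfMz d) -mulrzA -expr2 sqrr_sign mulr1z; case: (yP g).
Qed.

(** By [concentrate] the primitive may be taken in arity zero, where the equation in arity one says
    that it is invariant. *)
Lemma const0_boundary N z Y : homogeneous (N - 1) Y ->
  (forall m, const0 z m = tot Y m) -> exists2 y, deg (N - 1) y & invariant y /\ z = d y.
Proof.
move=> YN zY; have [|Y1 Y1N YY1] := concentrate YN.
  by move=> m; rewrite -zY const0_S.
pose y := Y 0%N (fun=> 0) - tot Y1 0%N (fun=> 0).
have yE m : Y m - tot Y1 m = const0 y m by exact: (@eq_const0 (fun m => Y m - tot Y1 m)).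
have ty m : tot (const0 y) m = const0 z m.
  by rewrite -(eq_tot yE) totB tot_sq subr0 -zY.
exists y.
  have := homogeneousB YN (homogeneous_tot1 Y1N) (m := 0%N) (fun=> 0).
  by rewrite yE const0_0 subr0.
split.
  apply: invariantP; have := ty 1%N; rewrite /const0 tot_singleS single_ne //.
by have := ty 0%N => /(congr1 (fun u => u (fun=> 0))); rewrite const0_0 /= const0_0.
Qed.

(** Both conditions say that the total cocycle joining [c] to [z] is a total coboundary; exactness
    reads this off in arity [n], acyclicity in arity zero. *)
Lemma hyper_rel_coboundary n (c : cochain L R n) z : hyper_rel c z ->
  @coboundary (cochain_complex actR) n c <->
  exists2 y, deg (n%:Z + k - 1) y & invariant y /\ z = d y.
Proof.
move=> [x [Y [xN dx xn xc [YN xY]]]]; split=> [cb|[y yN [yI zE]]].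
  suff [Y1 Y1N xY1] : exists2 Y1, homogeneous (n%:Z + k - 1) Y1 & forall m, x m = tot Y1 m.
    apply: (@const0_boundary (n%:Z + k) z (fun m => Y1 m - Y m)).
      exact: homogeneousB.
    by move=> m; rewrite totB -xY1 xY.
  suff [Y0 Y0N xY0] : exists2 Y0, homogeneous (n%:Z + k - 1) Y0 &
      (forall m, (m < n)%N -> x m - tot Y0 m = 0) /\ forall g, rho (x n g - tot Y0 n g) 0.
    case: xY0 => xY0 xn0; pose x0 m := x m - tot Y0 m.
    have x0N : homogeneous (n%:Z + k) x0 by apply: homogeneousB => //; exact: homogeneous_tot1.
    have dx0 m : tot x0 m = 0 by rewrite totB dx tot_sq subrr.
    have [//|g|Y1 Y1N x0Y1] := @clear_step (n%:Z + k) x0 n x0N.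
      by rewrite [_ + k - _]addrAC subrr add0r; exact: (rho_bnd (xn0 g)).
    have [||m mn||Y2 Y2N x0Y2] := @clear_above (n%:Z + k) (fun m => x0 m - tot Y1 m) n.+1.
    - by apply: homogeneousB => //; exact: homogeneous_tot1.
    - by move=> m; rewrite totB dx0 tot_sq subrr.
    - exact: x0Y1.
    - lia.
    exists (addf (addf Y0 Y1) Y2) => [m g|m]; first exact: degD (degD (Y0N _ _) (Y1N _ _)) (Y2N _ _).
    by rewrite !totD -x0Y2 /x0 -(addrA (x m)) -opprD addrCA subrr addr0.
  case: n => [|n] in c cb x Y xN dx xn xc YN xY *.
    exists (fun=> 0) => [m g|]; first exact: deg0.
    split=> // g; rewrite (@tot0 (fun=> 0)) // subr0.
    by have := xc g; rewrite cb.
  case: cb => b cb.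
  have /choice[y yP] : forall g, exists y, rho y (b g) by move=> g; exact: rho_onto.
  exists (single (y : coch n)).
    apply: homogeneous_single => g; have [yk _] := rho_cycle (yP g).
    by have E : n.+1%:Z + k - 1 - n%:Z = k; [lia|rewrite E].
  split=> [m|g].
    rewrite ltnS leq_eqVlt => /orP[/eqP->|mn]; last by rewrite xn ?tot_single_lt ?subrr // ltnW.
    rewrite xn // tot_single_id (_ : dcoch _ = 0) ?mul0rz ?subrr //; apply/funext => g.
    by have [] := rho_cycle (yP g).
  rewrite tot_singleS -(subrr (c g)) {2}cb; apply: rhoB; first exact: xc.
  exact: (rho_delta yP).
have tz m : tot (const0 y) m = const0 z m by rewrite tot_const0 // zE.
pose Y' := addf Y (const0 y).
have Y'N : homogeneous (n%:Z + k - 1) Y'.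
  by move=> m g; apply: degD; [exact: YN|exact: homogeneous_const0].
have xY' m : x m = tot Y' m by rewrite totD tz -xY addrC subrK.
case: n => [|n] in c x Y xN dx xn xc YN xY yN Y' Y'N xY' *.
  apply/funext => g; apply: rho0; have := xc g; rewrite xY' /= => H.
  rewrite -(subrr (dcoch (Y' 0%N) g)) -(subr0 (c g)); apply: rhoB => //.
  by apply: bnd_rho; have := Y'N 0%N g; rewrite add0r subr0.
have [m mn|m mn|Y2 Y2N Y'Y2] := @clear_below _ Y' n Y'N.
- by rewrite -xY' xn // ltnW.
- lia.
pose Y3 m := Y' m - tot Y2 m.
have Y3N : homogeneous (n.+1%:Z + k - 1) Y3.
  by apply: homogeneousB => //; exact: homogeneous_tot1.
have xY3 m : x m = tot Y3 m by rewrite totB tot_sq subr0.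
have dY3 : dcoch (Y3 n) = 0.
  have : tot Y3 n = 0 by rewrite -xY3 xn.
  case: (n) Y'Y2 => [|i] Y'Y2 //=; rewrite [Y3 i]Y'Y2 // delta0 add0r.
  exact: dcoch_eq0.
have /choice[b bP] : forall g, exists s, rho (Y3 n g) s.
  move=> g; apply: rho_tot; last exact: (congr1 (fun u => u g) dY3).
  by have := Y3N n g; rewrite (_ : _ - n%:Z = k) //; lia.
exists b; apply/funext => g; apply/eqP; rewrite -subr_eq0; apply/eqP/rho0.
have H : rho (delta (Y3 n) g + (dcoch (Y3 n.+1) *~ (-1) ^+ n.+1) g) (c g).
  by have := xc g; rewrite xY3.
have H2 : rho ((dcoch (Y3 n.+1) *~ (-1) ^+ n.+1) g) 0.
  rewrite fct_mulrz /dcoch -(raddfMz d); apply: bnd_rho; apply: deg_sign.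
  by have := Y3N n.+1 g; rewrite (_ : _ - n.+1%:Z = k - 1) //; lia.
have := rhoB (rhoB H H2) (rho_delta bP g).
by rewrite addrK subrr subr0.
Qed.
End Hyper.

(** * Exterior powers and multivectors *)

Section WedgeWords.
Variable M : zmodType.
Implicit Types (x y : M) (s t : seq M) (q : int).

Lemma wedge_swap q s x y t :
  wedge q (s ++ x :: y :: t) = - wedge q (s ++ y :: x :: t).
Proof.
have E z : wedge q (s ++ z :: (x + y) :: t) = wedge q (s ++ z :: x :: t) + wedge q (s ++ z :: y :: t).
  by have := wedgeD q (s ++ [:: z]) x y t; rewrite -!catA.
have := wedge_alt q s (x + y) t; rewrite wedgeD !E !wedge_alt add0r addr0.
by move/eqP; rewrite addr_eq0 => /eqP.
Qed.

Lemma wedge_move q x s t :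
  wedge q (x :: s ++ t) = wedge q (s ++ x :: t) *~ (-1) ^+ size s.
Proof.
suff H u : wedge q (u ++ x :: s ++ t) = wedge q (u ++ s ++ x :: t) *~ (-1) ^+ size s.
  exact: (H [::]).
elim: s u => [|y s IH] u /=; first by rewrite expr0 mulr1z.
rewrite wedge_swap -cat_rcons IH -cats1 -catA /= exprS mulN1r mulrNz.
by [].
Qed.

Lemma wedge_repeat q x s t : wedge q (x :: s ++ x :: t) = 0.
Proof. by rewrite -cat_cons -cat1s -catA cat1s wedge_move (wedge_alt q s x t) mul0rz. Qed.

Lemma ext_multDl q x y (w : ext_power M q) :
  ext_mult (x + y) q w = ext_mult x q w + ext_mult y q w.
Proof.
move: w; apply: ext_ext => [u v|u v|s]; first exact: raddfB.
  by rewrite !raddfB opprD addrACA.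
by rewrite !ext_multE (wedgeD _ [::]).
Qed.

Lemma ext_multBl q x y (w : ext_power M q) :
  ext_mult (x - y) q w = ext_mult x q w - ext_mult y q w.
Proof. by rewrite -[x in RHS](subrK y) (ext_multDl (x - y) y) addrK. Qed.

Definition ext_mult_by q (w : ext_power M q) : M -> ext_power M (q + 1) :=
  fun x => ext_mult x q w.

Fact ext_mult_by_additive q w : zmod_morphism (@ext_mult_by q w).
Proof. by move=> x y; exact: ext_multBl. Qed.
HB.instance Definition _ q w := GRing.isZmodMorphism.Build
  M (ext_power M (q + 1)) (@ext_mult_by q w) (@ext_mult_by_additive q w).
End WedgeWords.

Section EnumSplit.
Variable E : finType.
Implicit Types (e : E) (A : {set E}).

(** Links [sg], which counts smaller elements, to the position of [e] in a sorted word. *)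
Lemma enum_split e A : exists s1 s2, let s := enum A in
  [/\ (e \notin A -> s = s1 ++ s2), (e \in A -> s = s1 ++ e :: s2),
      enum (e |: A) = s1 ++ e :: s2 & sg e A = (-1) ^+ size s1].
Proof.
have [t1 [t2 [tE lt1]]] : exists t1 t2, enum E = t1 ++ e :: t2 /\ forall x, (x \in t1) = ltE x e.
  exists (take (enum_rank e) (enum E)), (drop (enum_rank e).+1 (enum E)).
  have er : (enum_rank e < size (enum E))%N by rewrite -cardE ltn_ord.
  split; first by rewrite -{1}(cat_take_drop (enum_rank e) (enum E)) (drop_nth e er) nth_enum_rank.
  move=> x; rewrite in_take ?mem_enum // /ltE; congr (_ < _)%N.
  by rewrite -{1}[x](nth_enum_rank e) index_uniq ?enum_uniq // -cardE ltn_ord.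
have uE : uniq (t1 ++ e :: t2) by rewrite -tE enum_uniq.
have [et1 et2] : e \notin t1 /\ e \notin t2.
  move: uE; rewrite cat_uniq /= negb_or => /and3P[_ /andP[-> _] /andP[-> _]] //.
have fE B : enum B = [seq x <- t1 | x \in B] ++ (if e \in B then e :: [seq x <- t2 | x \in B] else [seq x <- t2 | x \in B]).
  by rewrite {1}/enum_mem -enumT tE filter_cat.
have fe (t : seq E) : e \notin t -> [seq x <- t | x \in e |: A] = [seq x <- t | x \in A].
  move=> et; apply: eq_in_filter => x xt; rewrite !inE.
  by case: eqP xt et => [->->|].
exists [seq x <- t1 | x \in A], [seq x <- t2 | x \in A] => /=; split.
- by move=> eA; rewrite fE (negPf eA).
- by move=> eA; rewrite fE eA.
- by rewrite fE setU11 !fe.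
rewrite /sg /before; congr (_ ^+ _); rewrite -(card_uniqP _); last first.
  by apply: filter_uniq; move: uE; rewrite cat_uniq => /andP[].
by apply: eq_card => x; rewrite !inE mem_filter lt1.
Qed.
End EnumSplit.

Section WedgeSum.
Variables (E : finType) (M : zmodType) (b : E -> M).
Variables (V : zmodType).

Lemma wedge_enum_cre q e (A : {set E}) : e \notin A ->
  wedge q (map b (enum (e |: A))) *~ sg e A = wedge q (b e :: map b (enum A)).
Proof.
have [s1 [s2 [/(_ _)E1 _ -> ->]]] := enum_split e A => eA; rewrite (E1 eA).
by rewrite !map_cat wedge_move size_map.
Qed.

Lemma wedge_enum_in q e (A : {set E}) : e \in A -> wedge q (b e :: map b (enum A)) = 0.
Proof.
have [s1 [s2 [_ /(_ _)E1 _ _]]] := enum_split e A => eA; rewrite (E1 eA).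
by rewrite map_cat /= wedge_repeat.
Qed.

Section Pair.
Variables (q : int) (T : zmodType) (pr : V -> ext_power M q -> T).
Hypothesis prBl : forall w, {morph pr^~ w : v v' / v - v'}.
Hypothesis prBr : forall v, {morph pr v : w w' / w - w'}.

Let prl w : {additive V -> T} :=
  HB.pack (pr^~ w) (GRing.isZmodMorphism.Build V T (pr^~ w) (prBl w)).
Let prr v : {additive ext_power M q -> T} :=
  HB.pack (pr v) (GRing.isZmodMorphism.Build (ext_power M q) T (pr v) (prBr v)).

(** The pairing is left open for two uses: scalar multiplication gives [form_ext], the tensor
    product gives [theta]. *)
Definition wedge_sum (x : {set E} -> V) : T :=
  \sum_(A : {set E}) pr (x A) (wedge q (map b (enum A))).

Lemma wedge_sumB x y : wedge_sum (x - y) = wedge_sum x - wedge_sum y.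
Proof. by rewrite -sumrB; apply: eq_bigr => A _; rewrite -prBl. Qed.

(** On the right, sets containing [e] give a word with a repeated letter; the others correspond to
    the sets on the left by adding [e]. *)
Lemma wedge_sum_cre e x : wedge_sum (cre e x) =
  \sum_(A : {set E}) pr (x A) (wedge q (b e :: map b (enum A))).
Proof.
have pr0l w : pr 0 w = 0 by exact: (raddf0 (prl w)).
have pr0r v : pr v 0 = 0 by exact: (raddf0 (prr v)).
rewrite /wedge_sum (bigID (fun A : {set E} => e \in A)) /=.
rewrite [X in _ + X]big1 ?addr0 => [|A eA]; last by rewrite /cre (negPf eA) pr0l.
rewrite [RHS](bigID (fun A : {set E} => e \in A)) /=.
rewrite [X in _ = X + _]big1 ?add0r => [|A eA]; last by rewrite wedge_enum_in.
rewrite (reindex_onto (fun A => e |: A) (fun A => A :\ e)) /=; last first.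
  by move=> A eA; rewrite setD1K.
apply: eq_big => [A|A /andP[_ /eqP eA]].
  rewrite setU11 /=; apply/eqP/idP => [<-|eA]; first by rewrite !inE eqxx.
  exact: setU1K.
have neA : e \notin A by rewrite -eA !inE eqxx.
rewrite /cre setU11 setU1K // sg_setU1id -wedge_enum_cre //.
have prlM w v n : pr (v *~ n) w = pr v w *~ n by exact: (raddfMz (prl w) n v).
have prrM v w n : pr v (w *~ n) = pr v w *~ n by exact: (raddfMz (prr v) n w).
by rewrite prlM prrM.
Qed.
End Pair.
End WedgeSum.

Section Words.
Variables (E : finType).
Local Notation X := {ffun E -> int}.
Local Notation Om := ({set E} -> int).

Lemma crevDl (u u' : E -> int) (w : Om) :
  crev (fun e => u e + u' e) w = crev u w + crev u' w.
Proof. by rewrite /crev -big_split; apply: eq_bigr => e _; rewrite mulrzDr. Qed.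

Lemma eq_crev (u u' : E -> int) (w : Om) : u =1 u' -> crev u w = crev u' w.
Proof. by move=> uu; apply: eq_bigr => e _; rewrite uu. Qed.

Lemma eq_annv (u u' : E -> int) (w : Om) : u =1 u' -> annv u w = annv u' w.
Proof. by move=> uu; apply: eq_bigr => e _; rewrite uu. Qed.

Section Module.
Variables (M : zmodType) (co : {additive M -> X}).

Definition word_form (s : seq M) : Om := foldr (fun x w => crev (co x) w) (vac 1 : Om) s.

Lemma word_formD s x y t : word_form (s ++ (x + y) :: t) =
  word_form (s ++ x :: t) + word_form (s ++ y :: t).
Proof.
elim: s => [|z s IH] /=; last by rewrite IH raddfD.
by rewrite -crevDl; apply: eq_crev => e; rewrite raddfD ffunE.
Qed.

Lemma word_form_alt s x t : word_form (s ++ [:: x, x & t]) = 0.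
Proof. by elim: s => [|z s IH] /=; [exact: crev_sq|rewrite IH raddf0]. Qed.

Lemma word_form_size s C : word_form s C != 0 -> #|C| = size s.
Proof.
elim: s C => [|x s IH] C /=.
  by rewrite /vac; case: ifP => [/eqP->|_]; rewrite ?cards0 ?eqxx.
rewrite /crev fct_sumE => n0.
have [f fn0|H] := pickP (fun f => (cre f (word_form s) *~ co x f) C != 0); last first.
  by case/eqP: n0; rewrite big1 // => f _; apply/eqP; move: (H f) => /negbFE.
move: fn0; rewrite fct_mulrz /cre; case: ifP => fC; last by rewrite mul0rz eqxx.
rewrite -mulrzA => wn0; rewrite (cardsD1 f) fC add1n; congr S; apply: IH.
by apply: contraNneq wn0 => ->; rewrite mul0rz.
Qed.

Lemma ann_word_form e s : ann e (word_form s) =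
  \sum_(i < size s) word_form (take i s ++ drop i.+1 s) *~ ((-1) ^+ i * co (nth 0 s i) e).
Proof.
elim: s => [|x s IH] /=; first by rewrite big_ord0 ann_vac.
rewrite ann_crev IH big_ord_recl /= drop0 mul1r; congr (_ + _).
rewrite (raddf_sum (crev (co x))) -sumrN; apply: eq_bigr => i _.
by rewrite (raddfMz (crev (co x))) /= exprS mulN1r mulNr mulrNz.
Qed.

Fact ext_form_rel q a : ext_rel q a ->
  lin (fun s => if (size s)%:Z == q then word_form s else 0) a = 0.
Proof.
have sz (s t : seq M) (x y : M) : size (s ++ x :: t) = size (s ++ y :: t).
  by rewrite !size_cat.
case=> [s /negPf sq|s x y t|s x t]; rewrite ?raddfB /= !linU.
- by rewrite sq.
- rewrite !(sz s t _ 0); case: ifP => _; last by rewrite !subr0.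
  by rewrite word_formD -addrA -opprD subrr.
- by rewrite word_form_alt if_same.
Qed.

Definition ext_form q : {additive ext_power M q -> Om} := qlift (@ext_form_rel q).

Lemma ext_formE q s : ext_form q (wedge q s) = if (size s)%:Z == q then word_form s else 0.
Proof. by apply: etrans (qliftE _ _) _; rewrite /= linU. Qed.

Lemma ext_form_deg q x C : ext_form q x C != 0 -> #|C|%:Z = q.
Proof.
move=> n0; apply/eqP; apply: contraNT n0 => Cq; apply/eqP; move: x.
pose ev := fun w : Om => w C.
have evB : zmod_morphism ev by [].
apply: (@ext_ext _ _ _ (fun x => ext_form q x C) (fun=> 0)) => [u v|u v|s].
- by rewrite raddfB.
- by rewrite subr0.
rewrite ext_formE; case: ifP => // /eqP sq; apply/eqP; apply: contraNT Cq => /word_form_size ->.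
by rewrite sq.
Qed.
End Module.

(** The inverse construction, for a module spanned by the [b e]. *)
Section Span.
Variables (M : zmodType) (b : E -> M) (q : int).

Definition form_ext (w : Om) : ext_power M q :=
  wedge_sum b (fun (n : int) (x : ext_power M q) => x *~ n) w.

Fact form_ext_additive : zmod_morphism form_ext.
Proof. by move=> w w'; apply: wedge_sumB => x u v; exact: mulrzBr. Qed.
HB.instance Definition _ := GRing.isZmodMorphism.Build
  Om (ext_power M q) form_ext form_ext_additive.
End Span.

Lemma form_ext_cre (M : zmodType) (b : E -> M) q e w :
  form_ext b (q + 1) (cre e w) = ext_mult (b e) q (form_ext b q w).
Proof.
rewrite {1}/form_ext wedge_sum_cre => [|x u v|n u v]; [|exact: mulrzBr|exact: mulrzBl].
rewrite (raddf_sum (ext_mult (b e) q)); apply: eq_bigr => A _.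
by rewrite (raddfMz (ext_mult (b e) q)) ext_multE.
Qed.

Lemma form_ext_crev (M : zmodType) (b : E -> M) q (u : E -> int) w :
  form_ext b (q + 1) (crev u w) = ext_mult (\sum_e b e *~ u e) q (form_ext b q w).
Proof.
rewrite /crev (raddf_sum (form_ext b (q + 1))).
rewrite -[RHS]/(ext_mult_by (form_ext b q w) _) raddf_sum; apply: eq_bigr => e _.
by rewrite (raddfMz (form_ext b (q + 1))) raddfMz /= form_ext_cre.
Qed.

Lemma form_ext_vac (M : zmodType) (b : E -> M) : form_ext b 0 (vac 1 : Om) = wedge 0 [::].
Proof.
rewrite /form_ext /wedge_sum (bigD1 set0) //= /vac eqxx mulr1z enum_set0 /=.
by rewrite big1 ?addr0 // => A /negPf ->; rewrite mulr0z.
Qed.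

Lemma form_ext_word (M N : zmodType) (co : {additive M -> X}) (b : E -> N) (s : seq M) :
  form_ext b (size s)%:Z (word_form co s) =
  wedge (size s)%:Z (map (fun x => \sum_e b e *~ co x e) s).
Proof.
elim: s => [|x s IH] /=; first exact: form_ext_vac.
by rewrite -addn1 PoszD form_ext_crev IH ext_multE.
Qed.

(** The factors are inserted from the last to the first in sorted order, each one at the front, so
    no sign arises. *)
Lemma foldr_cre_enum (V : zmodType) (v : V) (A : {set E}) :
  foldr (fun e w => cre e w) (vac v) (enum A) = fun D => if D == A then v else 0.
Proof.
have [s] : exists s, s = enum A by eexists.
elim: s A => [|e s IH] A sE; rewrite -sE /=.
  suff -> : A = set0 by [].
  by apply/setP => x; rewrite inE -mem_enum -sE.
have eA : e \in A by rewrite -mem_enum -sE inE eqxx.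
have [s1 [s2 [/(_ _)E1 _ E2 E3]]] := enum_split e (A :\ e).
have eA' : e \notin A :\ e by rewrite !inE eqxx.
move: (E1 eA') E2 => {}E1; rewrite setD1K // -sE; case: s1 E1 E3 => [|y s1] E1 E3 /=; last first.
  case=> ey _; have : y \in enum (A :\ e) by rewrite E1 inE eqxx.
  by rewrite -ey mem_enum (negPf eA').
case=> s2E; have sA : s = enum (A :\ e) by rewrite E1.
rewrite sA (IH _ sA).
apply/funext => D; rewrite /cre; case: ifPn => eD; last first.
  by case: eqP => // DA; move: eD; rewrite DA eA.
have -> : (D :\ e == A :\ e) = (D == A).
  by apply/eqP/eqP => [DA|->//]; rewrite -(setD1K eD) DA setD1K.
case: eqP => [->|_]; last by rewrite mul0rz.
by rewrite -sg_setD1id E3 expr0 mulr1z.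
Qed.

Definition pairX (phi x : X) : int := \sum_e phi e * x e.

Fact pairX_additive phi : zmod_morphism (pairX phi).
Proof. by move=> x y; rewrite -sumrB; apply: eq_bigr => e _; rewrite !ffunE mulrBr. Qed.
HB.instance Definition _ phi := GRing.isZmodMorphism.Build X int (pairX phi) (pairX_additive phi).

(** The map [x |-> x - u * phi x], where [(u, phi)] is the pair. *)
Definition elem (up : X * X) (x : X) : X := x - up.1 *~ pairX up.2 x.

Fact elem_additive up : zmod_morphism (elem up).
Proof.
have zE (N : zmodType) (a b c e : N) : a - b - (c - e) = a - c - (b - e).
  by rewrite !opprB addrACA [RHS]addrACA [- b - c]addrC.
by move=> x y; rewrite /elem raddfB mulrzBr zE.
Qed.
HB.instance Definition _ up := GRing.isZmodMorphism.Build X X (elem up) (elem_additive up).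

Notation wordX := (word_form (idfun : {additive X -> X})).

Lemma ffunX_mulrz (c : X) n x : (c *~ n) x = c x *~ n.
Proof. by case: n => n; rewrite ?NegzE ?mulrNz -!pmulrn ?ffunE ffunMnE. Qed.

(** The map that a rank one change x - u phi(x) induces on multivectors has a single correction
    term, since further ones would contain u twice. *)
Lemma wordX_elem up s :
  wordX (map (elem up) s) = wordX s - crev up.1 (annv up.2 (wordX s)).
Proof.
elim: s => [|x s IH] /=.
  suff -> : annv up.2 (vac 1 : Om) = 0 by rewrite raddf0 subr0.
  by rewrite /annv big1 // => e _; rewrite ann_vac mul0rz.
set w := wordX s in IH *.
have cE w' : crev (elem up x) w' = crev x w' - crev up.1 w' *~ pairX up.2 x.
  rewrite /crev mulrz_suml -sumrB; apply: eq_bigr => e _.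
  by rewrite !ffunE ffunX_mulrz -mulrzA -mulrzBr mulrzz.
have L : crev (elem up x) (w - crev up.1 (annv up.2 w)) =
    crev x w - crev x (crev up.1 (annv up.2 w)) - crev up.1 w *~ pairX up.2 x.
  by rewrite cE (raddfB (crev x)) (raddfB (crev up.1)) /= crev_sq subr0.
rewrite IH L annv_crev -/(pairX up.2 x) (raddfB (crev up.1)) (raddfMz (crev up.1)) /=.
by rewrite (crev_anti up.1 x) opprK opprD addrA addrAC.
Qed.

Definition elems (l : seq (X * X)) (x : X) : X := foldr elem x l.

Fact elems_additive l : zmod_morphism (elems l).
Proof. by elim: l => [|up l IH] x y //=; rewrite IH raddfB. Qed.
HB.instance Definition _ l := GRing.isZmodMorphism.Build X X (elems l) (elems_additive l).

Definition elem_form (up : X * X) (w : Om) : Om := w - crev up.1 (annv up.2 w).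

Fact elem_form_additive up : zmod_morphism (elem_form up).
Proof.
have zE (N : zmodType) (a b c e : N) : a - b - (c - e) = a - c - (b - e).
  by rewrite !opprB addrACA [RHS]addrACA [- b - c]addrC.
by move=> w w'; rewrite /elem_form (raddfB (annv up.2)) (raddfB (crev up.1)); exact: zE.
Qed.
HB.instance Definition _ up := GRing.isZmodMorphism.Build Om Om (elem_form up) (elem_form_additive up).

Definition elems_form (l : seq (X * X)) (w : Om) : Om := foldr elem_form w l.

Fact elems_form_additive l : zmod_morphism (elems_form l).
Proof. by elim: l => [|up l IH] x y //=; rewrite IH raddfB. Qed.
HB.instance Definition _ l := GRing.isZmodMorphism.Build Om Om (elems_form l) (elems_form_additive l).

Lemma wordX_elems_fix (l : seq (X * X)) (w : Om) : (forall up, up \in l -> annv up.2 w = 0) ->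
  elems_form l w = w.
Proof.
elim: l => [|up l IH] H //=; rewrite IH => [|v vl]; last by apply: H; rewrite inE vl orbT.
by rewrite /elem_form H ?inE ?eqxx // raddf0 subr0.
Qed.

Lemma wordX_elems l s : wordX (map (elems l) s) =
  elems_form l (wordX s).
Proof.
elim: l => [|up l IH] /=; first by rewrite (eq_map (g := id)) ?map_id.
by rewrite -IH /elem_form -wordX_elem -map_comp.
Qed.
End Words.
Arguments elem {E} up x.
Arguments elems {E} l x.
Arguments pairX {E} phi x.
Notation wordX := (word_form (idfun : {additive {ffun _ -> int} -> {ffun _ -> int}})).

(** * Retraction of chains onto the cycles that avoid a face *)

Section Retraction.
Variables (G : graph) (v0 : vertex G).
Local Notation E := (edge G).
Local Notation X := {ffun E -> int}.
Local Notation Om := ({set E} -> int).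
Implicit Types (S T : {set E}) (e : E) (x : X).

(** A chain from [v0] to [v] avoiding [S]. *)
Definition path_chain S v : X :=
  if pselect (exists c, off S c /\ forall w, boundary c w = (w == v)%:R - (w == v0)%:R)
  is left ex then projT1 (cid ex) else 0.

Lemma path_chainP S v : conn S ->
  off S (path_chain S v) /\ forall w, boundary (path_chain S v) w = (w == v)%:R - (w == v0)%:R.
Proof.
move=> cS; rewrite /path_chain; case: pselect => [ex|[]]; first by case: (cid ex).
by have /connP/(_ v0 v)/connect_chain[c] := cS; exists c.
Qed.

Definition incX v : X := [ffun e => inc v e].

Lemma pairX_inc v x : pairX (incX v) x = boundary x v.
Proof. by rewrite boundaryE; apply: eq_bigr => e _; rewrite ffunE mulrC. Qed.

Lemma pairX_delt e x : pairX (delt e) x = x e.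
Proof.
rewrite /pairX (bigD1 e) //= ffunE eqxx mul1r big1 ?addr0 // => f fe.
by rewrite ffunE (negPf fe) mul0r.
Qed.

(** As [foldr] applies the last steps first, the coordinates in [S] are cleared, and then the
    boundary at each vertex is moved to the root along a chain avoiding [S]. Decomposing into rank
    one steps makes the induced map on multivectors computable by [wordX_elems]. *)
Definition retr_steps S : seq (X * X) :=
  [seq (path_chain S v, incX v) | v <- enum (vertex G)] ++ [seq (delt e, delt e) | e <- enum S].

Definition retr S : {additive X -> X} := elems (retr_steps S).

Lemma boundary_sum x : \sum_v boundary x v = 0.
Proof.
under eq_bigr => v _ do rewrite boundaryE.
rewrite exchange_big big1 // => e _; rewrite -mulr_sumr /inc sumrB.
have H w : \sum_v (w == v)%:R = 1 :> int.
  by rewrite (bigD1 w) //= eqxx big1 ?addr0 // => v; rewrite eq_sym => /negPf->.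
by rewrite !H subrr mulr0.
Qed.

Lemma retrP S x : conn S -> boundary (retr S x) = 0 /\ off S (retr S x).
Proof.
move=> cS; rewrite /= /elems /retr_steps foldr_cat.
set y := foldr elem x _.
have yS : off S y.
  suff H (s : seq E) : forall e, e \in s -> foldr elem x [seq (delt e, delt e) | e <- s] e = 0.
    by move=> e eS; apply: H; rewrite mem_enum.
  elim: s => //= f s IH e; rewrite inE => H.
  rewrite {1}/elem !ffunE ffunX_mulrz /= pairX_delt ffunE.
  have [->|ef] := eqVneq e f; first by rewrite intz subrr.
  by rewrite mul0rz subr0 IH //; move: H; rewrite (negPf ef).
suff H (s : seq (vertex G)) : off S (foldr elem y [seq (path_chain S v, incX v) | v <- s]) /\
    forall v, v \in s -> v != v0 -> boundary (foldr elem y [seq (path_chain S v, incX v) | v <- s]) v = 0.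
  have [H1 H2] := H (enum (vertex G)); split=> //.
  have H3 v : v != v0 -> boundary (foldr elem y [seq (path_chain S v, incX v) | v <- enum (vertex G)]) v = 0.
    by apply: H2; rewrite mem_enum.
  (* At the root the boundary vanishes because the coefficients of a boundary add up to zero. *)
  apply/ffunP => v; rewrite ffunE; have [->|/H3 //] := eqVneq v v0.
  have := boundary_sum (foldr elem y [seq (path_chain S v, incX v) | v <- enum (vertex G)]).
  by rewrite (bigD1 v0) //= big1 ?addr0 // => w /H3.
elim: s => [|u s [IH1 IH2]] //=; have [cS1 cb] := path_chainP u cS; split=> [e eS|v].
  by rewrite {1}/elem !ffunE IH1 // ffunX_mulrz cS1 // mul0rz subrr.
rewrite inE {2}/elem raddfB /= ffunE raddfMz /= !ffunE ffunX_mulrz cb pairX_inc => H vv.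
rewrite (negPf vv) subr0; have [->|vu] := eqVneq v u; first by rewrite intz subrr.
by rewrite mul0rz subr0 IH2 //; move: H; rewrite (negPf vu).
Qed.

Lemma retr_id S x : boundary x = 0 -> off S x -> retr S x = x.
Proof.
move=> bx xS; rewrite /= /elems.
have : forall up, up \in retr_steps S -> pairX up.2 x = 0.
  move=> up; rewrite mem_cat => /orP[]/mapP[y yS ->] /=.
    by rewrite pairX_inc bx ffunE.
  by rewrite pairX_delt xS // -mem_enum.
elim: retr_steps => //= up l IH H; rewrite IH => [|v vl]; last by apply: H; rewrite inE vl orbT.
by rewrite /elem H ?inE ?eqxx // mulr0z subr0.
Qed.

(** * Exterior powers of the cycle groups *)

Section Face.
Variable S : {set E}.
Hypothesis cS : conn S.
Local Notation L := (H1 (delete S)).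

Definition cycle_val (c : L) : X := [ffun e => edge_pairing e c].

Fact cycle_val_additive : zmod_morphism cycle_val.
Proof. by move=> c d; apply/ffunP => e; rewrite !ffunE raddfB. Qed.
HB.instance Definition _ := GRing.isZmodMorphism.Build L X cycle_val cycle_val_additive.

Lemma cycle_val_off c : off S (cycle_val c).
Proof. by move=> e eS; rewrite ffunE /edge_pairing insubF // eS. Qed.

Lemma boundary_restr (x : X) : off S x ->
  boundary ([ffun e => x (val e)] : {ffun edge (delete S) -> int}) = boundary x.
Proof.
move=> xS; apply/ffunP => v; rewrite !boundaryE.
under eq_bigr => e _ do rewrite ffunE.
rewrite (sum_edge_delete S (fun e => x e * @inc G v e)) (@boundaryE G x v) [RHS](bigID (mem S)) /=.
by rewrite [X in _ = X + _]big1 ?add0r // => e eS; rewrite xS // mul0r.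
Qed.

Lemma cycle_val_boundary c : boundary (cycle_val c) = 0.
Proof.
have bc : boundary (ker_val c) = 0 by apply/eqP; case: (c).
apply: etrans (esym (boundary_restr (@cycle_val_off c))) _; apply: etrans bc.
apply: (congr1 (@boundary (delete S))).
by apply/ffunP => e; rewrite !ffunE /edge_pairing valK.
Qed.

Definition face_retr (x : X) : L :=
  insubd 0 ([ffun e => retr S x (val e)] : {ffun edge (delete S) -> int}).

Lemma face_retrK x : cycle_val (face_retr x) = retr S x.
Proof.
have [bx xS] := retrP x cS.
have k : ([ffun e => retr S x (val e)] : {ffun edge (delete S) -> int}) \in kernel (@boundary (delete S)).
  by rewrite unfold_in; apply/eqP; exact: etrans (boundary_restr xS) bx.
apply/ffunP => e; rewrite ffunE /edge_pairing (insubdK _ k : ker_val (face_retr x) = _).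
by case: insubP => [e' _ <- /=|]; [rewrite ffunE|rewrite negbK => /xS ->].
Qed.

Lemma cycle_val_inj : injective cycle_val.
Proof.
move=> c d cd; apply/val_inj/ffunP => e.
by have := congr1 (fun u : X => u (val e)) cd; rewrite !ffunE /edge_pairing valK.
Qed.

Lemma cycle_valK : cancel cycle_val face_retr.
Proof.
move=> c; apply: cycle_val_inj; rewrite face_retrK retr_id //.
  exact: cycle_val_boundary.
exact: cycle_val_off.
Qed.

Fact face_retr_additive : zmod_morphism face_retr.
Proof. by move=> x y; apply: cycle_val_inj; rewrite raddfB /= !face_retrK raddfB. Qed.

Definition face_retrA : {additive X -> L} :=
  HB.pack face_retr (GRing.isZmodMorphism.Build X L face_retr face_retr_additive).

Definition form_of q : {additive ext_power L q -> Om} :=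
  ext_form [the {additive L -> X} of cycle_val] q.

Definition of_form q : {additive Om -> ext_power L q} :=
  form_ext (fun e => face_retr (delt e)) q.

Lemma sum_delt (N : zmodType) (f : {additive X -> N}) x : \sum_e f (delt e) *~ x e = f x.
Proof.
have {2}-> : x = \sum_e delt e *~ x e.
  apply/ffunP => e; rewrite sum_ffunE (bigD1 e) //= ffunX_mulrz ffunE eqxx intz.
  by rewrite big1 ?addr0 // => f' fe; rewrite ffunX_mulrz ffunE eq_sym (negPf fe) mul0rz.
by rewrite raddf_sum; apply: eq_bigr => e _; rewrite raddfMz.
Qed.

Lemma form_ofK q : cancel (form_of q) (of_form q).
Proof.
apply: (@ext_ext _ _ _ (fun y => of_form q (form_of q y)) id) => [u v|//|s].
  by rewrite !raddfB.
rewrite /form_of ext_formE; case: eqP => [<-|/eqP sq]; last by rewrite raddf0 wedge_size.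
rewrite /of_form /= form_ext_word; congr wedge; rewrite -[RHS]map_id.
apply: eq_map => c /=; rewrite -[RHS]cycle_valK.
exact: (sum_delt face_retrA).
Qed.

Lemma word_form_inO (s : seq L) : inO S (word_form [the {additive L -> X} of cycle_val] s).
Proof.
elim: s => [|c s IH] /=; last exact: inO_crev (cycle_val_boundary c) (@cycle_val_off c) IH.
by split=> [e _|v]; [exact: ann_vac|rewrite /annv big1 // => e _; rewrite ann_vac mul0rz].
Qed.

Lemma form_of_inO q (y : ext_power L q) : inO S (form_of q y).
Proof.
have W s : inO S (form_of q (wedge q s)).
  by rewrite /form_of ext_formE; case: ifP => _; [exact: word_form_inO|exact: inO0].
split=> [e eS|v]; move: y.
  apply: (@ext_ext _ _ _ (fun y => ann e (form_of q y)) (fun=> 0)) => [u u'|u u'|s].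
  - by rewrite !raddfB.
  - by rewrite subr0.
  - by case: (W s) => -> .
apply: (@ext_ext _ _ _ (fun y => annv (inc v) (form_of q y)) (fun=> 0)) => [u u'|u u'|s].
- by rewrite !raddfB.
- by rewrite subr0.
- by case: (W s) => _ ->.
Qed.

(** The composite is the map induced by the retraction. Each of its steps fixes a multivector killed
    by the functional of that step, and membership in [inO S] provides exactly this. *)
Lemma of_formK q (w : Om) : inO S w -> (forall C, w C != 0 -> #|C|%:Z = q) ->
  form_of q (of_form q w) = w.
Proof.
move=> [wS wv] wq; have WE (C : {set E}) : wordX (map (@delt G) (enum C)) = fun D => if D == C then 1 else 0.
  rewrite -foldr_cre_enum; elim: (enum C) => //= e s ->.
  rewrite /crev (bigD1 e) //= ffunE eqxx mulr1z big1 ?addr0 // => f fe.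
  by rewrite ffunE (negPf fe) mulr0z.
have wE : w = \sum_(C : {set E}) wordX (map (@delt G) (enum C)) *~ w C.
  apply/funext => D; rewrite fct_sumE (bigD1 D) //= fct_mulrz WE eqxx intz big1 ?addr0 // => C CD.
  by rewrite fct_mulrz WE eq_sym (negPf CD) mul0rz.
transitivity (elems_form (retr_steps S) w); last first.
  rewrite wordX_elems_fix // => up; rewrite mem_cat => /orP[]/mapP[y yS ->] /=.
    by rewrite -[RHS](wv y); apply: eq_annv => e; rewrite ffunE.
  have yS' : y \in S by rewrite -mem_enum.
  apply: etrans (wS y yS'); rewrite /annv (bigD1 y) //= ffunE eqxx mulr1z.
  by rewrite big1 ?addr0 // => f fy; rewrite ffunE (negPf fy) mulr0z.
rewrite {2}wE (raddf_sum (elems_form (retr_steps S))).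
rewrite /of_form /= /form_ext /wedge_sum (raddf_sum (form_of q)); apply: eq_bigr => C _.
rewrite (raddfMz (form_of q)) (raddfMz (elems_form (retr_steps S))) /=.
have [->|/wq Cq] := eqVneq (w C) 0; first by rewrite !mulr0z.
congr (_ *~ _); rewrite /form_of ext_formE size_map -cardE Cq eqxx -wordX_elems -map_comp.
elim: (enum C) => //= e s ->; apply: eq_crev => f.
by rewrite (face_retrK (delt e)).
Qed.

Lemma form_of_contract e q q' (y : ext_power L q) : q = q' + 1 ->
  form_of q' (contract (@edge_pairing G S e) q q' y) = ann e (form_of q y).
Proof.
move=> qq; move: y; apply: (@ext_ext _ _ _ (fun y => form_of q' (contract (@edge_pairing G S e) q q' y))
  (fun y => ann e (form_of q y))) => [u u'|u u'|s]; [by rewrite !raddfB..|].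
rewrite contractE /form_of !ext_formE; case: eqP => [sq|_]; last by rewrite !raddf0.
rewrite ann_word_form (raddf_sum (ext_form _ q')); apply: eq_bigr => i _.
rewrite (raddfMz (ext_form _ q')) /= ext_formE ffunE ifT //.
rewrite size_cat size_take size_drop ltn_ord; apply/eqP.
have := ltn_ord i; move: (nat_of_ord i) sq qq => j sq qq ji; lia.
Qed.
End Face.

Section FaceMaps.
Variables (S T : {set E}).
Hypotheses (cS : conn S) (cT : conn T).

Lemma form_of_incl q y : S \subset T ->
  form_of S q (ext_map (@H1_incl G S T) q y) = form_of T q y.
Proof.
move=> ST; move: y; apply: (@ext_ext _ _ _ (fun y => form_of S q (ext_map (@H1_incl G S T) q y))
  (form_of T q)) => [u u'|u u'|s]; [by rewrite !raddfB..|].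
rewrite ext_mapE /form_of !ext_formE size_map; case: ifP => // _.
elim: s => //= c s ->; apply: eq_crev => e; rewrite !ffunE /edge_pairing.
case: insubP => [e' eS e'E|]; last first.
  by rewrite negbK => /(subsetP ST) eT; rewrite insubF // eT.
by rewrite /= H1_inclE // ffunE e'E.
Qed.

(** [interior] is characterised after the inclusion into the larger cycle group. On multivectors
    this inclusion becomes the identity and the contraction becomes [ann e]. The cycle required by
    [interiorP] exists because [e] is not a bridge of G \ S. *)
Lemma of_form_interior e q q' (w : Om) : q = q' + 1 -> e \notin S -> T = e |: S ->
  inO S w -> (forall C, w C != 0 -> #|C|%:Z = q) ->
  interior S T e q q' (of_form S q w) = of_form T q' (ann e w).
Proof.
move=> qq eS TE wS wq; have [c0 [cb co ce]] : exists c, [/\ boundary c = 0, off S c & c e = 1].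
  by apply: conn_cycle; rewrite -?TE.
have c0e : edge_pairing e (face_retr S c0) = 1.
  have := congr1 (fun u : X => u e) (face_retrK cS c0).
  by rewrite ffunE retr_id // => ->.
have I := @interiorP G S e _ c0e q q' (of_form S q w).
have ST : S \subset T by rewrite TE subsetUr.
have := congr1 (form_of S q') I; rewrite form_of_contract // of_formK // -TE form_of_incl //.
by move=> /(congr1 (of_form T q')); rewrite form_ofK.
Qed.
End FaceMaps.
End Retraction.

Lemma subrACA (M : zmodType) (a b c e : M) : a - b - (c - e) = a - c - (b - e).
Proof. by rewrite !opprB addrACA [RHS]addrACA [- b - c]addrC. Qed.

(** * Antidifferences *)

Section Antidifference.
Variables (X U : zmodType).

(** The oriented sum from 0 to [m], a primitive of [g] on all of Z. *)
Definition partial_sum (g : int -> U) (m : int) : U :=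
  match m with
  | Posz n => \sum_(i < n) g i%:Z
  | Negz n => - \sum_(i < n.+1) g (- i.+1%:Z)
  end.

Lemma partial_sumS g m : partial_sum g (m + 1) - partial_sum g m = g m.
Proof.
case: m => [n|[|n]].
- by rewrite -PoszD addn1 /= big_ord_recr /= addrAC subrr add0r.
- by rewrite (_ : Negz 0 + 1 = 0) //= big_ord0 big_ord1 sub0r opprK.
rewrite (_ : Negz n.+1 + 1 = Negz n) /=; last by rewrite !NegzE; lia.
by rewrite opprK [X in _ + X]big_ord_recr /= addrA addNr add0r.
Qed.

Lemma partial_sum_ker (U' : zmodType) (h : {additive U -> U'}) g m :
  (forall i, h (g i) = 0) -> h (partial_sum g m) = 0.
Proof.
by move=> H; case: m => n /=; rewrite ?raddfN raddf_sum big1 ?oppr0 // => i _; rewrite H.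
Qed.

Variables (u : X) (n : X -> int).
Hypotheses (nD : forall p q, n (p + q) = n p + n q) (nu : n u = 1).

(** On each line in the direction [u], the values are summed from the point where [n] vanishes. *)
Definition antidiff (f : X -> U) (p : X) : U :=
  partial_sum (fun i => f (p + u *~ (i - n p))) (n p).

Lemma antidiffP f p : antidiff f (p + u) - antidiff f p = f p.
Proof.
rewrite /antidiff nD nu.
have -> : (fun i => f (p + u + u *~ (i - (n p + 1)))) = fun i => f (p + u *~ (i - n p)).
  apply/funext => i; congr f; rewrite -addrA -{1}[u]mulr1z -mulrzDr.
  by congr (_ + _ *~ _); lia.
by rewrite partial_sumS subrr mulr0z addr0.
Qed.

Lemma antidiff_inv f w : n w = 0 -> (forall p, f (p + w) = f p) ->
  forall p, antidiff f (p + w) = antidiff f p.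
Proof.
move=> nw fw p; rewrite /antidiff nD nw addr0; congr (partial_sum _ _).
by apply/funext => i; rewrite addrAC fw.
Qed.
End Antidifference.

(** * Koszul columns *)

Section Columns.
Variables (G : graph) (v0 : vertex G).
Local Notation E := (edge G).
Local Notation X := {ffun E -> int}.
Implicit Types (S A C : {set E}) (e f : E) (p : X).

Local Notation base e := (path_chain v0 set0 (tail_of e)).

(** Up to an invertible translation this is the difference operator in the
    direction [e]; this twist makes it the difference of the operators attached
    to the two ends of [e] on functions invariant under cycles. *)
Definition dop (U : zmodType) e (f : X -> U) : X -> U := fun p =>
  f (p + (base e + delt e)) - f (p + base e).

Lemma dopB (U : zmodType) e (f g : X -> U) : dop e (f - g) = dop e f - dop e g.
Proof.
apply/funext => p; rewrite -[RHS]/(dop e f p - dop e g p) /dop.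
exact: subrACA.
Qed.

Fact dop_additive (U : zmodType) e : zmod_morphism (@dop U e).
Proof. by move=> f g; exact: dopB. Qed.
HB.instance Definition _ (U : zmodType) e :=
  GRing.isZmodMorphism.Build (X -> U) (X -> U) (@dop U e) (@dop_additive U e).

Lemma dop_comm (U : zmodType) e f (g : X -> U) : dop e (dop f g) = dop f (dop e g).
Proof.
apply/funext => p; rewrite /dop subrACA.
by rewrite ![p + (base e + _) + _]addrAC ![p + base e + _]addrAC.
Qed.

Lemma dop_map (U U' : zmodType) e (h : {additive U -> U'}) (f : X -> U) p :
  h (dop e f p) = dop e (fun p => h (f p)) p.
Proof. by rewrite /dop raddfB. Qed.

Lemma dop0 (U : zmodType) e (f : X -> U) : (forall p, f (p + delt e) = f p) -> dop e f = 0.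
Proof. by move=> H; apply/funext => p; rewrite /dop addrA H subrr. Qed.

Lemma dop_eq0 (U : zmodType) e (f : X -> U) : dop e f = 0 -> forall p, f (p + delt e) = f p.
Proof.
move=> H p; have := congr1 (fun u => u (p - base e)) H.
rewrite /dop addrA subrK => /eqP; rewrite subr_eq0 => /eqP //.
Qed.

Section Column.
Variables (U : zmodType) (S : {set E}).
Local Notation K := (X -> ({set E} -> U)).

Definition kos (z : K) : K := fun p => \sum_(e | e \notin S) cre e (dop e z p).

Fact kos_additive : zmod_morphism kos.
Proof.
move=> z z'; apply/funext => p; rewrite -[RHS]/(kos z p - kos z' p) /kos -sumrB.
apply: eq_bigr => e _; rewrite dopB; exact: (raddfB (cre e)).
Qed.
HB.instance Definition _ := GRing.isZmodMorphism.Build K K kos kos_additive.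

Definition annK e (z : K) : K := fun p => ann e (z p).

Lemma dop_annK e f z : dop e (annK f z) = annK f (dop e z).
Proof. by apply/funext => p; rewrite /annK (dop_map _ (ann f)). Qed.

Lemma kos_dop e z : kos (dop e z) = dop e (kos z).
Proof.
apply/funext => p; rewrite [RHS]/dop /kos -sumrB; apply: eq_bigr => f _.
by rewrite dop_comm -(raddfB (cre f)).
Qed.

(** A Cartan formula: contraction with [e] is a homotopy from [dop v0 e] to zero. *)
Lemma annK_kos e z : e \notin S -> annK e (kos z) = dop e z - kos (annK e z).
Proof.
move=> eS; apply/funext => p; rewrite -[RHS]/(dop e z p - kos (annK e z) p).
rewrite -[LHS]/(ann e (kos z p)) /kos (raddf_sum (ann e)) /=.
under [X in _ - X]eq_bigr => f _ do rewrite dop_annK /annK.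
rewrite (bigD1 e) //= [X in _ - X](bigD1 e) //= ann_creid opprD addrA -sumrN.
by congr (_ + _); apply: eq_bigr => f /andP[_ fe]; rewrite ann_creN 1?eq_sym.
Qed.

Lemma kos_sq z : kos (kos z) = 0.
Proof.
pose T e (x : K) : K := if e \in S then 0 else fun p => cre e (dop e x p).
have Ta e : zmod_morphism (T e).
  move=> x y; rewrite /T; case: ifP => _; first by rewrite subrr.
  by apply/funext => p; rewrite dopB; exact: (raddfB (cre e)).
pose TA e : {additive K -> K} := HB.pack (T e) (GRing.isZmodMorphism.Build K K (T e) (Ta e)).
have kE x : kos x = \sum_e TA e x.
  apply/funext => p; rewrite fct_sumE /kos big_mkcond; apply: eq_bigr => e _.
  by rewrite /= /T; case: (e \in S).
have TT e f x p : e \notin S -> f \notin S -> TA e (TA f x) p = cre e (cre f (dop e (dop f x) p)).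
  move=> /negPf eS /negPf fS; rewrite /= /T eS fS; congr cre.
  by rewrite -(dop_map _ (cre f)).
have T0 e x : e \in S -> TA e x = 0 by move=> eS; rewrite /= /T eS.
rewrite (kE z) kE; apply: sum_anti_sq => [e f x|e x].
  have [eS|eS] := boolP (e \in S).
    by rewrite (T0 _ _ eS) (T0 _ x eS) (raddf0 (TA f)) oppr0.
  have [fS|fS] := boolP (f \in S).
    by rewrite (T0 _ _ fS) (T0 _ _ fS) (raddf0 (TA e)) oppr0.
  apply/funext => p; rewrite -[RHS]/(- (TA f (TA e x) p)).
  by rewrite !TT // dop_comm cre_anti.
have [eS|eS] := boolP (e \in S); first exact: T0.
by apply/funext => p; rewrite TT // cre_sq.
Qed.

Lemma kos_inv z w : (forall p, z (p + w) = z p) -> forall p, kos z (p + w) = kos z p.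
Proof.
move=> H p; apply: eq_bigr => e _; rewrite /dop; congr (cre e (_ - _)); by rewrite addrAC H.
Qed.

(** Lifting [z] through the surjective operator [dop e], [z - kos (ann e y)] is
    killed by both [dop e] and [ann e]. *)
Lemma column_exact z : kos z = 0 ->
  exists y, forall p A, ~~ (A \subset S) -> (z - kos y) p A = 0.
Proof.
move=> Kz.
suff [y H] : exists y, forall e, e \in enum (~: S) -> annK e (z - kos y) = 0.
  exists y => p A /subsetPn[e eA eS].
  have := congr1 (fun u => u p (A :\ e)) (H e _); rewrite mem_enum inE => /(_ eS).
  rewrite /annK /ann !inE eqxx /= setD1K // => /(congr1 (fun u => u *~ sg e (A :\ e))).
  by rewrite -mulrzA sg_sq mulr1z mul0rz.
have : all (fun e => e \notin S) (enum (~: S)).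
  by apply/allP => e; rewrite mem_enum inE.
suff H l : all (fun e => e \notin S) l -> exists y, forall e, e \in l ->
    annK e (z - kos y) = 0 /\ forall p, (z - kos y) (p + delt e) = (z - kos y) p.
  by move=> /H[y yP]; exists y => e /yP[].
elim: l => [|e l IH] /=; first by exists 0.
case/andP => eS lS; have [y yP] := IH lS.
have [el|el] := boolP (e \in l).
  by exists y => f; rewrite inE => /orP[/eqP->|]; exact: yP.
pose z1 := z - kos y.
have Kz1 : kos z1 = 0 by rewrite /z1 raddfB /= Kz kos_sq subrr.
pose n (p : X) := p e.
have nD p q : n (p + q) = n p + n q by rewrite /n ffunE.
have n1 : n (delt e) = 1 by rewrite /n ffunE eqxx.
(* The translation by [base e] undoes the twist in [dop]. *)
pose y1 : K := fun p => antidiff (delt e) n z1 (p - base e).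
have y1P : dop e y1 = z1.
  apply/funext => p; rewrite /dop /y1 [base e + _]addrC addrA !addrK.
  exact: antidiffP.
have y1inv f : f \in l -> forall p, y1 (p + delt f) = y1 p.
  move=> fl p; rewrite /y1 addrAC antidiff_inv //; last by have [_] := yP f fl.
  by rewrite /n ffunE; case: eqP el => // ->; rewrite fl.
have y1ann f : f \in l -> annK f y1 = 0.
  move=> fl; apply/funext => p; apply: (partial_sum_ker (h := ann f)) => i.
  by have [H _] := yP f fl; exact: (congr1 (fun u => u _) H).
exists (y + annK e y1) => f fl.
have -> : z - kos (y + annK e y1) = annK e (kos y1).
  by rewrite raddfD opprD addrA -/z1 annK_kos // y1P.
have dz2 : dop e (annK e (kos y1)) = 0.
  by rewrite dop_annK -kos_dop y1P Kz1; apply/funext => p; rewrite /annK raddf0.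
move: fl; rewrite inE; have [-> _|fe /= fl] := eqVneq f e.
  split; last exact: dop_eq0.
  by apply/funext => p; rewrite /annK ann_sq.
split.
  have fS : f \notin S by move/allP: lS; apply.
  apply/funext => p; rewrite /annK ann_anti -[ann f _]/(annK f (kos y1) p) annK_kos //.
  by rewrite y1ann // raddf0 subr0 dop0 ?raddf0 ?oppr0 //; exact: y1inv.
by move=> p; rewrite /annK kos_inv //; exact: y1inv.
Qed.
End Column.
End Columns.

(** * Columns of invariant functions *)

Section InvariantColumn.
Variables (G : graph) (v0 : vertex G).
Local Notation E := (edge G).
Local Notation X := {ffun E -> int}.
Implicit Types (S A C : {set E}) (e f : E) (p : X) (v w : vertex G).
Hypothesis c0 : conn (set0 : {set E}).

Definition cycle_inv (T : Type) (z : X -> T) := forall c p, boundary c = 0 -> z (p + c) = z p.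

Lemma cycle_invD (U : zmodType) (y a : X -> U) : cycle_inv y -> cycle_inv a -> cycle_inv (y + a).
Proof. by move=> yI aI c p cb; rewrite -[LHS]/(y (p + c) + a (p + c)) yI // aI. Qed.

Lemma cycle_invB (U : zmodType) (y a : X -> U) : cycle_inv y -> cycle_inv a -> cycle_inv (y - a).
Proof. by move=> yI aI c p cb; rewrite -[LHS]/(y (p + c) - a (p + c)) yI // aI. Qed.

(** On functions invariant under cycles this does not depend on the chain from the root to [v]. *)
Definition vop (U : zmodType) v (f : X -> U) : X -> U := fun p => f (p + path_chain v0 set0 v) - f p.

(** The translation in the first term of [dop] is a chain from the root to the head of [e], and
    chains with the same ends differ by a cycle. *)
Lemma dop_vop (U : zmodType) e (z : X -> U) p : cycle_inv z ->
  dop v0 e z p = vop (head_of e) z p - vop (tail_of e) z p.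
Proof.
move=> zI; rewrite /dop /vop opprB [RHS]addrA subrK; congr (_ - _).
have [_ bh] := path_chainP v0 (head_of e) c0; have [_ bt] := path_chainP v0 (tail_of e) c0.
rewrite -[RHS](zI (path_chain v0 set0 (tail_of e) + delt e - path_chain v0 set0 (head_of e))).
  by congr z; rewrite -addrA; congr (_ + _); rewrite addrC subrK.
apply/ffunP => w; rewrite raddfB raddfD /= !ffunE bh bt boundary_delt /inc.
by rewrite [head_of e == w]eq_sym [tail_of e == w]eq_sym; ring.
Qed.

Lemma vop_root (U : zmodType) (z : X -> U) : cycle_inv z -> vop v0 z = 0.
Proof.
move=> zI; apply/funext => p; rewrite /vop zI ?subrr //.
by apply/ffunP => w; have [_ ->] := path_chainP v0 v0 c0; rewrite subrr ffunE.
Qed.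

Section Kos.
Variables (U : zmodType) (S : {set E}).
Local Notation K := (X -> ({set E} -> U)).

(** Multiplication by the coboundary of the vertex [v] in G \ S. *)
Definition cut v (x : {set E} -> U) : {set E} -> U :=
  crev (fun e => if e \in S then 0 else inc v e) x.

Fact cut_additive v : zmod_morphism (cut v).
Proof. by move=> x y; rewrite /cut raddfB. Qed.
HB.instance Definition _ v := GRing.isZmodMorphism.Build
  ({set E} -> U) ({set E} -> U) (cut v) (cut_additive v).

Lemma sum_inc (f : vertex G -> {set E} -> U) e :
  \sum_v f v *~ inc v e = f (head_of e) - f (tail_of e).
Proof.
rewrite /inc; under eq_bigr => v _ do rewrite mulrzBr.
have H w : \sum_v f v *~ (w == v)%:R = f w.
  rewrite (bigD1 w) //= eqxx mulr1z big1 ?addr0 // => v vw.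
  by rewrite eq_sym (negPf vw) mulr0z.
by rewrite sumrB !H.
Qed.

Lemma kos_cut (z : K) p : cycle_inv z -> kos v0 S z p = \sum_v cut v (vop v z p).
Proof.
move=> zI; rewrite /kos /cut /crev exchange_big big_mkcond; apply: eq_bigr => e _.
case: (e \in S); first by rewrite big1 // => v _; rewrite mulr0z.
rewrite dop_vop // -(sum_inc (fun v => vop v z p)) (raddf_sum (cre e)); apply: eq_bigr => v _.
by rewrite (raddfMz (cre e)).
Qed.

Lemma sum_cut x : \sum_v cut v x = 0.
Proof.
rewrite /cut /crev exchange_big big1 // => e _; case: (e \in S).
  by rewrite big1 // => v _; rewrite mulr0z.
by rewrite (sum_inc (fun=> cre e x)) subrr.
Qed.

(** The primitive is linear in the boundary, so [vop] makes it constant; the contribution of the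
    root drops out because the vertex coboundaries add up to zero. *)
Lemma kos_cut_linear (eta : vertex G -> {set E} -> U) :
  exists2 y : K, cycle_inv y & forall p, kos v0 S y p = \sum_v cut v (eta v).
Proof.
pose y : K := fun p => \sum_v eta v *~ boundary p v.
have yI : cycle_inv y.
  by move=> c p cb; apply: eq_bigr => v _; rewrite raddfD /= cb addr0.
exists y => // p; rewrite kos_cut //.
have vy w : vop w y p = eta w - eta v0.
  rewrite /vop /y -sumrB.
  under eq_bigr => v _ do rewrite -mulrzBr (raddfD (@boundary G)) /= ffunE addrAC subrr add0r.
  have [_ bw] := path_chainP v0 w c0.
  under eq_bigr => v _ do rewrite bw mulrzBr.
  have H u : \sum_v eta v *~ (v == u)%:R = eta u.
    by rewrite (bigD1 u) //= eqxx mulr1z big1 ?addr0 // => v /negPf->; rewrite mulr0z.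
  by rewrite sumrB !H.
under eq_bigr => v _ do rewrite vy raddfB.
by rewrite sumrB sum_cut subr0.
Qed.

Hypothesis cS : conn S.

(** The Cartan formula for vertices: a chain in G \ S from the root to [v] pairs with the coboundary
    of [v] to one and with those of the other vertices, except the root, to zero. The root does not
    matter by [vop_root]. *)
Lemma annv_kos v (z : K) p : cycle_inv z ->
  annv (path_chain v0 S v) (kos v0 S z p) =
  vop v z p - kos v0 S (fun p => annv (path_chain v0 S v) (z p)) p.
Proof.
move=> zI; have [pS pb] := path_chainP v0 v cS; set c := path_chain v0 S v in pS pb *.
rewrite /kos (raddf_sum (annv c)) /=.
have E1 e : e \notin S -> annv c (cre e (dop v0 e z p)) =
    dop v0 e z p *~ c e - cre e (dop v0 e (fun p => annv c (z p)) p).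
  by move=> _; rewrite annv_cre (dop_map _ _ (annv c)).
rewrite (eq_bigr _ E1) sumrB; congr (_ - _).
transitivity (\sum_e dop v0 e z p *~ c e).
  rewrite [RHS](bigID (mem S)) /= [X in _ = X + _]big1 ?add0r // => e eS.
  by rewrite pS // mulr0z.
under eq_bigr => e _ do rewrite dop_vop // -(sum_inc (fun v => vop v z p)) mulrz_suml.
rewrite exchange_big /=.
transitivity (\sum_w vop w z p *~ boundary c w).
  apply: eq_bigr => w _; rewrite boundaryE mulrz_sumr; apply: eq_bigr => e _.
  by rewrite -mulrzA mulrC.
under eq_bigr => w _ do rewrite pb mulrzBr.
have H u : \sum_w vop w z p *~ (w == u)%:R = vop u z p.
  by rewrite (bigD1 u) //= eqxx mulr1z big1 ?addr0 // => w /negPf->; rewrite mulr0z.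
by rewrite sumrB !H vop_root // subr0.
Qed.

Lemma kos_vop w (z : K) p : kos v0 S (vop w z) p = vop w (kos v0 S z) p.
Proof.
rewrite /vop /kos -sumrB; apply: eq_bigr => e _; rewrite -(raddfB (cre e)); congr (cre e _).
rewrite /dop subrACA; congr (_ - _ - (_ - _)).
- by rewrite addrAC.
- by rewrite addrAC.
Qed.

(** The argument of [column_exact] with vertices in place of edges. In the end the cocycle is killed
    by [vop v] for every [v], and cycles together with the chains from the root generate all
    translations, so it is constant. *)
Lemma invariant_column (z : K) : cycle_inv z -> kos v0 S z = 0 ->
  exists y zeta, cycle_inv y /\ forall p, (z - kos v0 S y) p = zeta.
Proof.
move=> zI Kz.
suff [y [yI yv]] : exists y, cycle_inv y /\ forall v, v \in enum (vertex G) -> vop v (z - kos v0 S y) = 0.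
  have z1I : cycle_inv (z - kos v0 S y).
    by apply: cycle_invB => // c p cb; apply: kos_inv => q; exact: yI.
  exists y, ((z - kos v0 S y) 0); split=> // p; set z1 := z - _ in z1I yv *.
  have step v q n : z1 (q + path_chain v0 set0 v *~ n) = z1 q.
    have H q' : z1 (q' + path_chain v0 set0 v) = z1 q'.
      have := congr1 (fun u => u q') (yv v (mem_enum _ _)).
      by rewrite /vop => /eqP; rewrite subr_eq0 => /eqP.
    elim/int_rect: n => [|n IH|n IH]; first by rewrite mulr0z addr0.
      by rewrite -addn1 PoszD mulrzDr addrA H.
    by rewrite -[LHS]H -addn1 PoszD opprD mulrzDr mulrN1z !addrA subrK.
  have steps (l : seq (vertex G)) q m :
      z1 (q + \sum_(v <- l) path_chain v0 set0 v *~ m v) = z1 q.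
    elim: l q => [|v l IH] q; first by rewrite big_nil addr0.
    by rewrite big_cons addrA IH step.
  rewrite -(steps (index_enum _) 0 (boundary p)) add0r.
  (* Subtracting from [p] the chains weighted by its boundary leaves a cycle; at the root one uses
     that the boundary has sum zero. *)
  rewrite -[RHS](z1I (p - \sum_v path_chain v0 set0 v *~ boundary p v)) ?[_ + (p - _)]addrC ?subrK //.
  apply/ffunP => w; rewrite [RHS]ffunE.
  transitivity (boundary p w - \sum_v boundary (path_chain v0 set0 v *~ boundary p v) w).
    rewrite (raddfB (@boundary G)) ffunE; congr (_ + _).
    rewrite (raddf_sum (@boundary G)) ffunE; congr (- _).
    by rewrite sum_ffunE.
  have E1 v : (boundary (path_chain v0 set0 v *~ boundary p v)) w =
      (w == v)%:R * boundary p v - (w == v0)%:R * boundary p v.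
    have [_ pb] := path_chainP v0 v c0.
    rewrite raddfMz /=.
    have -> : (boundary (path_chain v0 set0 v) *~ boundary p v) w = boundary (path_chain v0 set0 v) w * boundary p v.
      by rewrite ffunX_mulrz mulrzz.
    by rewrite pb mulrBl.
  under eq_bigr => v _ do rewrite E1.
  rewrite sumrB -mulr_sumr boundary_sum mulr0 subr0.
  rewrite (bigD1 w) //= eqxx mul1r big1 ?addr0 ?subrr // => v vw.
  by rewrite eq_sym (negPf vw) mul0r.
elim: (enum (vertex G)) => [|v l [y [yI yv]]]; first by exists 0; split.
have [vl|vl] := boolP (v \in l).
  by exists y; split=> // w; rewrite inE => /orP[/eqP->|]; exact: yv.
pose z1 := z - kos v0 S y.
have z1I : cycle_inv z1.
  by apply: cycle_invB => // c p cb; apply: kos_inv => q; exact: yI.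
have [vE|vv0] := eqVneq v v0.
  exists y; split=> // w; rewrite inE => /orP[/eqP->|]; last exact: yv.
  by rewrite vE; exact: vop_root.
have Kz1 : kos v0 S z1 = 0 by rewrite /z1 raddfB /= Kz kos_sq subrr.
pose n (p : X) := boundary p v.
have nD p q : n (p + q) = n p + n q by rewrite /n raddfD ffunE.
have npath w : n (path_chain v0 set0 w) = (v == w)%:R.
  by have [_ pb] := path_chainP v0 w c0; rewrite /n pb (negPf vv0) subr0.
have n1 : n (path_chain v0 set0 v) = 1 by rewrite npath eqxx.
pose y1 : K := antidiff (path_chain v0 set0 v) n z1.
have y1P : vop v y1 = z1 by apply/funext => p; exact: antidiffP.
have y1I : cycle_inv y1.
  move=> c p cb; rewrite /y1 (antidiff_inv _ nD) // => [|q]; last exact: z1I.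
  by rewrite /n cb ffunE.
have y1w w : w \in l -> vop w y1 = 0.
  move=> wl; apply/funext => p; rewrite /vop /y1 (antidiff_inv _ nD) ?subrr //.
    by rewrite npath; case: eqP vl => // ->; rewrite wl.
  move=> q; have := congr1 (fun u => u q) (yv w wl).
  by rewrite /vop => /eqP; rewrite subr_eq0 => /eqP.
(* By [annv_kos], correcting with [a] replaces [z1] by a contraction of [kos v0 S y1], which is
   constant in the direction of [v] and of the earlier vertices. *)
pose a : K := fun p => annv (path_chain v0 S v) (y1 p).
have aI : cycle_inv a by move=> c p cb; rewrite /a y1I.
have zE0 : z - kos v0 S (y + a) = z1 - kos v0 S a.
  by rewrite (raddfD (kos v0 S)) opprD addrA.
exists (y + a); split=> [|w]; first exact: cycle_invD.
have zE p : (z - kos v0 S (y + a)) p = annv (path_chain v0 S v) (kos v0 S y1 p).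
  by rewrite zE0 -[LHS]/(z1 p - kos v0 S a p) annv_kos // y1P.
have vE : vop w (z - kos v0 S (y + a)) = fun p => annv (path_chain v0 S v) (kos v0 S (vop w y1) p).
  by apply/funext => p; rewrite kos_vop /vop !zE raddfB.
rewrite vE inE => /orP[/eqP->|wl].
  by rewrite y1P Kz1; apply/funext => p; rewrite raddf0.
by rewrite y1w // raddf0; apply/funext => p; rewrite raddf0.
Qed.
End Kos.
End InvariantColumn.

(** * From columns to tensor products with exterior powers of H^1 *)

Lemma tensBl (A B : zmodType) (b : B) : {morph (@tens A B)^~ b : x y / x - y}.
Proof. by move=> x y; apply/eqP; rewrite eq_sym subr_eq -tensDl subrK. Qed.

Lemma tensBr (A B : zmodType) (a : A) : {morph @tens A B a : x y / x - y}.
Proof. by move=> x y; apply/eqP; rewrite eq_sym subr_eq -tensDr subrK. Qed.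

Section TensLeft.
Variables (A B : zmodType) (b : B).

Definition tens_l (a : A) : tensor A B := tens a b.

Fact tens_l_additive : zmod_morphism tens_l.
Proof. exact: tensBl. Qed.
HB.instance Definition _ := GRing.isZmodMorphism.Build A (tensor A B) tens_l tens_l_additive.
End TensLeft.

Section WedgeCons.
Variables (M : zmodType) (q : int) (s : seq M).

Definition wedge_cons (x : M) : ext_power M q := wedge q (x :: s).

Fact wedge_cons_additive : zmod_morphism wedge_cons.
Proof.
by move=> x y; apply/eqP; rewrite eq_sym subr_eq /wedge_cons -(wedgeD _ [::]) /= subrK.
Qed.
HB.instance Definition _ := GRing.isZmodMorphism.Build M (ext_power M q) wedge_cons wedge_cons_additive.
End WedgeCons.

Section TensRight.
Variables (A B : zmodType) (a : A).

Definition tens_r (w : B) : tensor A B := tens a w.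

Fact tens_r_additive : zmod_morphism tens_r.
Proof. exact: tensBr. Qed.
HB.instance Definition _ := GRing.isZmodMorphism.Build B (tensor A B) tens_r tens_r_additive.

Lemma tens_sumz (I : finType) (w : I -> B) (u : I -> int) :
  \sum_i tens a (w i) *~ u i = tens a (\sum_i w i *~ u i).
Proof.
rewrite -[RHS]/(tens_r _) raddf_sum; apply: eq_bigr => i _.
by rewrite raddfMz.
Qed.

Lemma tensr0 : @tens A B a 0 = 0.
Proof. exact: (raddf0 tens_r). Qed.
End TensRight.

Lemma wedge_sumz (M : zmodType) (q : int) (s : seq M) (I : finType) (w : I -> M) (u : I -> int) :
  \sum_i wedge q (w i :: s) *~ u i = wedge q ((\sum_i w i *~ u i) :: s).
Proof.
rewrite -[RHS]/(wedge_cons q s _) raddf_sum; apply: eq_bigr => i _.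
by rewrite raddfMz.
Qed.

Lemma wedge_cons0 (M : zmodType) (q : int) (s : seq M) : wedge q (0 :: s) = 0.
Proof. exact: (raddf0 (wedge_cons q s)). Qed.

Section Theta.
Variables (G : graph) (v0 : vertex G) (S : {set edge G}).
Hypothesis cS : conn S.
Local Notation E := (edge G).
Local Notation X := {ffun E -> int}.
Local Notation Om := ({set E} -> int).
Local Notation coL := (coH1 (delete S)).

Definition edge_coclass (c : {ffun edge (delete S) -> int}) : coL := cls _ c.
HB.instance Definition _ := GRing.Additive.copy edge_coclass (cls (fun c => exists g, c = @cobound (delete S) g)).

Definition edge_class e : coL := edge_coclass [ffun e' => (val e' == e)%:R].

Lemma edge_coclass_sum (u : E -> int) :
  \sum_e edge_class e *~ u e = edge_coclass [ffun e' => u (val e')].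
Proof.
have -> : [ffun e' => u (val e')] = \sum_e ([ffun e' => (val e' == e)%:R] : {ffun edge (delete S) -> int}) *~ u e.
  apply/ffunP => e'; rewrite sum_ffunE ffunE (bigD1 (val e')) //= ffunX_mulrz ffunE eqxx intz.
  by rewrite big1 ?addr0 // => e ee; rewrite ffunX_mulrz ffunE eq_sym (negPf ee) mul0rz.
by rewrite raddf_sum; apply: eq_bigr => e _; rewrite raddfMz.
Qed.

Lemma edge_coclass_inc (v : vertex G) : edge_coclass [ffun e' => inc v (val e')] = 0.
Proof.
apply: cls_rel; exists [ffun w => (w == v)%:R]; apply/ffunP => e'.
by rewrite !ffunE /inc.
Qed.

Variables (La : zmodType) (l : int).
Local Notation Te := (tensor La (ext_power coL l)).

(** The projection from the exterior algebra of Z^E to that of H^1(G \ S), with coefficients; edges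
    in [S] go to zero. *)
Definition theta (x : {set E} -> La) : Te := wedge_sum edge_class (fun a w => tens a w) x.

Fact theta_additive : zmod_morphism theta.
Proof. by move=> x y; apply: wedge_sumB => w a b; exact: tensBl. Qed.
HB.instance Definition _ := GRing.isZmodMorphism.Build ({set E} -> La) Te theta theta_additive.

Lemma theta_cre e x : theta (cre e x) = \sum_(A : {set E})
  tens (x A) (wedge l (edge_class e :: map edge_class (enum A))).
Proof.
exact: (@wedge_sum_cre E coL edge_class La l Te (fun a w => tens a w)
  (fun w => @tensBl _ _ w) (fun a => @tensBr _ _ a) e x).
Qed.

Lemma theta_crev (u : E -> int) x : theta (crev u x) =
  \sum_(A : {set E}) tens (x A) (wedge l ((\sum_e edge_class e *~ u e) :: map edge_class (enum A))).
Proof.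
rewrite /crev (raddf_sum theta).
have E1 e : theta (cre e x *~ u e) = \sum_(A : {set E})
    tens (x A) (wedge l (edge_class e :: map edge_class (enum A))) *~ u e.
  transitivity (theta (cre e x) *~ u e); first exact: (raddfMz theta).
  by rewrite theta_cre mulrz_suml.
rewrite (eq_bigr _ (fun e _ => E1 e)) exchange_big; apply: eq_bigr => A _.
by rewrite tens_sumz wedge_sumz.
Qed.

Lemma theta_cut v x : theta (cut S v x) = 0.
Proof.
rewrite /cut theta_crev big1 // => A _.
rewrite edge_coclass_sum.
have -> : edge_coclass [ffun e' => if val e' \in S then 0 else inc v (val e')] = 0.
  rewrite -[RHS](edge_coclass_inc v); apply: (congr1 edge_coclass); apply/ffunP => e'.
  by rewrite !ffunE (negPf (valP e')).
by rewrite wedge_cons0 tensr0.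
Qed.

(** The transpose of the retraction onto the cycles splits the projection from
    cochains to H^1. *)
Definition transpose_retr (c : {ffun edge (delete S) -> int}) : X :=
  [ffun e => \sum_(e' : edge (delete S)) c e' * retr v0 S (delt e) (val e')].

Fact transpose_retr_additive : zmod_morphism transpose_retr.
Proof.
move=> c d; apply/ffunP => e; rewrite !ffunE -sumrB; apply: eq_bigr => e' _.
by rewrite !ffunE mulrBl.
Qed.
HB.instance Definition _ := GRing.isZmodMorphism.Build
  {ffun edge (delete S) -> int} X transpose_retr transpose_retr_additive.

Fact transpose_retr_rel c : (exists g, c = @cobound (delete S) g) -> transpose_retr c = 0.
Proof.
case=> g ->; apply/ffunP => e; rewrite !ffunE.
have [bx xS] := retrP v0 (delt e) cS.
pose x : {ffun edge (delete S) -> int} := [ffun e' => retr v0 S (delt e) (val e')].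
have H := @sum_cobound (delete S) g x; rewrite (boundary_restr xS) bx in H.
transitivity (\sum_v g v * (0 : {ffun vertex G -> int}) v); last first.
  by rewrite big1 // => v _; rewrite ffunE mulr0.
transitivity (\sum_e' x e' * cobound g e'); last exact: H.
by apply: eq_bigr => e' _; rewrite [x e']ffunE mulrC.
Qed.

Definition split_coclass : {additive coL -> X} := qlift transpose_retr_rel.

Lemma split_edge_class e f : split_coclass (edge_class e) f = if e \in S then 0 else retr v0 S (delt f) e.
Proof.
rewrite [split_coclass _](qliftE transpose_retr_rel) ffunE.
case: ifPn => eS.
  rewrite big1 // => e' _; rewrite ffunE; case: eqP => [ee|_]; last by rewrite mul0r.
  by have := valP e'; rewrite /= ee eS.
rewrite (bigD1 (Sub e eS)) //= ffunE eqxx mul1r big1 ?addr0 // => e' ee.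
rewrite ffunE; case: eqP => [E1|_]; last by rewrite mul0r.
by case/negP: ee; apply/eqP/val_inj.
Qed.

(** Outside [S], the transpose of the retraction is the identity up to coboundaries, because each
    vertex step subtracts a multiple of the boundary at that vertex. *)
Lemma retr_coord a : exists mu : vertex G -> int, forall e, e \notin S ->
  retr v0 S (delt e) a = (e == a)%:R + \sum_w mu w * inc w e.
Proof.
have fixS (s : seq E) e : e \notin s -> elems [seq (delt f, delt f) | f <- s] (delt e) = delt e.
  elim: s => //= f s IH; rewrite inE negb_or => /andP[ef es]; rewrite IH // /elem /=.
  by rewrite pairX_delt ffunE eq_sym (negPf ef) mulr0z subr0.
(* The coefficients [mu] are general so that the induction can absorb the boundary terms of a
   step. *)
have main (s : seq (vertex G)) (mu : vertex G -> int) : exists mu', forall x : X,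
    elems [seq (path_chain v0 S v, incX v) | v <- s] x a +
      \sum_w mu w * boundary (elems [seq (path_chain v0 S v, incX v) | v <- s] x) w =
    x a + \sum_w mu' w * boundary x w.
  elim: s mu => [|v s IH] mu /=; first by exists mu.
  pose u := path_chain v0 S v.
  pose k := u a + \sum_w mu w * boundary u w.
  have [mu' H] := IH (fun w => mu w - (w == v)%:R * k); exists mu' => x.
  rewrite -H; set y := elems _ x.
  have bE w : boundary (elem (u, incX v) y) w = boundary y w - boundary u w * boundary y v.
    by rewrite /elem (raddfB (@boundary G)) (raddfMz (@boundary G)) /= pairX_inc ffunE [X in _ + X]ffunE ffunX_mulrz mulrzz.
  have -> : elem (u, incX v) y a = y a - u a * boundary y v.
    by rewrite /elem !ffunE ffunX_mulrz pairX_inc mulrzz.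
  under eq_bigr => w _ do rewrite bE mulrBr mulrA.
  under [in RHS]eq_bigr => w _ do rewrite mulrBl.
  rewrite !sumrB -mulr_suml [\sum_i (i == v)%:R * k * _](bigD1 v) //= eqxx.
  rewrite [X in _ + (_ - (_ + X))]big1 => [|w /negPf->]; last by rewrite !mul0r.
  rewrite /k (_ : (true%:R : int) = 1) // mul1r mulrDl addr0; ring.
have [mu H] := main (enum (vertex G)) (fun=> 0).
exists mu => e eS; have := H (delt e).
rewrite [X in _ + X = _]big1 ?addr0 => [|w _]; last by rewrite mul0r.
have -> : elems [seq (path_chain v0 S v, incX v) | v <- enum (vertex G)] (delt e) = retr v0 S (delt e).
  have E1 : elems [seq (delt f, delt f) | f <- enum S] (delt e) = delt e by rewrite fixS // mem_enum.
  rewrite [RHS]/= /elems /retr_steps foldr_cat; apply: (congr1 (foldr elem ^~ _)); exact/esym.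
move=> ->; rewrite ffunE [a == e]eq_sym; congr (_ + _).
by apply: eq_bigr => w _; rewrite boundary_delt.
Qed.

(** Multivectors divisible by a cut or by an edge in [S]. *)
Definition in_cuts (x : {set E} -> La) := exists eta th,
  x = \sum_v cut S v (eta v) + \sum_(e in S) cre e (th e).

Lemma in_cutsB x y : in_cuts x -> in_cuts y -> in_cuts (x - y).
Proof.
move=> [eta [th ->]] [eta' [th' ->]]; exists (fun v => eta v - eta' v), (fun e => th e - th' e).
rewrite opprD addrACA -!sumrB; congr (_ + _); apply: eq_bigr => ? _; exact/esym/raddfB.
Qed.

Lemma in_cuts0 : in_cuts 0.
Proof.
exists (fun=> 0), (fun=> 0); rewrite !big1 ?addr0 // => ? _; exact: raddf0.
Qed.

Lemma in_cutsD x y : in_cuts x -> in_cuts y -> in_cuts (x + y).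
Proof.
move=> H H'; rewrite -[y]opprK; apply: in_cutsB => //; rewrite -sub0r.
by apply: in_cutsB => //; exact: in_cuts0.
Qed.

Lemma in_cuts_sum (I : Type) (r : seq I) (P : pred I) (F : I -> {set E} -> La) :
  (forall i, P i -> in_cuts (F i)) -> in_cuts (\sum_(i <- r | P i) F i).
Proof. by move=> H; elim/big_ind: _ => //; [exact: in_cuts0|exact: in_cutsD]. Qed.

Lemma in_cuts_cut v x : in_cuts (cut S v x).
Proof.
exists (fun w => if w == v then x else 0), (fun=> 0).
rewrite [X in _ + X]big1 ?addr0 => [|e _]; last exact: raddf0.
rewrite (bigD1 v) //= eqxx big1 ?addr0 // => w /negPf ->; exact: raddf0.
Qed.

Lemma in_cuts_S e x : e \in S -> in_cuts (cre e x).
Proof.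
move=> eS; exists (fun=> 0), (fun f => if f == e then x else 0).
rewrite big1 ?add0r => [|w _]; last exact: raddf0.
rewrite (bigD1 e) //= eqxx big1 ?addr0 // => f /andP[_ /negPf ->]; exact: raddf0.
Qed.

Lemma in_cutsMz x n : in_cuts x -> in_cuts (x *~ n).
Proof.
move=> [eta [th ->]]; exists (fun v => eta v *~ n), (fun e => th e *~ n).
rewrite mulrzDl !mulrz_suml; congr (_ + _); apply: eq_bigr => ? _; exact/esym/raddfMz.
Qed.

Lemma in_cuts_cre e x : in_cuts x -> in_cuts (cre e x).
Proof.
move=> [eta [th ->]]; exists (fun v => - cre e (eta v)), (fun f => - cre e (th f)).
rewrite raddfD !raddf_sum; congr (_ + _); apply: eq_bigr => ? _.
  by rewrite /= raddfN /= /cut cre_crev.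
by rewrite /= raddfN /= cre_anti.
Qed.

(** By [retr_coord], an edge differs from the lift of its class by cuts and edges of [S]. *)
Lemma cre_sub_split a x :
  in_cuts (cre a x - crev (split_coclass (edge_class a)) x).
Proof.
have [aS|aS] := boolP (a \in S).
  rewrite (_ : crev _ x = 0) ?subr0; first exact: in_cuts_S.
  by rewrite /crev big1 // => f _; rewrite split_edge_class aS mulr0z.
have [mu H] := retr_coord a.
pose c e : int := \sum_w mu w * inc w e.
have cutE : \sum_w cut S w x *~ mu w = \sum_e cre e x *~ (if e \in S then 0 else c e).
  transitivity (\sum_w \sum_e cre e x *~ (if e \in S then 0 else mu w * inc w e)).
    apply: eq_bigr => w _; rewrite /cut /crev mulrz_suml; apply: eq_bigr => e _.
    by case: ifP => _; rewrite ?mulr0z ?mul0rz // mulrC mulrzA.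
  rewrite exchange_big; apply: eq_bigr => e _; rewrite /c.
  case: ifP => _; last by rewrite -mulrz_sumr.
  by rewrite big1 ?mulr0z // => w _; rewrite mulr0z.
have SE : \sum_(e in S) cre e x *~ retr v0 S (delt e) a =
    \sum_e cre e x *~ (if e \in S then retr v0 S (delt e) a else 0).
  by rewrite big_mkcond; apply: eq_bigr => e _; case: ifP => // _; rewrite mulr0z.
have aE : cre a x = \sum_e cre e x *~ (e == a)%:R.
  by rewrite (bigD1 a) //= eqxx mulr1z big1 ?addr0 // => e /negPf->; exact: mulr0z.
have -> : cre a x - crev (split_coclass (edge_class a)) x =
    - (\sum_w cut S w x *~ mu w) - (\sum_(e in S) cre e x *~ retr v0 S (delt e) a).
  rewrite aE cutE SE /crev -!sumrN -!big_split; apply: eq_bigr => e _ /=.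
  rewrite split_edge_class (negPf aS) -!mulrNz -!mulrzDr; apply: (congr1 (fun n => _ *~ n)).
  case: ifPn => eS; last by rewrite H // /c; ring.
  have -> : (e == a) = false by apply/eqP => ea; rewrite -ea eS in aS.
  by rewrite /=; ring.
apply: in_cutsB; last by apply: in_cuts_sum => e eS; apply/in_cutsMz/in_cuts_S.
rewrite -sub0r; apply: in_cutsB; first exact: in_cuts0.
by apply: in_cuts_sum => w _; apply/in_cutsMz/in_cuts_cut.
Qed.

Lemma in_cuts_crev (u : E -> int) x : in_cuts x -> in_cuts (crev u x).
Proof. by move=> H; apply: in_cuts_sum => e _; apply/in_cutsMz/in_cuts_cre. Qed.

Lemma split_coclassK c : \sum_e edge_class e *~ split_coclass c e = c.
Proof.
have [d <-] := cls_surj c; rewrite edge_coclass_sum.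
apply/eqP; rewrite -subr_eq0 -[cls _ d]/(edge_coclass d) -raddfB; apply/eqP.
have muP (e' : edge (delete S)) := cid (retr_coord (val e')).
pose mu e' := projT1 (muP e').
have -> : [ffun e' => split_coclass (cls (fun c => exists g, c = @cobound (delete S) g) d) (val e')] - d =
    \sum_w ([ffun e' => inc w (val e')] : {ffun edge (delete S) -> int}) *~ (\sum_e' d e' * mu e' w).
  apply/ffunP => f; rewrite sum_ffunE [LHS]ffunE [X in X + _]ffunE.
  have -> : split_coclass (cls (fun c => exists g, c = @cobound (delete S) g) d) =
    transpose_retr d by exact: (qliftE transpose_retr_rel).
  rewrite [X in X + _]ffunE [X in _ + X]ffunE.
  transitivity (\sum_(e' : edge (delete S)) d e' * \sum_w mu e' w * inc w (val f)).
    have -> : \sum_e' d e' * retr v0 S (delt (val f)) (val e') =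
        d f + \sum_(e' : edge (delete S)) d e' * \sum_w mu e' w * inc w (val f).
      transitivity (\sum_e' (d e' * (val f == val e')%:R + d e' * \sum_w mu e' w * inc w (val f))).
        by apply: eq_bigr => e' _; rewrite -mulrDr /mu; case: (muP e') => m /= ->; rewrite ?(valP f).
      rewrite big_split /=; congr (_ + _).
      rewrite (bigD1 f) //= eqxx mulr1 big1 ?addr0 // => e' e'f.
      by rewrite val_eqE eq_sym (negPf e'f) mulr0.
    by rewrite addrAC subrr add0r.
  under eq_bigr => e' _ do rewrite mulr_sumr.
  rewrite exchange_big; apply: eq_bigr => w _ /=.
  rewrite ffunX_mulrz ffunE mulrzz mulr_sumr; apply: eq_bigr => e' _.
  by rewrite mulrA mulrC.
rewrite raddf_sum big1 // => w _.
by rewrite raddfMz /= edge_coclass_inc mul0rz.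
Qed.

Definition untheta_gen (a : La) (w : ext_power coL l) : {set E} -> La :=
  fun A => a *~ ext_form split_coclass l w A.

Fact untheta_genDl w : {morph untheta_gen^~ w : x y / x + y}.
Proof. by move=> x y; apply/funext => A; exact: mulrzDl. Qed.

Fact untheta_genDr a : {morph untheta_gen a : x y / x + y}.
Proof. by move=> x y; apply/funext => A; rewrite /untheta_gen raddfD; exact: mulrzDr. Qed.

Definition untheta : {additive Te -> ({set E} -> La)} := tensor_lift untheta_genDl untheta_genDr.

Lemma untheta_tens a w A : untheta (tens a w) A = a *~ ext_form split_coclass l w A.
Proof. by rewrite /untheta tensor_liftE. Qed.

Lemma untheta_deg t A : untheta t A != 0 -> #|A|%:Z = l.
Proof.
move=> n0; apply/eqP; apply: contraNT n0 => Al; apply/eqP; move: t.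
have evB : zmod_morphism (fun t => untheta t A) by move=> x y; rewrite raddfB.
pose f : {additive Te -> La} := HB.pack (fun t => untheta t A) (GRing.isZmodMorphism.Build Te La _ evB).
have zB : zmod_morphism (fun _ : Te => 0 : La) by move=> x y; rewrite subr0.
pose z : {additive Te -> La} := HB.pack (fun _ : Te => 0 : La) (GRing.isZmodMorphism.Build Te La _ zB).
suff H : f =1 z by move=> t; exact: H.
apply: tensor_ext => a w; rewrite -[LHS]/(untheta (tens a w) A) -[RHS]/(0 : La) untheta_tens.
have [->|/ext_form_deg H] := eqVneq (ext_form split_coclass l w A) 0; first exact: mulr0z.
by rewrite H eqxx in Al.
Qed.

(** In a product of edges the factors are replaced one by one by the lifts of their classes; each
    replacement changes the product by an element of the ideal of cuts and edges of [S]. *)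
Lemma untheta_theta (x : {set E} -> La) : (forall A, x A != 0 -> #|A|%:Z = l) -> in_cuts (x - untheta (theta x)).
Proof.
move=> xl.
have -> : x - untheta (theta x) = \sum_(A : {set E})
   ((fun D => if D == A then x A else 0) - untheta (tens (x A) (wedge l (map edge_class (enum A))))).
  rewrite sumrB /theta /wedge_sum (raddf_sum untheta); congr (_ - _).
  apply/funext => D; rewrite fct_sumE (bigD1 D) //= eqxx big1 ?addr0 // => A AD.
  by rewrite eq_sym (negPf AD).
apply: in_cuts_sum => A _.
have [xA|/xl Al] := eqVneq (x A) 0.
  rewrite xA (_ : (fun D => _) = 0); last by apply/funext => D; case: ifP.
  rewrite (_ : untheta _ = 0) ?subr0; first exact: in_cuts0.
  by apply/funext => D; rewrite untheta_tens mul0rz.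
rewrite -foldr_cre_enum.
have -> : untheta (tens (x A) (wedge l (map edge_class (enum A)))) =
    foldr (fun e w => crev (split_coclass (edge_class e)) w) (vac (x A)) (enum A).
  apply/funext => D; rewrite untheta_tens ext_formE size_map -cardE Al eqxx.
  elim: (enum A) D => [|e s IH] D /=.
    by rewrite /vac; case: ifP => _; rewrite ?mulr1z ?mulr0z.
  have -> : foldr (fun e w => crev (split_coclass (edge_class e)) w) (vac (x A)) s =
    fun C => x A *~ word_form split_coclass [seq edge_class i | i <- s] C by exact/esym/funext.
  rewrite {2}/crev {1}/crev !fct_sumE mulrz_sumr; apply: eq_bigr => f _.
  rewrite !fct_mulrz /cre; case: ifP => _; last by rewrite !mul0rz mulr0z.
  by rewrite !mulrzz !mulrzA.
elim: (enum A) => [|e s IH] /=; first by rewrite subrr; exact: in_cuts0.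
set y := foldr _ _ s in IH *; set y' := foldr _ _ s in IH *.
have -> : cre e y - crev (split_coclass (edge_class e)) y' =
    (cre e y - crev (split_coclass (edge_class e)) y) + crev (split_coclass (edge_class e)) (y - y').
  by rewrite (raddfB (crev _)) addrA subrK.
by apply: in_cutsD; [exact: cre_sub_split|exact: in_cuts_crev].
Qed.

(** A multiple of an edge of [S] has no coefficient at sets disjoint from [S], so only the cuts
    remain. *)
Lemma theta_ker (x : {set E} -> La) : (forall A, x A != 0 -> #|A|%:Z = l) -> theta x = 0 ->
  exists eta, forall A : {set E}, [disjoint A & S] -> x A = (\sum_v cut S v (eta v)) A.
Proof.
move=> xl tx; have := untheta_theta xl; rewrite tx raddf0 subr0 => -[eta [th ->]].
exists eta => A AS; rewrite -[LHS]/((\sum_v _) A + (\sum_(e in S) _) A).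
have -> : (\sum_(e in S) cre e (th e)) A = \sum_(e in S) cre e (th e) A by rewrite fct_sumE.
rewrite [X in _ + X]big1 ?addr0 // => e eS.
by rewrite /cre (disjointFl AS eS).
Qed.

Lemma theta_untheta t : theta (untheta t) = t.
Proof.
pose f : {additive Te -> Te} := [the {additive _ -> _} of theta \o untheta].
pose g : {additive Te -> Te} := idfun.
suff H : f =1 g by exact: H.
apply: tensor_ext => a w; rewrite -[LHS]/(theta (untheta (tens a w))) -[RHS]/(tens a w); move: w.
apply: (@ext_ext _ _ _ (fun w => theta (untheta (tens a w))) (tens a)) => [x y|x y|s].
- by rewrite tensBr !raddfB.
- exact: tensBr.
have -> : untheta (tens a (wedge l s)) = fun A => a *~ ext_form split_coclass l (wedge l s) A.
  by apply/funext => A; exact: untheta_tens.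
transitivity (tens a (form_ext edge_class l (ext_form split_coclass l (wedge l s)))).
  rewrite /form_ext /theta /wedge_sum -tens_sumz; apply: eq_bigr => A _.
  exact: (raddfMz (tens_l (wedge l (map edge_class (enum A))))).
apply: (congr1 (tens a)); rewrite ext_formE; case: eqP => [<-|/eqP sl]; last first.
  by rewrite (wedge_size sl) raddf0.
rewrite form_ext_word; apply: (congr1 (wedge _)); rewrite -[RHS]map_id; apply: eq_map => c.
exact: split_coclassK.
Qed.
End Theta.

(** * The double complex of interior products and difference operators *)

Section TotalComplex.
Variables (G : graph) (v0 : vertex G).
Local Notation E := (edge G).
Local Notation X := {ffun E -> int}.
Local Notation Om := ({set E} -> int).
Local Notation V := ({set E} -> {set E} -> Om).
Local Notation W := (X -> V).
Local Notation K := (X -> ({set E} -> Om)).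

Definition column (w : W) S : K := fun p => w p S.

(** In [w p S A C] the position is [p], [S] is the face, [A] indexes the Koszul directions and [C]
    the multivector. Asking that [e] be outside [A] keeps [A] disjoint from the face. *)
Definition face_part e (w : W) : W := fun p S A =>
  if (e \in S) && (e \notin A) then ann e (w p (S :\ e) A) else 0.

(** The sign makes this part anticommute with [face_part], which adds one edge to [S]. *)
Definition kos_part e (w : W) : W := fun p S A =>
  if e \in S then 0 else cre e (dop v0 e (column w S) p) A *~ (-1) ^+ #|S|.

Fact face_part_additive e : zmod_morphism (face_part e).
Proof.
move=> w w'; apply/funext => p; apply/funext => S; apply/funext => A.
rewrite -[RHS]/(face_part e w p S A - face_part e w' p S A) /face_part.
case: ifP => _; last by rewrite subr0.
exact: (raddfB (ann e)).
Qed.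
HB.instance Definition _ e := GRing.isZmodMorphism.Build W W (face_part e) (face_part_additive e).

Fact kos_part_additive e : zmod_morphism (kos_part e).
Proof.
move=> w w'; apply/funext => p; apply/funext => S; apply/funext => A.
rewrite -[RHS]/(kos_part e w p S A - kos_part e w' p S A) /kos_part.
case: ifP => _; first by rewrite subr0.
have -> : column (w - w') S = column w S - column w' S by [].
by rewrite dopB -mulrzBl; apply: (congr1 (fun x => x *~ _)); rewrite -[LHS]/(cre e (dop v0 e (column w S) p - dop v0 e (column w' S) p) A) raddfB.
Qed.
HB.instance Definition _ e := GRing.isZmodMorphism.Build W W (kos_part e) (kos_part_additive e).

Definition part (i : E + E) : {additive W -> W} :=
  match i with inl e => face_part e | inr e => kos_part e end.

Definition total_diff (w : W) : W := \sum_(i : E + E) (part i w : W).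

Fact total_diff_additive : zmod_morphism total_diff.
Proof.
move=> w w'; rewrite /total_diff -sumrB; apply: eq_bigr => i _.
exact: (raddfB (part i)).
Qed.
HB.instance Definition _ := GRing.isZmodMorphism.Build W W total_diff total_diff_additive.

Lemma face_part_anti e f w : face_part e (face_part f w) = - face_part f (face_part e w).
Proof.
apply/funext => p; apply/funext => S; apply/funext => A.
rewrite -[RHS]/(- (face_part f (face_part e w) p S A)) /face_part /= !inE.
have [->|ef] := eqVneq e f; first by rewrite /= !raddf0 if_same oppr0.
rewrite /=.
case: (e \in S); case: (e \in A); case: (f \in S); case: (f \in A);
  rewrite /= ?raddf0 ?oppr0 //.
by rewrite ann_anti !setDDl setUC.
Qed.

Lemma face_part_sq e w : face_part e (face_part e w) = 0.
Proof.
apply/funext => p; apply/funext => S; apply/funext => A; rewrite /face_part.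
by rewrite !inE eqxx /= raddf0 if_same.
Qed.

Lemma column_kos_part e w S : column (kos_part e w) S =
  if e \in S then 0 else fun p => cre e (dop v0 e (column w S) p) *~ (-1) ^+ #|S|.
Proof.
apply/funext => p; apply/funext => A; rewrite /column /kos_part.
by case: ifP => // _; rewrite fct_mulrz.
Qed.

Lemma kos_part2 e f w p S : kos_part e (kos_part f w) p S =
  if (e \in S) || (f \in S) then 0 else cre e (cre f (dop v0 e (dop v0 f (column w S)) p)).
Proof.
rewrite -[LHS]/(column (kos_part e (kos_part f w)) S p) column_kos_part.
have [eS|eS] := boolP (e \in S); first by [].
rewrite column_kos_part; have [fS|fS] := boolP (f \in S).
  by rewrite /= (raddf0 (dop v0 e)) -[(0 : K) p]/(0 : _) raddf0 mul0rz.
have dm : dop v0 e (fun p => cre f (dop v0 f (column w S) p) *~ (-1) ^+ #|S|) p =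
    cre f (dop v0 e (dop v0 f (column w S)) p) *~ (-1) ^+ #|S|.
  apply: etrans (esym (mulrzBl _ _ _)) _; apply: (congr1 (fun x => x *~ _)).
  exact/esym/(raddfB (cre f)).
rewrite /= dm (raddfMz (cre e)) /= -mulrzA -expr2 -exprM mulnC exprM.
by rewrite expr2 mulrNN mulr1 expr1n mulr1z.
Qed.

Lemma kos_part_anti e f w : kos_part e (kos_part f w) = - kos_part f (kos_part e w).
Proof.
apply/funext => p; apply/funext => S.
rewrite -[RHS]/(- (kos_part f (kos_part e w) p S)) !kos_part2 orbC.
by case: ifP => _; rewrite ?oppr0 // cre_anti dop_comm.
Qed.

Lemma kos_part_sq e w : kos_part e (kos_part e w) = 0.
Proof.
apply/funext => p; apply/funext => S; rewrite kos_part2 cre_sq; exact: if_same.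
Qed.

Lemma face_kos_part e f w : face_part e (kos_part f w) = - kos_part f (face_part e w).
Proof.
apply/funext => p; apply/funext => S; apply/funext => A.
rewrite -[RHS]/(- (column (kos_part f (face_part e w)) S p A)) column_kos_part.
rewrite /face_part; have -> : kos_part f w p (S :\ e) = column (kos_part f w) (S :\ e) p by [].
rewrite column_kos_part !inE.
have dE : dop v0 f (column (face_part e w) S) p (A :\ f) =
    if (e \in S) && (e \notin A :\ f) then ann e (dop v0 f (column w (S :\ e)) p (A :\ f)) else 0.
  rewrite /dop -[LHS]/(face_part e w (p + (path_chain v0 set0 (tail_of f) + delt f)) S (A :\ f) -
     face_part e w (p + path_chain v0 set0 (tail_of f)) S (A :\ f)) /face_part.
  by case: ifP => _; rewrite ?subr0 // -(raddfB (ann e)).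
have [fe|fe] := eqVneq f e.
  move: dE; rewrite {f}fe => dE; have [eS|eS] := boolP (e \in S).
    rewrite -[RHS]/(- 0) oppr0; case: ifP => //= eA.
    by rewrite fct_mulrz /cre (negPf eA) mul0rz raddf0.
  rewrite /= fct_mulrz /cre; case: ifP => eA; last by rewrite mul0rz oppr0.
  by rewrite dE (negPf eS) !mul0rz oppr0.
rewrite /=; have [fS|fS] := boolP (f \in S).
  by rewrite raddf0 if_same; apply/esym/eqP; rewrite oppr_eq0.
rewrite !fct_mulrz {2}/cre; have [fA|fA] := boolP (f \in A); last first.
  by rewrite /cre (negPf fA) mul0rz raddf0 if_same mul0rz oppr0.
rewrite dE !inE eq_sym fe /=.
case: ifP => [/andP[eS eA]|_]; last by rewrite !mul0rz oppr0.
rewrite (raddfMz (ann e)) /= /cre fA (raddfMz (ann e)) /=.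
by rewrite [#|S|](cardsD1 e) eS add1n exprS mulN1r mulrNz opprK.
Qed.

Lemma total_diff_sq w : total_diff (total_diff w) = 0.
Proof.
rewrite /total_diff; apply: (@sum_anti_sq _ W part) => [[e|e] [f|f] x|[e|e] x] /=.
- exact: face_part_anti.
- exact: face_kos_part.
- by rewrite face_kos_part opprK.
- exact: kos_part_anti.
- exact: face_part_sq.
- exact: kos_part_sq.
Qed.

Lemma total_diffE w p S A : total_diff w p S A =
  \sum_(e | (e \in S) && (e \notin A)) ann e (w p (S :\ e) A) +
  kos v0 S (column w S) p A *~ (-1) ^+ #|S|.
Proof.
rewrite /total_diff big_sumType -[LHS]/((\sum_e face_part e w) p S A + (\sum_e kos_part e w) p S A).
apply: (congr2 +%R).
  transitivity (\sum_e face_part e w p S A); first by apply/funext => C; rewrite !fct_sumE.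
  by rewrite [RHS]big_mkcond.
transitivity (\sum_e kos_part e w p S A); first by apply/funext => C; rewrite !fct_sumE.
have -> : kos v0 S (column w S) p A = \sum_(e | e \notin S) cre e (dop v0 e (column w S) p) A.
  by apply/funext => C; rewrite /kos !fct_sumE.
rewrite mulrz_suml [RHS]big_mkcond; apply: eq_bigr => e _.
by rewrite /kos_part if_neg.
Qed.
End TotalComplex.

Lemma mulrz_signK (M : zmodType) (x : M) n : x *~ (-1) ^+ n *~ (-1) ^+ n = x.
Proof. by rewrite -mulrzA -exprMn mulrNN mulr1 expr1n mulr1z. Qed.

(** * Exactness of the double complex outside degree k *)

Section Degrees.
Variables (G : graph) (v0 : vertex G) (k : nat).
Local Notation E := (edge G).
Local Notation X := {ffun E -> int}.
Local Notation Om := ({set E} -> int).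
Local Notation V := ({set E} -> {set E} -> Om).
Local Notation W := (X -> V).
Local Notation K := (X -> ({set E} -> Om)).
Local Notation D := (total_diff v0).

Lemma total_diffB w w' : D (w - w') = D w - D w'.
Proof. exact: total_diff_additive. Qed.

Lemma total_diff0 : D 0 = 0.
Proof. by have := total_diffB 0 0; rewrite !subrr. Qed.

Lemma total_diffD w w' : D (w + w') = D w + D w'.
Proof.
have H : D (- w') = - D w' by rewrite -(sub0r w') total_diffB total_diff0 sub0r.
by rewrite -[w' in LHS]opprK total_diffB H opprK.
Qed.

Lemma total_diff_translate c w :
  D (fun p => w (p + c)) = fun p => D w (p + c).
Proof.
apply/funext => p; apply/funext => S; apply/funext => A.
rewrite !total_diffE; apply: (congr2 +%R) => //.
apply: (congr1 (fun x : {set E} -> Om => x A *~ _)).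
apply: eq_bigr => e _; apply: (congr1 (cre e)).
by rewrite /dop /column ![p + c + _]addrAC.
Qed.

(** [n] is the total degree, while [#|C| + #|S|] is a weight that the differential preserves. *)
Definition col_deg (S : {set E}) (n : int) (x : {set E} -> Om) := forall A, inO S (x A) /\
  forall C, x A C != 0 -> [&& conn S, [disjoint A & S], #|S|%:Z + #|A|%:Z == n & (#|C| + #|S| == k)%N].

Definition face_deg n (v : V) := forall S, col_deg S n (v S).

Lemma col_deg0 S n : col_deg S n 0.
Proof. by move=> A; split; [exact: inO0|]. Qed.

Lemma col_degB S n x y : col_deg S n x -> col_deg S n y -> col_deg S n (x - y).
Proof.
move=> H H' A; have [H1 H2] := H A; have [H1' H2'] := H' A; split; first exact: inOB.
move=> C; rewrite -[(x - y) A C]/(x A C - y A C) => n0.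
have [x0|/H2 //] := eqVneq (x A C) 0; apply: H2'.
by move: n0; rewrite x0 sub0r oppr_eq0.
Qed.

Lemma col_degD S n x y : col_deg S n x -> col_deg S n y -> col_deg S n (x + y).
Proof.
move=> H H'; rewrite -[y]opprK; apply: col_degB => //; rewrite -sub0r.
by apply: col_degB => //; exact: col_deg0.
Qed.

Lemma col_deg_sum S n (I : Type) (r : seq I) (P : pred I) (F : I -> {set E} -> Om) :
  (forall i, P i -> col_deg S n (F i)) -> col_deg S n (\sum_(i <- r | P i) F i).
Proof. by move=> H; elim/big_ind: _ => //; [exact: col_deg0|exact: col_degD]. Qed.

Lemma col_degMz S n x (j : int) : col_deg S n x -> col_deg S n (x *~ j).
Proof.
move=> H A; have [H1 H2] := H A; rewrite fct_mulrz; split; first exact: inOMz.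
by move=> C; rewrite fct_mulrz => n0; apply: H2; apply: contraNneq n0 => ->; rewrite mul0rz.
Qed.

Lemma face_deg0 n : face_deg n 0.
Proof. by move=> S; exact: col_deg0. Qed.

Lemma face_degB n v v' : face_deg n v -> face_deg n v' -> face_deg n (v - v').
Proof. by move=> H H' S; exact: col_degB. Qed.

Lemma face_deg_neg n v : n < 0 -> face_deg n v -> v = 0.
Proof.
move=> n0 H; apply/funext => S; apply/funext => A; apply/funext => C.
have [//|/(proj2 (H S A))/and4P[_ _ /eqP nE _]] := eqVneq (v S A C) 0.
by move: n0; rewrite -nE -PoszD.
Qed.

Lemma disjoint_setD1l (S A : {set E}) e : e \notin S -> [disjoint A :\ e & S] = [disjoint A & S].
Proof.
move=> eS; rewrite -!setI_eq0; congr (_ == _); apply/setP => f; rewrite !inE.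
by case: eqP => [->|//]; rewrite (negPf eS) !andbF.
Qed.

Lemma cre_col_deg (S : {set E}) n e (x : {set E} -> Om) : e \notin S -> col_deg S (n - 1) x -> col_deg S n (cre e x).
Proof.
move=> eS H A; rewrite /cre; case: ifPn => eA; last by split; [exact: inO0|].
have [H1 H2] := H (A :\ e); split; first exact: inOMz.
move=> C; rewrite fct_mulrz => n0.
have : x (A :\ e) C != 0 by apply: contraNneq n0 => ->; rewrite mul0rz.
move=> /H2/and4P[cS AS /eqP nE Ck]; rewrite cS Ck /= andbT -(disjoint_setD1l A eS) AS /=.
apply/eqP; move: nE; rewrite (cardsD1 e A) eA; lia.
Qed.

Lemma kos_col_deg S n (z : K) : (forall p, col_deg S (n - 1) (z p)) ->
  forall p, col_deg S n (kos v0 S z p).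
Proof.
move=> H p; apply: col_deg_sum => e eS; apply: cre_col_deg => //.
by rewrite /dop; exact: col_degB.
Qed.

Lemma total_diff_deg n w : (forall p, face_deg n (w p)) -> forall p, face_deg (n + 1) (D w p).
Proof.
move=> H p S.
have -> : D w p S = (fun A : {set E} => \sum_(e | (e \in S) && (e \notin A)) ann e (w p (S :\ e) A)) +
    kos v0 S (column w S) p *~ (-1) ^+ #|S|.
  apply/funext => A; rewrite total_diffE.
  by rewrite -[RHS]/(_ A + (_ *~ _) A) fct_mulrz.
apply: col_degD; last first.
  apply: col_degMz; apply: kos_col_deg => q; rewrite addrK; exact: H.
move=> A; split.
  apply: inO_sum => e /andP[eS eA]; have := inO_ann e (proj1 (H p (S :\ e) A)).
  by rewrite setD1K.
move=> C; rewrite fct_sumE => n0.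
have [e /andP[/andP[eS eA] en0]|H0] := pickP (fun e => (e \in S) && (e \notin A) && (ann e (w p (S :\ e) A) C != 0)); last first.
  case/eqP: n0; apply: big1 => e eSA; have := H0 e; rewrite eSA /=.
  by move=> /negbFE/eqP.
have [eC /(proj2 (H p _ _))/and4P[cS AS /eqP nE /eqP Ck]] := ann_neq0 en0.
(* Contraction with a dependent edge would give zero; hence [e] is not a bridge and [S] is again a
   face. *)
have nd : ~ dependent (S :\ e) e.
  move=> dS; move: en0; rewrite (inO_dependent dS) ?eqxx //.
  exact: (proj1 (H p _ _)).
have cSS : conn S.
  by rewrite -(setD1K eS); apply/negPn/negP => /(nconn_dependent cS) dS; apply: nd; apply: dS; rewrite !inE eqxx.
apply/and4P; split=> //.
- by rewrite disjoint_sym -(disjoint_setD1l S eA) disjoint_sym.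
- by apply/eqP; move: nE; rewrite (cardsD1 e S) eS; lia.
- by rewrite (cardsD1 e S) eS; move: Ck; rewrite cardsU1 eC => <-; apply/eqP; lia.
Qed.

Lemma kos_proj (P Q : pred {set E}) (S : {set E}) (y : K) :
  (forall e (A : {set E}), e \notin S -> e \in A -> Q A = P (A :\ e)) ->
  forall p A, kos v0 S (fun p A => if P A then y p A else 0) p A =
    if Q A then kos v0 S y p A else 0.
Proof.
move=> PQ p A.
have kE (z : K) : kos v0 S z p A = \sum_(e | e \notin S) cre e (dop v0 e z p) A.
  by apply/funext => C; rewrite /kos !fct_sumE.
rewrite !kE; transitivity (\sum_(e | e \notin S) if Q A then cre e (dop v0 e y p) A else 0); last first.
  by case: ifP => // _; rewrite big1.
apply: eq_bigr => e eS; rewrite /cre; case: ifP => eA; last by rewrite if_same.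
rewrite (PQ e A eS eA) -[dop v0 e _ p (A :\ e)]/((if P (A :\ e) then _ else 0) - (if P (A :\ e) then _ else 0)).
by case: ifP => _ //; rewrite subr0 mul0rz.
Qed.

(** [column_exact] gives a primitive without control of its degree; truncation restores the degree
    and commutes with [kos]. *)
Lemma column_proj (S : {set E}) (n : int) (y : K) (Q := fun A : {set E} => [disjoint A & S] && (#|S|%:Z + #|A|%:Z == n)) :
  exists y' : K, (forall p (A : {set E}), y' p A = if [disjoint A & S] && (#|S|%:Z + #|A|%:Z == n - 1) then y p A else 0) /\
  forall p A, kos v0 S y' p A = if Q A then kos v0 S y p A else 0.
Proof.
exists (fun p (A : {set E}) => if [disjoint A & S] && (#|S|%:Z + #|A|%:Z == n - 1) then y p A else 0); split=> // p A.
apply: (kos_proj (Q := Q) (P := fun A : {set E} => [disjoint A & S] && (#|S|%:Z + #|A|%:Z == n - 1))).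
move=> e B eS eB; rewrite /Q disjoint_setD1l //; congr (_ && _).
by rewrite (cardsD1 e B) eB; apply/eqP/eqP; lia.
Qed.

Lemma column_clear (S : {set E}) n (z : K) : (forall p, col_deg S n (z p)) ->
  kos v0 S z = 0 ->
  exists2 y : K, forall p, col_deg S (n - 1) (y p) &
    forall p A, A != set0 -> (z - kos v0 S y) p A = 0.
Proof.
move=> zd kz.
have [cS|ncS] := boolP (conn S); last first.
  exists 0 => [p|p A _]; first exact: col_deg0.
  rewrite raddf0 subr0; apply/funext => C; have [//|/(proj2 (zd p A))] := eqVneq (z p A C) 0.
  by rewrite (negPf ncS).
pose q : int := k%:Z - #|S|%:Z.
have zq p A C : z p A C != 0 -> #|C|%:Z = q.
  move=> /(proj2 (zd p A))/and4P[_ _ _ /eqP]; rewrite /q; lia.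
(* The values are moved to the exterior power of the cycle group so that the primitive takes values
   there too, and not merely in all multivectors. *)
pose La := ext_power (H1 (delete S)) q.
pose zL : X -> ({set E} -> La) := fun p A => of_form v0 S q (z p A).
have kosL (U U' : zmodType) (f : {additive U -> U'}) (u : X -> ({set E} -> U)) :
    kos v0 S (fun p A => f (u p A)) = fun p A => f (kos v0 S u p A).
  apply/funext => p; apply/funext => A; rewrite /kos !fct_sumE raddf_sum; apply: eq_bigr => e _.
  rewrite /cre /dop; case: ifP => _; last by rewrite raddf0.
  rewrite raddfMz /=; apply: (congr1 (fun x => x *~ _)).
  exact/esym/raddfB.
have kzL : kos v0 S zL = 0.
  rewrite /zL (kosL _ _ (of_form v0 S q)) kz; apply/funext => p; apply/funext => A.
  by rewrite -[RHS](raddf0 (of_form v0 S q)).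
have [yL yLP] := column_exact kzL.
have [y [yE ky]] := column_proj S n (fun p A => form_of S q (yL p A)).
exists y => [p A|p A A0].
  rewrite yE; case: ifP => [/andP[AS nE]|_]; last by split; [exact: inO0|].
  split; first exact: form_of_inO.
  move=> C n0; have Cq : #|C|%:Z = q := ext_form_deg n0.
  by rewrite cS AS nE /=; apply/eqP; move: Cq; rewrite /q; lia.
rewrite -[LHS]/(z p A - kos v0 S y p A) ky; case: ifP => [/andP[AS nE]|nQ]; last first.
  rewrite subr0; apply/funext => C; have [//|/(proj2 (zd p A))/and4P[_ AS nE _]] := eqVneq (z p A C) 0.
  by rewrite AS nE in nQ.
have nAS : ~~ (A \subset S).
  apply: contra A0 => /setIidPl <-; rewrite setI_eq0 //.
have := yLP p A nAS; rewrite -[(zL - _) p A]/(zL p A - kos v0 S yL p A) => H.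
have HE : form_of S q (zL p A) - form_of S q (kos v0 S yL p A) = 0.
  by rewrite -(raddfB (form_of S q)) H (raddf0 (form_of S q)).
have zE : form_of S q (zL p A) = z p A.
  by apply: of_formK => //; [exact: (proj1 (zd p A))|exact: zq].
have kE : kos v0 S (fun p A => form_of S q (yL p A)) p A = form_of S q (kos v0 S yL p A).
  by rewrite (kosL _ _ (form_of S q)).
by rewrite kE -zE.
Qed.

Definition noA (w : W) := forall p (S A : {set E}), A != set0 -> w p S A = 0.

Definition homog n (w : W) := forall p, face_deg n (w p).

Lemma homogB n w w' : homog n w -> homog n w' -> homog n (w - w').
Proof. by move=> H H' p; exact: face_degB. Qed.

Lemma homog_diff n y : homog (n - 1) y -> homog n (D y).
Proof. by move=> yd p; have := total_diff_deg yd p; rewrite subrK. Qed.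

(** Components at faces with fewer than [j] edges live only at A empty, so in the columns with [j]
    edges the Koszul part vanishes by itself. *)
Lemma clear_column_step j n z : homog n z -> noA (D z) ->
  (forall p (S A : {set E}), (#|S| < j)%N -> A != set0 -> z p S A = 0) ->
  exists2 y, homog (n - 1) y & forall p (S A : {set E}), (#|S| < j.+1)%N -> A != set0 -> (z - D y) p S A = 0.
Proof.
move=> zd dz zj.
have kz (S : {set E}) : #|S| = j -> kos v0 S (column z S) = 0.
  move=> Sj; apply/funext => p; apply/funext => A.
  have [->|A0] := eqVneq A set0.
    apply/funext => C; rewrite /kos !fct_sumE big1 // => e _.
    by rewrite /cre inE.
  have := dz p S A A0; rewrite total_diffE big1 ?add0r => [|e /andP[eS _]]; last first.
    by rewrite zj ?raddf0 // -Sj (cardsD1 e S) eS.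
  by move=> /(congr1 (fun x => x *~ (-1) ^+ #|S|)); rewrite mulrz_signK mul0rz.
have ySP (S : {set E}) : exists y : K, (forall p, col_deg S (n - 1) (y p)) /\
    (#|S| = j -> forall p A, A != set0 -> (column z S - kos v0 S y) p A = 0).
  have [Sj|Sj] := eqVneq #|S| j; last first.
    by exists 0; split=> [p|Sj']; [exact: col_deg0|rewrite Sj' eqxx in Sj].
  by have [y yd yP] := column_clear (fun p => zd p S) (kz S Sj); exists y.
have [Y YP] := choice ySP.
exists (fun p (S : {set E}) => if #|S| == j then Y S p *~ (-1) ^+ j else 0).
  move=> p S; case: ifP => _; last exact: col_deg0.
  by apply: col_degMz; have [H _] := YP S; exact: H.
move=> p S A; rewrite ltnS leq_eqVlt => /orP[/eqP Sj|Sj] A0.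
  rewrite -[LHS]/(z p S A - D _ p S A) total_diffE big1 ?add0r => [|e /andP[eS _]]; last first.
    rewrite ifF ?raddf0 //; apply/eqP; move: Sj; rewrite (cardsD1 e S) eS; lia.
  have -> : column (fun p (S : {set E}) => if #|S| == j then Y S p *~ (-1) ^+ j else 0) S = Y S *~ (-1) ^+ j.
    by apply/funext => q; rewrite /column Sj eqxx fct_mulrz.
  have [_ /(_ Sj p A A0) <-] := YP S; rewrite (raddfMz (kos v0 S)) Sj.
  rewrite -[RHS]/(z p S A - kos v0 S (Y S) p A); congr (_ - _).
  by rewrite 2!fct_mulrz mulrz_signK.
rewrite -[LHS]/(z p S A - D _ p S A) zj // sub0r; apply/eqP; rewrite oppr_eq0; apply/eqP.
rewrite total_diffE big1 ?add0r => [|e /andP[eS _]]; last first.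
  rewrite ifF ?raddf0 //; apply/eqP; move: Sj; rewrite (cardsD1 e S) eS; lia.
have -> : column (fun p (S : {set E}) => if #|S| == j then Y S p *~ (-1) ^+ j else 0) S = 0.
  by apply/funext => q; rewrite /column ifF //; apply/eqP; lia.
by rewrite raddf0 mul0rz.
Qed.

Lemma clear_noA n z : homog n z -> noA (D z) ->
  exists2 y, homog (n - 1) y & noA (z - D y).
Proof.
move=> zd dz.
suff [y yd yP] : exists2 y, homog (n - 1) y &
    forall p (S A : {set E}), (#|S| < #|E|.+1)%N -> A != set0 -> (z - D y) p S A = 0.
  by exists y => // p S A; apply: yP; rewrite ltnS max_card.
elim: #|E|.+1 => [|j [y yd yP]].
  by exists 0 => // p; exact: face_deg0.
have z1d : homog n (z - D y).
  exact: homogB zd (homog_diff yd).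
have dz1 : noA (D (z - D y)) by rewrite total_diffB total_diff_sq subr0.
have [y' yd' yP'] := clear_column_step z1d dz1 yP.
exists (y + y').
  by move=> p S; exact: col_degD (yd p S) (yd' p S).
by move=> p S A; rewrite total_diffD opprD addrA; exact: yP'.
Qed.

(** At a singleton [A] the differential of [z] reduces, up to sign, to the operator [dop v0 e]. *)
Lemma noA_inv z (S : {set E}) e p : noA z -> noA (D z) -> e \notin S ->
  z (p + delt e) S set0 = z p S set0.
Proof.
move=> zA dzA eS.
have e0 : [set e] != set0 by apply/set0Pn; exists e; rewrite inE.
have K0 q : dop v0 e (fun q => z q S set0) q = 0.
  have := dzA q S [set e] e0; rewrite total_diffE big1 ?add0r; last first.
    by move=> f _; rewrite zA ?raddf0.
  have -> : kos v0 S (column z S) q [set e] = dop v0 e (fun q => z q S set0) q *~ sg e [set e].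
    transitivity (\sum_(f | f \notin S) cre f (dop v0 f (column z S) q) [set e]).
      by apply/funext => C; rewrite /kos !fct_sumE.
    rewrite (bigD1 e) //= big1 ?addr0 => [|f /andP[_ fe]]; last by rewrite /cre inE (negPf fe).
    by rewrite /cre inE eqxx setDv.
  move=> /(congr1 (fun x => x *~ (-1) ^+ #|S|)); rewrite mulrz_signK mul0rz.
  by move=> /(congr1 (fun x => x *~ sg e [set e])); rewrite /sg mulrz_signK mul0rz.
have K0' : dop v0 e (fun q => z q S set0) = 0 by apply/funext.
exact: (dop_eq0 K0' p).
Qed.

Lemma total_diff_face z p S : D z p S set0 = \sum_(e in S) ann e (z p (S :\ e) set0).
Proof.
rewrite total_diffE (_ : kos v0 S (column z S) p set0 = 0) ?mul0rz ?addr0.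
  by apply: eq_bigl => e; rewrite inE andbT.
by apply/funext => C; rewrite /kos !fct_sumE big1 // => f _; rewrite /cre inE.
Qed.

Lemma noA_diff z : noA z ->
  (forall p (S : {set E}) e, e \notin S -> z (p + delt e) S set0 = z p S set0) -> noA (D z).
Proof.
move=> zA zI p S A A0; rewrite total_diffE big1 ?add0r; last first.
  by move=> f _; rewrite zA ?raddf0.
rewrite (_ : kos v0 S (column z S) p A = 0) ?mul0rz //.
transitivity (\sum_(e | e \notin S) cre e (dop v0 e (column z S) p) A).
  by apply/funext => C; rewrite /kos !fct_sumE.
apply: big1 => e eS; rewrite /cre; case: ifP => // eA.
rewrite -[dop v0 e _ p (A :\ e)]/(z (p + (path_chain v0 set0 (tail_of e) + delt e)) S (A :\ e) -
  z (p + path_chain v0 set0 (tail_of e)) S (A :\ e)).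
have [->|AE] := eqVneq (A :\ e) set0; last by rewrite !zA // subrr mul0rz.
by rewrite addrA zI // subrr mul0rz.
Qed.

(** After [clear_noA] the cocycle is a face cochain, so [dB_exact] applies below [k]; outside the
    range from 0 to [k] the component at A empty is zero. *)
Lemma total_exact n z : homog n z -> D z = 0 -> n != k%:Z ->
  exists2 y, homog (n - 1) y & z = D y.
Proof.
move=> zd dz nk.
have dz0 : noA (D z) by rewrite dz.
have [y yd yP] := clear_noA zd dz0.
pose z1 := z - D y.
have z1d : homog n z1.
  exact: homogB zd (homog_diff yd).
have dz1 : D z1 = 0 by rewrite total_diffB total_diff_sq subr0.
suff [y' yd' yE] : exists2 y', homog (n - 1) y' & z1 = D y'.
  exists (y + y').
    by move=> p S; exact: col_degD (yd p S) (yd' p S).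
  by rewrite total_diffD -yE addrC subrK.
have supp p (S C : {set E}) : z1 p S set0 C != 0 -> [/\ conn S, #|S|%:Z = n & (#|C| + #|S| = k)%N].
  move=> /(proj2 (z1d p S set0))/and4P[cS _ /eqP nE /eqP Ck]; split=> //.
  by move: nE; rewrite cards0 addr0.
have z1E p (S A : {set E}) : z1 p S A = if A == set0 then z1 p S set0 else 0.
  by case: eqP => [->//|/eqP A0]; exact: yP.
have [[m mk nE]|bad] : (exists2 m, (m < k)%N & n = m%:Z) \/ (n < 0 \/ k%:Z < n).
  case: n nk {zd yd z1d supp} => [m|m] nk; last by right; left.
  by have [mk|mk] := ltnP m k; [left; exists m|right; right; lia].
  2: exists 0; first by move=> p; exact: face_deg0.
2: { rewrite total_diff0; apply/funext => p; apply/funext => S; apply/funext => A; apply/funext => C.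
  rewrite z1E; case: eqP => // _; have [//|/supp[_ Sn Ck]] := eqVneq (z1 p S set0 C) 0.
  by case: bad; lia. }
have yk : face_cochain k (fun S p => z1 p S set0).
  split=> [S p|S p C /supp[-> _ ->]|S e p eS]; rewrite ?eqxx //.
    exact: (proj1 (z1d p S set0)).
  by apply: noA_inv => //; rewrite dz1.
have dy : dB (fun S p => z1 p S set0) = 0.
  by apply/funext => S; apply/funext => p; rewrite -[RHS]/((0 : W) p S set0) -dz1 total_diff_face.
have ym (S : {set E}) p C : z1 p S set0 C != 0 -> #|S| = m by move=> /supp[_ Sn _]; move: Sn; rewrite nE => -[].
have [y' [yk' ym' yE]] := dB_exact yk mk ym dy.
pose y1 : W := fun p (S A : {set E}) => if A == set0 then y' S p else 0.
have y1A : noA y1 by move=> p S A /negPf A0; rewrite /y1 A0.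
have dy1 : noA (D y1).
  by apply: noA_diff => // p S e eS; rewrite /y1 eqxx (fc_inv yk').
exists y1.
  move=> p S A; rewrite /y1; case: eqP => [->|_]; last by split; [exact: inO0|].
  split; first exact: (fc_in yk').
  move=> C n0; have /andP[-> ->] := fc_deg yk' n0.
  rewrite cards0 addr0 nE -(ym' _ _ _ n0) disjoint_sym -setI_eq0 setI0 eqxx /=.
  by rewrite andbT; apply/eqP; lia.
apply/funext => p; apply/funext => S; apply/funext => A.
have [->|A0] := eqVneq A set0; last by rewrite z1E (negPf A0) dy1.
have := congr1 (fun y => y S p) yE; rewrite total_diff_face /dB => <-.
by apply: eq_bigr => e _; rewrite /y1 eqxx.
Qed.
End Degrees.

(** * The Koszul complex of the periodic face ring and its square-free part *)

Section MonomialKoszul.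
Variables (G : graph) (k : nat).
Local Notation E := (edge G).
Local Notation X := {ffun E -> int}.
Local Notation Om := ({set E} -> int).
Local Notation N := {ffun E -> nat}.
Local Notation Kz := (N -> X -> Om).
Implicit Types (a : N) (e f : E) (u w : Kz) (S C : {set E}) (p : X).

Definition msup a : {set E} := [set e | (0 < a e)%N].
Definition minc a e : N := [ffun f => (a f + (f == e))%N].
Definition mdec a e : N := [ffun f => (a f - (f == e))%N].
Definition msize a : nat := (\sum_e a e)%N.

Lemma mincK a e : mdec (minc a e) e = a.
Proof. by apply/ffunP => f; rewrite !ffunE addnK. Qed.

Lemma mdecK a e : (0 < a e)%N -> minc (mdec a e) e = a.
Proof. by move=> ae; apply/ffunP => f; rewrite !ffunE; case: eqP => [->|_] /=; lia. Qed.

Lemma minc_mdec a e f : e != f -> mdec (minc a e) f = minc (mdec a f) e.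
Proof. by move=> ef; apply/ffunP => g; rewrite !ffunE; case: (g =P f) => [->|_]; rewrite ?[f == e]eq_sym ?(negPf ef) /=; lia. Qed.

Lemma mdecC a e f : mdec (mdec a e) f = mdec (mdec a f) e.
Proof. by apply/ffunP => g; rewrite !ffunE subnAC. Qed.

Lemma msup_minc a e : msup (minc a e) = e |: msup a.
Proof. by apply/setP => f; rewrite !inE ffunE; case: eqP => //= _; lia. Qed.

Lemma msup_mdec_sub a e : msup (mdec a e) \subset msup a.
Proof. by apply/subsetP => f; rewrite !inE ffunE; lia. Qed.

Lemma msup_mdec a e : (1 < a e)%N -> msup (mdec a e) = msup a.
Proof. by move=> ae; apply/setP => f; rewrite !inE ffunE; case: eqP => [->|_] /=; lia. Qed.

Lemma msup_mdec1 a e : a e = 1%N -> msup (mdec a e) = msup a :\ e.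
Proof. by move=> ae; apply/setP => f; rewrite !inE ffunE; case: eqP => [->|_] /=; rewrite ?ae ?subn0. Qed.

Lemma sum_nat_pred1 e : (\sum_(f : E) (f == e) = 1)%N.
Proof. by rewrite (bigD1 e) //= eqxx big1 // => f /negPf->. Qed.

Lemma msize_minc a e : msize (minc a e) = (msize a).+1.
Proof.
rewrite /msize; under eq_bigr => f _ do rewrite ffunE.
by rewrite big_split /= sum_nat_pred1 addn1.
Qed.

Lemma msize_mdec a e : (0 < a e)%N -> (msize (mdec a e)).+1 = msize a.
Proof. by move=> ae; rewrite -(msize_minc _ e) mdecK. Qed.

(** A chain of the Koszul complex of SR_per over H_1(G): [u a p] is the multivector at the monomial
    with exponents [a] and indices [p], and indices of edges with exponent zero are irrelevant. *)
Record mono_cochain u : Prop := MonoCochain {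
  mc_in : forall a p, inO set0 (u a p);
  mc_deg : forall a p C, u a p C != 0 -> conn (msup a) && (#|C| + msize a == k)%N;
  mc_inv : forall a e p, a e = 0%N -> u a (p + delt e) = u a p }.

Definition kD_part e u : Kz := fun a p =>
  if conn (msup a) && (0 < a e)%N then ann e (u (mdec a e) p) else 0.

Fact kD_part_additive e : zmod_morphism (kD_part e).
Proof.
move=> u w; apply/funext => a; apply/funext => p.
rewrite -[RHS]/(kD_part e u a p - kD_part e w a p) /kD_part.
case: ifP => _; last by rewrite subr0.
exact: (raddfB (ann e)).
Qed.
HB.instance Definition _ e := GRing.isZmodMorphism.Build Kz Kz (kD_part e) (kD_part_additive e).

(** The Koszul differential for multiplication by H_1(G): the coefficient at a monomial collects the
    contractions with [e] of the coefficients at its quotients by a variable over [e]. *)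
Definition kD u : Kz := \sum_e (kD_part e u : Kz).

Lemma kDB u w : kD (u - w) = kD u - kD w.
Proof. by rewrite /kD -sumrB; apply: eq_bigr => e _; exact: (raddfB (kD_part e)). Qed.

Lemma kD0 : kD 0 = 0.
Proof. by have := kDB 0 0; rewrite !subrr. Qed.

Lemma kDD u w : kD (u + w) = kD u + kD w.
Proof.
have H : kD (- w) = - kD w by rewrite -(sub0r w) kDB kD0 sub0r.
by rewrite -[w in LHS]opprK kDB H opprK.
Qed.

Lemma kD_sq u : kD (kD u) = 0.
Proof.
apply: (@sum_anti_sq _ Kz (fun e => kD_part e : {additive Kz -> Kz})) => [e f v|e v] /=.
  apply/funext => a; apply/funext => p; rewrite -[RHS]/(- kD_part f (kD_part e v) a p) /kD_part.
  have [ca|_] := boolP (conn (msup a)); last by rewrite /= oppr0.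
  rewrite !(conn_mono (msup_mdec_sub _ _) ca) !ffunE /=.
  have [->|ef] := eqVneq e f; first by case: ifP => _; rewrite ?oppr0 //; case: ifP => _; rewrite ?ann_sq ?raddf0 ?oppr0.
  rewrite !subn0; case: (0 < a e)%N; case: (0 < a f)%N; rewrite ?raddf0 ?oppr0 //.
  by rewrite ann_anti mdecC.
apply/funext => a; apply/funext => p; rewrite /kD_part.
by case: ifP => // _; case: ifP => _; rewrite ?ann_sq ?raddf0.
Qed.

Lemma kDE u a p : kD u a p =
  if conn (msup a) then \sum_(e in msup a) ann e (u (mdec a e) p) else 0.
Proof.
have -> : kD u a p = \sum_e kD_part e u a p.
  by apply/funext => C; rewrite /kD !fct_sumE.
rewrite /kD_part; case: ifP => _; last by rewrite big1.
by rewrite [RHS]big_mkcond; apply: eq_bigr => e _; rewrite inE.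
Qed.

Lemma mono_cochainB u w : mono_cochain u -> mono_cochain w -> mono_cochain (u - w).
Proof.
move=> H H'; split=> [a p|a p C|a e p ae].
- exact: inOB (mc_in H _ _) (mc_in H' _ _).
- rewrite -[(u - w) a p C]/(u a p C - w a p C) => n0.
  have [u0|/(mc_deg H) //] := eqVneq (u a p C) 0; apply: (mc_deg H' (p := p)).
  by move: n0; rewrite u0 sub0r oppr_eq0.
- by rewrite -[LHS]/(u a _ - w a _) (mc_inv H) // (mc_inv H').
Qed.

Lemma mono_cochain0 : mono_cochain 0.
Proof. by split=> // a p; exact: inO0. Qed.

Lemma mono_cochainD u w : mono_cochain u -> mono_cochain w -> mono_cochain (u + w).
Proof.
move=> H H'; rewrite -[w]opprK; apply: mono_cochainB => //; rewrite -sub0r.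
by apply: mono_cochainB => //; exact: mono_cochain0.
Qed.

Lemma mono_cochain_kD u : mono_cochain u -> mono_cochain (kD u).
Proof.
move=> H; split=> [a p|a p C|a e p ae]; rewrite !kDE.
- case: ifP => _; last exact: inO0.
  apply: inO_sum => e _; exact: inO_sub (sub0set _) (inO_ann e (mc_in H _ _)).
- case: ifP => // ca; rewrite fct_sumE => n0.
  have [e /andP[ea en0]|H0] := pickP (fun e => (e \in msup a) && (ann e (u (mdec a e) p) C != 0)); last first.
    by case/eqP: n0; apply: big1 => e ea; have := H0 e; rewrite ea => /negbFE/eqP.
  have [eC /(mc_deg H)/andP[_ /eqP <-]] := ann_neq0 en0.
  move: ea; rewrite inE => /msize_mdec <-; rewrite cardsU1 eC; apply/eqP; lia.
- case: ifP => // _; apply: eq_bigr => f _; rewrite (mc_inv H) //.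
  by rewrite ffunE ae.
Qed.

Definition nonsq a := [exists e, (1 < a e)%N].
Definition square_free u := forall a p, nonsq a -> u a p = 0.

(** For supports of size [s], clears the monomials divisible by the square of a variable over [e],
    keeping what is already cleared for smaller supports and for the edges in [l]. The correction
    multiplies the coefficient at the monomial times [e] by a cycle meeting the support only in
    [e]. *)
Lemma koszul_step s (l : seq E) e u : mono_cochain u -> square_free (kD u) ->
  (forall a p, (#|msup a| < s)%N -> nonsq a -> u a p = 0) ->
  (forall a p f, #|msup a| = s -> f \in l -> (1 < a f)%N -> u a p = 0) ->
  exists w, [/\ mono_cochain w,
    (forall a p, (#|msup a| < s)%N -> nonsq a -> (u - kD w) a p = 0) &
    (forall a p f, #|msup a| = s -> f \in e :: l -> (1 < a f)%N -> (u - kD w) a p = 0)].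
Proof.
move=> uc us u1 u2.
have gP S : exists c : X, conn S -> e \in S -> [/\ boundary c = 0, c e = 1 & forall f, f \in S -> f != e -> c f = 0].
  have [cS|_] := boolP (conn S); last by exists 0.
  have [eS|_] := boolP (e \in S); last by exists 0.
  have [c [cb co ce]] := conn_dual_cycle cS eS; exists c => _ _; split=> // f fS fe.
  by apply: co; rewrite !inE fe.
have [g gE] := choice gP.
pose w : Kz := fun a p => if (#|msup a| == s) && (e \in msup a) && conn (msup a)
  then crev (g (msup a)) (u (minc a e) p) else 0.
have supE a : e \in msup a -> msup (minc a e) = msup a.
  by move=> ea; rewrite msup_minc; apply/setUidPr; rewrite sub1set.
have wc : mono_cochain w.
  split=> [a p|a p C|a f p af]; rewrite /w; case: ifP => //; try by move=> _; exact: inO0.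
  - move=> /andP[/andP[_ ea] ca]; have [bg _ _] := gE _ ca ea.
    by apply: inO_crev => //; [move=> f; rewrite inE|exact: (mc_in uc)].
  - move=> /andP[/andP[_ ea] ca] /crev_neq0[f fC /(mc_deg uc)/andP[_ /eqP <-]].
    by rewrite ca msize_minc (cardsD1 f C) fC; apply/eqP; lia.
  - move=> /andP[/andP[_ ea] ca]; rewrite (mc_inv uc) // ffunE af.
    by move: ea; rewrite inE; case: eqP => // <-; rewrite af.
have wlt a p : (#|msup a| < s)%N -> kD w a p = 0.
  move=> sa; rewrite kDE; case: ifP => // _; apply: big1 => f _.
  rewrite /w ifF ?raddf0 //; apply/negbTE; rewrite !negb_and -orbA; apply/orP; left.
  apply/eqP; have := subset_leq_card (msup_mdec_sub a f); lia.
exists w; split=> // [a p sa na|a p f sa].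
  by rewrite -[LHS]/(u a p - kD w a p) wlt // u1 // subr0.
have [ca|nca] := boolP (conn (msup a)); last first.
  move=> _ _; apply/funext => C.
  have wc' := mono_cochainB uc (mono_cochain_kD wc).
  have [//|/(mc_deg wc')/andP[ca _]] := eqVneq ((u - kD w) a p C) 0.
  by rewrite ca in nca.
have [ea|nea] := boolP (e \in msup a); last first.
  move=> fl af; have -> : (u - kD w) a p = u a p.
    rewrite -[LHS]/(u a p - kD w a p) kDE ca big1 ?subr0 // => h _.
    rewrite /w ifF ?raddf0 //; apply/negbTE; rewrite !negb_and -orbA; apply/orP; right; apply/orP; left.
    by apply: contra nea; apply/subsetP/msup_mdec_sub.
  apply: (u2 _ _ f) => //; move: fl; rewrite inE => /orP[/eqP fe|//].
  by case/negP: nea; rewrite inE -fe; lia.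
have [bg ge1 g0] := gE _ ca ea; set c := g _ in bg ge1 g0.
pose F h := u (mdec (minc a e) h) p.
have F0 h : h \in msup a -> h != e -> a h = 1%N -> F h = 0.
  move=> ha he ah; rewrite /F minc_mdec 1?eq_sym //; apply: u1.
    rewrite msup_minc msup_mdec1 // (setUidPr _) ?sub1set ?inE ?(eq_sym e) ?he //.
      by rewrite -sa (cardsD1 h (msup a)) ha.
    by move: ea; rewrite inE => ->.
  by apply/existsP; exists e; rewrite !ffunE eqxx (eq_sym e) (negPf he); move: ea; rewrite inE; lia.
(* The monomial [minc a e] contains the square of a variable over [e], so [kD u] vanishes there. *)
have H : ann e (u a p) + \sum_(h in msup a | h != e) ann h (F h) = 0.
  have := us (minc a e) p; rewrite kDE supE // ca (bigD1 e) //= mincK; apply.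
  by apply/existsP; exists e; rewrite ffunE eqxx; move: ea; rewrite inE; lia.
have w1 h : h \in msup a -> a h = 1%N -> w (mdec a h) p = 0.
  move=> ha ah; rewrite /w ifF // msup_mdec1 //; apply/negbTE; rewrite !negb_and -orbA; apply/orP; left.
  by apply/eqP; rewrite -sa (cardsD1 h (msup a)) ha; lia.
have w2 h : (1 < a h)%N -> w (mdec a h) p = crev c (u (minc (mdec a h) e) p).
  by move=> ah; rewrite /w msup_mdec // sa eqxx ea ca.
(* The cycle [c] has coordinate zero at the other edges of the support, so contraction with them
   passes through multiplication by [c]. *)
have kw : \sum_(h in msup a | h != e) ann h (w (mdec a h) p) = crev c (ann e (u a p)).
  have -> : ann e (u a p) = - \sum_(h in msup a | h != e) ann h (F h).
    by apply/eqP; rewrite -addr_eq0 H.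
  rewrite (raddfN (crev c)) (raddf_sum (crev c)) -sumrN; apply: eq_bigr => h /andP[ha he].
  have -> : w (mdec a h) p = crev c (F h).
    have [ah|ah] := eqVneq (a h) 1%N; first by rewrite w1 // F0 // raddf0.
    rewrite w2 /F ?minc_mdec 1?eq_sym //.
    by move: ha; rewrite inE; lia.
  by rewrite ann_crev g0 // mulr0z sub0r.
have kwE : kD w a p = ann e (w (mdec a e) p) + crev c (ann e (u a p)).
  by rewrite kDE ca (bigD1 e) //= kw.
rewrite -[X in _ -> _ -> X = 0]/(u a p - kD w a p) kwE.
have [ae|ae] := ltnP 1 (a e).
  rewrite w2 // mdecK; last by apply: ltnW.
  by rewrite ann_crev ge1 mulr1z subrK subrr.
have ae1 : a e = 1%N by move: ea; rewrite inE; lia.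
rewrite w1 // raddf0 add0r inE => /orP[/eqP -> |fl af]; first by rewrite ltnNge ae.
by rewrite (u2 a p f sa fl af) !raddf0 subr0.
Qed.

(** Induction on the size of the support and, for each size, over the edges: a monomial that is not
    square-free has exponent at least 2 at some edge. *)
Lemma koszul_square_free u : mono_cochain u -> square_free (kD u) ->
  exists2 w, mono_cochain w & square_free (u - kD w).
Proof.
move=> uc us.
suff H s : exists2 w, mono_cochain w & forall a p, (#|msup a| < s)%N -> nonsq a -> (u - kD w) a p = 0.
  have [w wc wP] := H #|E|.+1; exists w => // a p; apply: wP.
  by rewrite ltnS max_card.
elim: s => [|s [w wc wP]].
  by exists 0 => //; exact: mono_cochain0.
have [w' wc' [wP1 wP2]] : exists2 w', mono_cochain w' &
   (forall a p, (#|msup a| < s)%N -> nonsq a -> (u - kD w') a p = 0) /\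
   (forall a p f, #|msup a| = s -> f \in enum E -> (1 < a f)%N -> (u - kD w') a p = 0).
  elim: (enum E) => [|e l [w1 wc1 [wP1 wP2]]]; first by exists w.
  have uc1 : mono_cochain (u - kD w1) := mono_cochainB uc (mono_cochain_kD wc1).
  have us1 : square_free (kD (u - kD w1)) by rewrite kDB kD_sq subr0.
  have [w2 [wc2 wP3 wP4]] := @koszul_step s l e _ uc1 us1 wP1 wP2.
  exists (w1 + w2); first exact: mono_cochainD.
  by rewrite kDD opprD addrA.
exists w' => // a p; rewrite ltnS leq_eqVlt => /orP[/eqP sa|sa] na; last exact: wP1.
have /existsP[f af] := na; apply: (wP2 a p f) => //; exact: mem_enum.
Qed.

(** For [e] in the support, [kD u] at [minc a e] reduces to [ann e (u a p)], the other terms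
    involving monomials with a square. *)
Lemma square_free_inO u a p : square_free u -> square_free (kD u) -> mono_cochain u ->
  ~~ nonsq a -> inO (msup a) (u a p).
Proof.
move=> us uds uc na; split=> [e ea|v]; last by have [_] := mc_in uc a p.
have [ca|nca] := boolP (conn (msup a)); last first.
  suff -> : u a p = 0 by rewrite raddf0.
  apply/funext => C; have [//|/(mc_deg uc)/andP[ca _]] := eqVneq (u a p C) 0.
  by rewrite ca in nca.
have supE : msup (minc a e) = msup a.
  by rewrite msup_minc; apply/setUidPr; rewrite sub1set.
have := uds (minc a e) p; rewrite kDE supE ca (bigD1 e) //= mincK big1 ?addr0 => [|f /andP[fa fe]].
  by apply; apply/existsP; exists e; rewrite ffunE eqxx; move: ea; rewrite inE; lia.
rewrite us ?raddf0 //; apply/existsP; exists e; rewrite !ffunE eqxx (eq_sym e) (negPf fe).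
by move: ea; rewrite inE; lia.
Qed.
End MonomialKoszul.

(** * Monomials by exponents and indices *)

Section Monomials.
Variables (G : graph) (v0 : vertex G).
Hypothesis G_connected : connected G.
Local Notation E := (edge G).
Local Notation X := {ffun E -> int}.
Local Notation Om := ({set E} -> int).
Local Notation N := {ffun E -> nat}.
Implicit Types (a : N) (e f : E) (S C : {set E}) (p : X) (m : permon G).

(** The product over [e] of the variable with index [p e] to the power [a e]. Since each edge occurs
    with at most one index in a periodic face, all relevant monomials have this form, see
    [per_faceP]. *)
Definition mono a p : permon G :=
  [cmonom (if v.1 == p v.2 then a v.2 else 0%N) | v in [fset (p e, e) | e in E]%fset]%M.

Lemma monoE a p v : mono a p v = if v.1 == p v.2 then a v.2 else 0%N.
Proof.
rewrite cmE fsfun_fun; case: ifP => // /negbT nv; case: eqP => // vp.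
by case/negP: nv; apply/imfsetP; exists v.2 => //=; rewrite -vp; case: v {vp}.
Qed.

Lemma mem_mono a p v : (v \in finsupp (mono a p)) = (v.1 == p v.2) && (0 < a v.2)%N.
Proof. by rewrite -cmE_neq0 monoE lt0n; case: ifP. Qed.

Lemma finsupp_mono a p : finsupp (mono a p) = [fset (p e, e) | e in msup a]%fset.
Proof.
apply/fsetP => v; rewrite mem_mono; apply/andP/imfsetP => [[/eqP vp av]|[e /= ea ->]] /=.
  by exists v.2; rewrite /= ?inE // -vp; case: v {vp av}.
by move: ea; rewrite inE eqxx.
Qed.

Lemma sum_mono (M : nmodType) (F : int * E -> M) a p :
  \sum_(v <- finsupp (mono a p)) F v = \sum_(e in msup a) F (p e, e).
Proof.
rewrite finsupp_mono big_imfset; last by move=> e f _ _ [].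
rewrite (big_uniq _ (enum_finmem_uniq _)); apply: eq_bigl => e; exact: enum_finmemE.
Qed.

Definition expo m : N := [ffun e => (\sum_(v <- finsupp m) if v.2 == e then m v else 0)%N].
Definition posi m : X := [ffun e => \sum_(v <- finsupp m) if v.2 == e then v.1 else 0].

Lemma expo_mono a p : expo (mono a p) = a.
Proof.
apply/ffunP => e; rewrite ffunE (@sum_mono nat) /=.
under eq_bigr => f _ do rewrite monoE /= eqxx.
rewrite big_mkcond (bigD1 e) //= eqxx big1 => [|f /negPf->]; last by rewrite if_same.
by rewrite inE addr0; case: (a e).
Qed.

Lemma posi_mono a p e : (0 < a e)%N -> posi (mono a p) e = p e.
Proof.
move=> ae; rewrite ffunE sum_mono /= (bigD1 e) ?inE //= eqxx big1 ?addr0 // => f /andP[_ /negPf->] //.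
Qed.

Lemma mdeg_mono a p : mdeg (mono a p) = msize a.
Proof.
rewrite mdegE (@sum_mono nat) /msize [RHS](bigID (fun e => e \in msup a)) /=.
rewrite [X in _ = (_ + X)%N]big1 ?addn0 => [|e]; last by rewrite inE lt0n negbK => /eqP.
by apply: eq_bigr => e _; rewrite monoE /= eqxx.
Qed.

Lemma mono_eq a (p q : X) : (forall e, (0 < a e)%N -> p e = q e) -> mono a p = mono a q.
Proof.
move=> pq; apply/eqP/cmP => v; rewrite !monoE.
by have [->|/pq ->] := posnP (a v.2); rewrite ?if_same.
Qed.

Lemma div_mono a p e : (0 < a e)%N -> divcm (mono a p) (ucm (p e, e)) = mono (mdec a e) p.
Proof.
move=> ae; apply/eqP/cmP => -[i f]; rewrite divcmE ucmE !monoE /= ffunE xpair_eqE.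
case: (f =P e) => [->|/eqP fe].
  by rewrite eqxx andbT eq_sym; case: eqP; rewrite ?subn0.
by rewrite [e == f]eq_sym (negPf fe) andbF !subn0.
Qed.

Lemma translate_mono c a p : translate (- c) (mono a p) = mono a (p + ker_val c).
Proof.
apply/eqP/cmP => -[i e]; rewrite translateE !monoE /= raddfN /= ffunE /pairing.
by rewrite subr_eq.
Qed.

Lemma per_face_mono a p : conn (msup a) -> per_face (mono a p).
Proof.
move=> ca; exists #|msup a|, (msup a), p; split; first by rewrite facesE // eqxx.
by move=> i e; rewrite mem_mono /= inE andbC.
Qed.

Lemma per_faceP m : per_face m -> m = mono (expo m) (posi m) /\ conn (msup (expo m)).
Proof.
move=> [q [S [I [SF mE]]]].
pose a : N := [ffun e => m (I e, e)]; pose p : X := [ffun e => I e].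
have SE : msup a = S.
  by apply/setP => e; rewrite inE ffunE lt0n cmE_neq0 mE eqxx andbT.
have mono_m : m = mono a p.
  apply/eqP/cmP => -[i e]; rewrite monoE /= !ffunE; case: eqP => [->//|/eqP iI].
  by apply/eqP; rewrite -[_ == _]negbK cmE_neq0 mE (negPf iI) andbF.
rewrite mono_m expo_mono SE; split.
  by apply: mono_eq => e ae; rewrite posi_mono.
by move: SF; rewrite facesE // => /andP[].
Qed.

Lemma per_index_mono (j : int) a p : per_index j (mono a p) = ((msize a)%:Z == j) && conn (msup a).
Proof.
rewrite /per_index mdeg_mono; congr (_ && _); apply/asboolP/idP => [/per_faceP[_]|].
  by rewrite expo_mono.
exact: per_face_mono.
Qed.

Lemma SR_ext (j : int) (f g : SRper G j) :
  (forall a p, conn (msup a) -> (msize a)%:Z = j -> SRcoef f (mono a p) = SRcoef g (mono a p)) -> f = g.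
Proof.
move=> fg; apply/funext => m; have /andP[mj /asboolP/per_faceP[mE cm]] := valP m.
have := fg (expo (val m)) (posi (val m)) cm; rewrite -mE /SRcoef valK /=; apply.
have md : mdeg (val m : permon G) = msize (expo (val m)) by rewrite {1}mE mdeg_mono.
by rewrite -md; exact/eqP.
Qed.

Definition toSR (j : int) (u : N -> X -> int) : SRper G j := fun x => u (expo (val x)) (posi (val x)).
Arguments toSR j u _ : clear implicits.

Definition position_inv (T : Type) (u : N -> X -> T) :=
  forall a e p, a e = 0%N -> u a (p + delt e) = u a p.

Lemma position_ext (T : Type) (u : N -> X -> T) a (p q : X) : position_inv u ->
  (forall e, (0 < a e)%N -> p e = q e) -> u a p = u a q.
Proof.
move=> uI pq; have H (l : seq E) x : u a (x + \sum_(e <- l) delt e *~ (q e - p e)) = u a x.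
  elim: l x => [|e l IH] x; first by rewrite big_nil addr0.
  rewrite big_cons addrA IH; have [ae|/pq ->] := posnP (a e); last by rewrite subrr mulr0z addr0.
  by apply: (inv_translate (h := u a)) => y; exact: uI.
rewrite -(H (index_enum E) p); congr (u a _); apply/ffunP => e.
rewrite [LHS]ffunE sum_ffunE (bigD1 e) //= ffun_mulrz ffunE eqxx intz big1 ?addr0.
  by rewrite addrC subrK.
by move=> f /negPf fe; rewrite ffun_mulrz ffunE eq_sym fe mul0rz.
Qed.

Lemma SRcoef_toSR (j : int) u a p : position_inv u ->
  SRcoef (toSR j u) (mono a p) = if conn (msup a) && ((msize a)%:Z == j) then u a p else 0.
Proof.
move=> uI; rewrite /SRcoef andbC -(per_index_mono _ _ p); case: insubP => [m -> mE|/negPf ->] //=.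
by rewrite /toSR mE expo_mono; apply: position_ext => // e ae; rewrite posi_mono.
Qed.

Lemma SRcoef_inv (j : int) (f : SRper G j) : position_inv (fun a p => SRcoef f (mono a p)).
Proof.
move=> a e p ae; congr (SRcoef f _); apply: mono_eq => g ag; rewrite !ffunE.
by case: eqP => [ge|_]; rewrite ?addr0 //; rewrite ge ae in ag.
Qed.

Lemma SRcoef_neq0 (j : int) (f : SRper G j) a p : SRcoef f (mono a p) != 0 ->
  conn (msup a) && ((msize a)%:Z == j).
Proof.
rewrite /SRcoef; case: insubP => [m mj _ _|_]; last by rewrite eqxx.
by move: mj; rewrite per_index_mono andbC.
Qed.

Lemma SRcoef_mulH1 (j : int) (f : SRper G (j - 1)) c a p :
  conn (msup a) -> (msize a)%:Z = j ->
  SRcoef (mulH1 f c) (mono a p) = \sum_(e in msup a) pairing e c * SRcoef f (mono (mdec a e) p).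
Proof.
move=> ca aj; have ij : per_index j (mono a p) by rewrite per_index_mono aj eqxx.
rewrite {1}/SRcoef (insubT _ ij) /= /mulH1 /= sum_mono /=.
by apply: eq_bigr => e; rewrite inE => ae; rewrite div_mono.
Qed.
End Monomials.

Lemma tensor_ind (A B : zmodType) (P : tensor A B -> Prop) : (forall a b, P (tens a b)) ->
  P 0 -> (forall x y, P x -> P y -> P (x - y)) -> forall t, P t.
Proof.
move=> Pt P0 PB t.
have PD x y : P x -> P y -> P (x + y).
  by move=> Px Py; rewrite -[y]opprK; apply: (PB) => //; rewrite -sub0r; exact: PB.
have PM x n : P x -> P (x *~ n).
  move=> Px; elim/int_rect: n => [|n IH|n IH]; first by rewrite mulr0z.
    by rewrite -addn1 PoszD mulrzDr; exact: PD.
  by rewrite -addn1 PoszD opprD mulrzDr mulrN1z; exact: PB.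
have [u <-] := cls_surj t; rewrite (monalgEw (fsubset_refl (msupp u))) raddf_sum.
elim/big_ind: _ => //= ab _; rewrite -[mcoeff ab u]intz !raddfMz; apply: PM.
by case: ab => a b; exact: Pt.
Qed.

(** * The relations of R_per as Koszul boundaries *)

Section PeriodicImage.
Variables (G : graph) (v0 : vertex G) (k : nat).
Hypothesis G_connected : connected G.
Local Notation E := (edge G).
Local Notation X := {ffun E -> int}.
Local Notation Om := ({set E} -> int).
Local Notation N := {ffun E -> nat}.
Let c0 : conn (set0 : {set E}) := connected_conn0 G_connected.

Definition cycle_coord (e : E) : H1 G :=
  insubd 0 (retr v0 set0 (delt e)).

Lemma cycle_coordE e : ker_val (cycle_coord e) = retr v0 set0 (delt e).
Proof.
apply: insubdK; rewrite unfold_in; apply/eqP.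
by have [] := retrP v0 (delt e) c0.
Qed.

(** The degree one part of [w] is a cycle, hence fixed by the retraction. *)
Lemma inO_coord (w : Om) f : inO set0 w -> \sum_e retr v0 set0 (delt e) f * w [set e] = w [set f].
Proof.
move=> [_ wv]; pose x : X := [ffun e => w [set e]].
have bx : boundary x = 0.
  apply/ffunP => v; rewrite boundaryE [RHS]ffunE.
  have := congr1 (fun u : Om => u set0) (wv v); rewrite /annv fct_sumE => H.
  apply: etrans H; apply: eq_bigr => e _.
  rewrite fct_mulrz /ann inE setU0 ffunE mulrzz; congr (_ * _).
  rewrite /sg /before (_ : [set c in set0 | _] = set0) ?cards0 ?expr0 ?mulr1z //.
  by apply/setP => y; rewrite !inE.
have rx : retr v0 set0 x = x by rewrite retr_id // => e; rewrite inE.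
transitivity (retr v0 set0 x f); last by rewrite rx ffunE.
rewrite -(sum_delt (retr v0 set0) x) sum_ffunE; apply: eq_bigr => e _.
by rewrite ffunX_mulrz mulrzz ffunE.
Qed.

Lemma ann_set0 e (w : Om) : ann e w set0 = w [set e].
Proof.
rewrite /ann inE setU0 /sg /before (_ : [set c in set0 | _] = set0) ?cards0 ?expr0 ?mulr1z //.
by apply/setP => y; rewrite !inE.
Qed.

(** Only the part of [u] of multivector degree one matters at [set0]; it is the sum of its
    coordinates tensored with the cycles [cycle_coord e]. *)
Lemma kD_image (u : N -> X -> Om) : mono_cochain k u ->
  exists t, mulH1_tensor G k t = @toSR G k (fun a p => kD u a p set0).
Proof.
move=> uc; pose ue e := @toSR G (k%:Z - 1) (fun a p => u a p [set e]).
exists (\sum_e tens (ue e) (cycle_coord e)).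
have uI : position_inv (fun a p => kD u a p set0).
  by move=> a e p ae; rewrite (mc_inv (mono_cochain_kD uc)).
have ueI e : position_inv (fun a p => u a p [set e]) by move=> a f p af; rewrite (mc_inv uc).
apply: (SR_ext G_connected) => a p ca [ak]; rewrite SRcoef_toSR // ca ak eqxx /=.
rewrite raddf_sum.
have scB : zmod_morphism (fun f : SRper G k => SRcoef f (mono a p)) by move=> f g; rewrite SRcoefB.
pose sc : {additive SRper G k -> int} := HB.pack (fun f : SRper G k => SRcoef f (mono a p))
  (GRing.isZmodMorphism.Build (SRper G k) int _ scB).
rewrite -[LHS]/(sc _) raddf_sum.
transitivity (\sum_e \sum_(f in msup a) retr v0 set0 (delt e) f * u (mdec a f) p [set e]).
  apply: eq_bigr => e _; rewrite -[LHS]/(SRcoef _ (mono a p)) mulH1_tensorE SRcoef_mulH1 ?ak //.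
  apply: eq_bigr => f fa; rewrite /pairing cycle_coordE; congr (_ * _).
  rewrite SRcoef_toSR // (conn_mono (msup_mdec_sub _ _) ca).
  move: fa; rewrite inE => /msize_mdec; rewrite ak => <-.
  by rewrite -addn1 PoszD addrK eqxx.
rewrite exchange_big kDE ca fct_sumE; apply: eq_bigr => f _.
by rewrite ann_set0 -inO_coord //; exact: (mc_in uc).
Qed.

(** A pure tensor corresponds to the Koszul chain obtained by multiplying the coefficients of [f] by
    the cycle [c]. *)
Lemma image_kD (t : tensor (SRper G (k%:Z - 1)) (H1 G)) : exists u : N -> X -> Om,
  [/\ mono_cochain k u, (forall a p C, u a p C != 0 -> #|C| = 1%N) &
      mulH1_tensor G k t = @toSR G k (fun a p => kD u a p set0)].
Proof.
move: t; apply: tensor_ind => [f c||t t' [u [uc u1 uE]] [u' [uc' u1' uE']]].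
- pose u : N -> X -> Om := fun a p => crev (ker_val c) (vac (SRcoef f (mono a p))).
  have bc : boundary (ker_val c) = 0 by apply/eqP; case: (c).
  have vacn0 (n : int) (C : {set E}) : vac n C != 0 -> C = set0 /\ n != 0.
    by rewrite /vac; case: (C =P set0) => [->|_]; rewrite ?eqxx.
  have u1 a p C : u a p C != 0 -> #|C| = 1%N /\ SRcoef f (mono a p) != 0.
    move=> /crev_neq0[e eC /vacn0[C0 n0]]; split=> //.
    by rewrite (cardsD1 e) eC C0 cards0.
  have uc : mono_cochain k u.
    split=> [a p|a p C /u1[C1 /SRcoef_neq0]|a e p ae].
    - apply: inO_crev => // [e|]; first by rewrite inE.
      by split=> [e _|v]; [exact: ann_vac|rewrite /annv big1 // => e _; rewrite ann_vac mul0rz].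
    - move=> /(_ G_connected)/andP[-> /eqP ak]; rewrite C1; apply/eqP; lia.
    - by rewrite /u (SRcoef_inv f p ae).
  exists u; split=> // [a p C /u1[]//|].
  have uI : position_inv (fun a p => kD u a p set0).
    by move=> a e p ae; rewrite (mc_inv (mono_cochain_kD uc)).
  apply: (SR_ext G_connected) => a p ca [ak]; rewrite SRcoef_toSR // ca ak eqxx /=.
  rewrite mulH1_tensorE SRcoef_mulH1 ?ak // kDE ca fct_sumE; apply: eq_bigr => e _.
  by rewrite /u ann_crev ann_vac raddf0 subr0 fct_mulrz /vac eqxx mulrzz mulrC.
- exists 0; split=> [|//|]; first exact: mono_cochain0.
  by rewrite raddf0 kD0.
exists (u - u'); split; first exact: mono_cochainB.
  move=> a p C; rewrite -[(u - u') a p C]/(u a p C - u' a p C) => n0.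
  have [u0|/u1 //] := eqVneq (u a p C) 0; apply: (u1' a p).
  by move: n0; rewrite u0 sub0r oppr_eq0.
by rewrite raddfB /= uE uE' kDB.
Qed.
End PeriodicImage.

Lemma span_closed (A : zmodType) (R : A -> Prop) x : R 0 -> (forall x y, R x -> R y -> R (x - y)) ->
  x \in span R -> R x.
Proof.
move=> R0 RB /asboolP xP.
pose K : {pred A} := fun x => `[< R x >].
have Kz : zmod_closed K.
  split; first exact/asboolP.
  by move=> u v /asboolP Ru /asboolP Rv; apply/asboolP; exact: RB.
pose Kc := GRing.isZmodClosed.Build A K Kz.
pose KP : zmodClosed A := HB.pack K Kc.
by have := xP KP; move=> H; apply/asboolP; apply: H => r Rr; apply/asboolP.
Qed.

(** * R_per as the top cohomology of the face complex *)

Section SquareFree.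
Variables (G : graph) (v0 : vertex G) (k : nat).
Hypothesis G_connected : connected G.
Local Notation E := (edge G).
Local Notation X := {ffun E -> int}.
Local Notation Om := ({set E} -> int).
Local Notation N := {ffun E -> nat}.
Local Notation W := (X -> ({set E} -> {set E} -> Om)).
Local Notation D := (total_diff v0).

Definition char (S : {set E}) : N := [ffun e => (e \in S) : nat].

Lemma msup_char S : msup (char S) = S.
Proof. by apply/setP => e; rewrite inE ffunE lt0b. Qed.

Lemma nonsq_char (S : {set E}) : nonsq (char S) = false.
Proof. by apply/negbTE; rewrite negb_exists; apply/forallP => e; rewrite ffunE -leqNgt leq_b1. Qed.

Lemma char_msup (a : N) : ~~ nonsq a -> char (msup a) = a.
Proof.
rewrite negb_exists => /forallP na; apply/ffunP => e; rewrite ffunE inE.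
by have := na e; case: (a e) => [|[]].
Qed.

Lemma msize_char (S : {set E}) : msize (char S) = #|S|.
Proof.
rewrite /msize -sum1_card [RHS]big_mkcond; apply: eq_bigr => e _.
by rewrite ffunE; case: (e \in S).
Qed.

Lemma mdec_char (S : {set E}) e : e \in S -> mdec (char S) e = char (S :\ e).
Proof.
move=> eS; apply/ffunP => f; rewrite !ffunE !inE.
by case: eqP => [->|_]; rewrite ?eS ?subn0.
Qed.

Definition mono_of (b : W) : N -> X -> Om := fun a p => if nonsq a then 0 else b p (msup a) set0.

(** The component at A empty is read as a combination of square-free monomials. *)
Definition sq (b : W) : SRper G k := @toSR G k (fun a p => mono_of b a p set0).

Lemma sqB b b' : sq (b - b') = sq b - sq b'.
Proof.
apply/funext => x; rewrite -[RHS]/(sq b x - sq b' x) /sq /toSR /mono_of.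
by case: ifP => _; rewrite ?subr0.
Qed.

Definition face_inv (b : W) := forall p (S : {set E}) e, e \notin S -> b (p + delt e) S set0 = b p S set0.

Lemma face_inv_pos b : face_inv b -> position_inv (fun a p => mono_of b a p set0).
Proof. by move=> bI a e p ae; rewrite /mono_of bI // inE ae. Qed.

Lemma face_inv_noA b : noA b -> noA (D b) -> face_inv b.
Proof. by move=> bA dbA p S e eS; exact: (noA_inv p bA dbA eS). Qed.

Lemma mono_of_cochain n b : homog k n b -> face_inv b -> mono_cochain k (mono_of b).
Proof.
move=> bd bI; split=> [a p|a p C|a e p ae]; rewrite /mono_of.
- case: ifP => _; first exact: inO0.
  exact: inO_sub (sub0set _) (proj1 (bd p _ _)).
- case: ifPn => // na /(proj2 (bd p _ _))/and4P[-> _ _].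
  by rewrite -{2}(char_msup na) msize_char.
- by rewrite bI // inE ae.
Qed.

Lemma homog_supp w p (S C : {set E}) : homog k k%:Z w -> w p S set0 C != 0 ->
  [/\ conn S, #|S| = k & C = set0].
Proof.
move=> wd /(proj2 (wd p S set0))/and4P[cS _ /eqP]; rewrite cards0 => Sk /eqP Ck.
by split=> //; [lia|apply/eqP; rewrite -cards_eq0; lia].
Qed.

(** On square-free monomials [kD] is the face differential. At a monomial with a square it vanishes
    here, since a square-free quotient has the same support and [y] is killed there by contraction
    with the edge removed. *)
Lemma sq_diff n y : homog k n y -> noA y -> noA (D y) -> exists t, sq (D y) = mulH1_tensor G k t.
Proof.
move=> yd yA dyA; have yI := face_inv_noA yA dyA.
have yc := mono_of_cochain yd yI.
have [t tE] := kD_image v0 G_connected yc; exists t; rewrite tE.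
have dyI : face_inv (D y).
  by apply: face_inv_noA => //; rewrite total_diff_sq.
apply: (SR_ext G_connected) => a p ca [ak].
rewrite !SRcoef_toSR ?ca ?ak ?eqxx //=; try exact: face_inv_pos.
  2: by move=> b e q be; rewrite (mc_inv (mono_cochain_kD yc)).
rewrite {1}/mono_of kDE ca; case: ifPn => na; last first.
  rewrite total_diff_face; apply: (congr1 (fun w : Om => w set0)); apply: eq_bigr => e ea.
  by rewrite /mono_of -(char_msup na) msup_char mdec_char // nonsq_char msup_char.
rewrite big1 // => e ea; rewrite /mono_of; case: ifPn => nd; first by rewrite raddf0.
have ae : (1 < a e)%N.
  have /existsP[f af] := na; have [fe|fe] := eqVneq f e; first by rewrite -fe.
  case/negP: nd; apply/existsP; exists f; by rewrite ffunE (negPf fe) subn0.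
by rewrite msup_mdec // (proj1 (proj1 (yd p (msup a) set0))).
Qed.

(** A relation is a Koszul boundary by [image_kD]; being square-free, it is the boundary of a
    square-free chain, whose values are multivectors avoiding the face by [square_free_inO]. *)
Lemma sq_boundary b t : homog k k%:Z b -> noA b -> face_inv b -> sq b = mulH1_tensor G k t ->
  exists2 y, homog k (k%:Z - 1) y & D y = b.
Proof.
move=> bd bA bI; have [u [uc u1 ->]] := image_kD G_connected t => sE.
have kI : position_inv (fun a p => kD u a p set0).
  by move=> a e q ae; rewrite (mc_inv (mono_cochain_kD uc)).
have kC a p C : kD u a p C != 0 -> C = set0.
  rewrite kDE; case: ifP => // _; rewrite fct_sumE => n0.
  have [e /andP[ea en0]|H0] := pickP (fun e => (e \in msup a) && (ann e (u (mdec a e) p) C != 0)); last first.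
    by case/eqP: n0; apply: big1 => e ea; have := H0 e; rewrite ea => /negbFE/eqP.
  have [eC /u1] := ann_neq0 en0; rewrite cardsU1 eC => Ck.
  by apply/eqP; rewrite -cards_eq0; lia.
have kE a p : conn (msup a) -> msize a = k -> kD u a p set0 = mono_of b a p set0.
  move=> ca ak; have := congr1 (fun f => SRcoef f (mono a p)) sE.
  rewrite !SRcoef_toSR ?ca ?ak ?eqxx //=; exact: face_inv_pos.
have us : square_free (kD u).
  move=> a p na; apply/funext => C; have [//|n0] := eqVneq (kD u a p C) 0.
  have C0 := kC _ _ _ n0; move: n0; rewrite C0 => n0.
  have := mc_deg (mono_cochain_kD uc) n0; rewrite cards0 add0n => /andP[ca /eqP ak].
  by rewrite kE // /mono_of na.
have [w wc ws] := koszul_square_free uc us.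
pose u' := u - kD w; have uc' : mono_cochain k u' := mono_cochainB uc (mono_cochain_kD wc).
have ku' : kD u' = kD u by rewrite /u' kDB kD_sq subr0.
(* Only faces with [k - 1] edges contribute to [D y] in degree [k]. *)
pose y : W := fun p S A => if (A == set0) && (#|S|.+1 == k)%N then u' (char S) p else 0.
have yd : homog k (k%:Z - 1) y.
  move=> p S A; rewrite /y; case: ifPn => [/andP[/eqP-> /eqP Sk]|_]; last by split; [exact: inO0|].
  split.
    rewrite -{1}(msup_char S); apply: (square_free_inO (k := k)) => //; rewrite ?ku' //.
    by rewrite nonsq_char.
  move=> C /(mc_deg uc'); rewrite msup_char msize_char => /andP[-> ->].
  by rewrite disjoint_sym -setI_eq0 setI0 eqxx cards0 /= andbT; apply/eqP; lia.
have yA : noA y by move=> p S A /negPf A0; rewrite /y A0.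
have dyA : noA (D y).
  apply: noA_diff => // p S e eS; rewrite /y; case: ifP => // _.
  by rewrite (mc_inv uc') // ffunE (negPf eS).
exists y => //; have dyd := homog_diff v0 yd.
apply/funext => p; apply/funext => S; apply/funext => A.
have [->|A0] := eqVneq A set0; last by rewrite dyA // bA.
apply/funext => C; have [P|nP] := boolP [&& conn S, #|S| == k & C == set0]; last first.
  have z0 w' : homog k k%:Z w' -> w' p S set0 C = 0.
    move=> wd'; have [//|/(homog_supp wd')[cS Sk C0]] := eqVneq (w' p S set0 C) 0.
    by rewrite cS Sk C0 !eqxx in nP.
  by rewrite !z0.
move: P => /and3P[cS /eqP Sk /eqP ->].
have := kE (char S) p; rewrite msup_char msize_char /mono_of nonsq_char msup_char => <- //.
rewrite -ku' kDE msup_char cS total_diff_face; apply: (congr1 (fun w : Om => w set0)).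
apply: eq_bigr => e eS; rewrite /y eqxx mdec_char // ifT //=.
by rewrite -Sk (cardsD1 e S) eS.
Qed.

(** Every element of SR_per is a Koszul cycle of multivector degree zero, so [koszul_square_free]
    makes it square-free modulo relations. *)
Lemma sq_onto f : exists b, [/\ homog k k%:Z b, noA b, D b = 0 & exists t, f - sq b = mulH1_tensor G k t].
Proof.
pose u : N -> X -> Om := fun a p => vac (SRcoef f (mono a p)).
have uc : mono_cochain k u.
  split=> [a p|a p C|a e p ae].
  - by split=> [e _|v]; [exact: ann_vac|rewrite /annv big1 // => e _; rewrite ann_vac mul0rz].
  - rewrite /u /vac; case: (C =P set0) => [->|_]; last by rewrite eqxx.
    by move=> /(SRcoef_neq0 G_connected)/andP[-> /eqP ak]; rewrite cards0; apply/eqP; lia.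
  - by rewrite /u (SRcoef_inv f p ae).
have ku : kD u = 0.
  apply/funext => a; apply/funext => p; rewrite kDE; case: ifP => // _.
  by apply: big1 => e _; exact: ann_vac.
have [w wc ws] : exists2 w, mono_cochain k w & square_free (u - kD w).
  by apply: koszul_square_free => //; rewrite ku.
pose u' := u - kD w; have uc' : mono_cochain k u' := mono_cochainB uc (mono_cochain_kD wc).
have ku' : kD u' = 0 by rewrite /u' kDB kD_sq ku subr0.
pose b : W := fun p S A => if (A == set0) && (#|S| == k)%N then u' (char S) p else 0.
have bd : homog k k%:Z b.
  move=> p S A; rewrite /b; case: ifPn => [/andP[/eqP-> /eqP Sk]|_]; last by split; [exact: inO0|].
  split.
    rewrite -{1}(msup_char S); apply: (square_free_inO (k := k)) => //; rewrite ?ku' //.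
    by rewrite nonsq_char.
  move=> C /(mc_deg uc'); rewrite msup_char msize_char => /andP[-> ->].
  by rewrite disjoint_sym -setI_eq0 setI0 eqxx cards0 /= andbT; apply/eqP; lia.
have bA : noA b by move=> p S A /negPf A0; rewrite /b A0.
have bI : face_inv b.
  move=> p S e eS; rewrite /b; case: ifP => // _.
  by rewrite (mc_inv uc') // ffunE (negPf eS).
have dbA : noA (D b) by exact: noA_diff.
exists b; split=> //.
  apply/funext => p; apply/funext => S; apply/funext => A; apply/funext => C.
  have [->|A0] := eqVneq A set0; last by rewrite dbA.
  have [//|/(proj2 (total_diff_deg v0 bd p S set0))] := eqVneq (D b p S set0 C) 0.
  by rewrite cards0 => /and4P[_ _ /eqP H1 /eqP H2]; lia.
have [t tE] := kD_image v0 G_connected wc; exists t; rewrite tE.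
apply: (SR_ext G_connected) => a p ca [ak].
rewrite SRcoefB !SRcoef_toSR ?ca ?ak ?eqxx //=; first last.
- by move=> c e q ce; rewrite (mc_inv (mono_cochain_kD wc)).
- exact: face_inv_pos.
have -> : mono_of b a p set0 = u' a p set0.
  rewrite /mono_of; case: ifPn => na; first by rewrite /u' ws.
  have sa : #|msup a| = k by rewrite -msize_char char_msup.
  by rewrite /b eqxx sa eqxx char_msup.
by rewrite -[u' a p set0]/(u a p set0 - kD w a p set0) /u /vac eqxx subKr.
Qed.
End SquareFree.

(** * Group cohomology of R_per through invariants of the double complex *)

Section PeriodicRelation.
Variables (G : graph) (v0 : vertex G) (k : nat).
Hypothesis G_connected : connected G.
Local Notation E := (edge G).
Local Notation X := {ffun E -> int}.
Local Notation Om := ({set E} -> int).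
Local Notation V := ({set E} -> {set E} -> Om).
Local Notation W := (X -> V).
Local Notation D := (total_diff v0).
Local Notation R := (Rper G k).

Definition cycle_chain (c : H1 G) : X := ker_val c.

Fact cycle_chain_additive : zmod_morphism cycle_chain.
Proof. by []. Qed.
HB.instance Definition _ := GRing.isZmodMorphism.Build (H1 G) X cycle_chain cycle_chain_additive.

Let c0 : conn (set0 : {set E}) := connected_conn0 G_connected.

Definition cycle_retr (x : X) : H1 G := insubd 0 (retr v0 set0 x).

Lemma cycle_retrE x : ker_val (cycle_retr x) = retr v0 set0 x.
Proof. by apply: insubdK; rewrite unfold_in; apply/eqP; have [] := retrP v0 x c0. Qed.

Lemma cycle_chain_boundary g : boundary (cycle_chain g) = 0.
Proof. by apply/eqP; case: g. Qed.

Lemma cycle_retrD x g : cycle_retr (x + cycle_chain g) = cycle_retr x + g.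
Proof.
apply: val_inj; rewrite /= !cycle_retrE raddfD /=; congr (_ + _).
by rewrite retr_id //; [exact: cycle_chain_boundary|move=> e; rewrite inE].
Qed.

Lemma invariant_cycle (z : W) : invariant cycle_chain z <-> cycle_inv z.
Proof.
split=> [H c p cb|H g]; last by apply/funext => p; exact: (H _ _ (cycle_chain_boundary g)).
have kc : c \in kernel (@boundary G) by rewrite unfold_in; apply/eqP.
by have := congr1 (fun w : W => w p) (H (Ker kc)).
Qed.

Definition Rcls : SRper G k -> R := cls _.
HB.instance Definition _ := GRing.Additive.copy Rcls (cls (fun x : SRper G k => exists t, x = mulH1_tensor G k t)).

Lemma Rcls_eq0 x : Rcls x = 0 <-> exists t, x = mulH1_tensor G k t.
Proof.
split=> [x0|[t ->]]; last by apply: cls_rel; exists t.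
apply: (@span_closed _ (fun x => exists t, x = mulH1_tensor G k t)).
- by exists 0; rewrite raddf0.
- by move=> y z [t ->] [t' ->]; exists (t - t'); rewrite raddfB.
rewrite -[x]subr0; apply/clsP; rewrite raddf0; exact: x0.
Qed.

(** The instance of [rho]: the class in R_per of what is left of [z] once its components with
    nonempty A are cleared. *)
Definition square_rel (z : W) (s : R) := [/\ homog k k%:Z z, D z = 0 &
  exists y, [/\ homog k (k%:Z - 1) y, noA (z - D y) & s = Rcls (@sq G k (z - D y))]].

Lemma square_rel_part z y : homog k k%:Z z -> D z = 0 -> homog k (k%:Z - 1) y ->
  homog k k%:Z (z - D y) /\ D (z - D y) = 0.
Proof.
move=> zd dz yd; split; first exact: homogB zd (homog_diff v0 yd).
by rewrite total_diffB total_diff_sq dz subr0.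
Qed.

Lemma noAB w w' : noA w -> noA w' -> noA (w - w' : W).
Proof. by move=> H H' p S A A0; rewrite -[LHS]/(w p S A - w' p S A) H // H' // subrr. Qed.

Lemma square_relB z s z' s' : square_rel z s -> square_rel z' s' -> square_rel (z - z') (s - s').
Proof.
move=> [zd dz [y [yd yA ->]]] [zd' dz' [y' [yd' yA' ->]]].
split; [exact: homogB|by rewrite total_diffB dz dz' subr0|].
have E1 : z - z' - D (y - y') = z - D y - (z' - D y') by rewrite total_diffB subrACA.
exists (y - y'); split; first exact: homogB.
  by rewrite E1; exact: noAB.
by rewrite E1 (sqB k (z - D y)) (raddfB Rcls).
Qed.

Lemma square_rel_tot z : homog k k%:Z z -> D z = 0 -> exists s, square_rel z s.
Proof.
move=> zd dz; have [y yd yA] : exists2 y, homog k (k%:Z - 1) y & noA (z - D y).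
  by apply: clear_noA => //; rewrite dz.
by exists (Rcls (@sq G k (z - D y))); split=> //; exists y.
Qed.

Lemma homog0 n : homog k n (0 : W).
Proof. by move=> p; exact: face_deg0. Qed.

Lemma square_rel_onto s : exists z, square_rel z s.
Proof.
have [f fs] := cls_surj s; have [b [bd bA db [t tE]]] := sq_onto v0 G_connected f.
exists b; split=> //; exists 0; split; first exact: homog0.
  by rewrite total_diff0 subr0.
rewrite total_diff0 subr0 -fs -[cls _ f]/(Rcls f); apply/eqP; rewrite -subr_eq0 -(raddfB Rcls); apply/eqP.
by apply/Rcls_eq0; exists t.
Qed.

Lemma SRact_sq g b : face_inv b -> SRact g (@sq G k b) = @sq G k (shift cycle_chain g b).
Proof.
move=> bI; have bI' : face_inv (shift cycle_chain g b).
  by move=> p S e eS; rewrite /shift addrAC bI.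
apply: (SR_ext G_connected) => a p ca [ak].
rewrite SRcoef_act translate_mono !SRcoef_toSR //; exact: face_inv_pos.
Qed.

Lemma total_diff_shift g w : D (shift cycle_chain g w) = shift cycle_chain g (D w).
Proof. exact: total_diff_translate. Qed.

Lemma square_rel_act g z s : square_rel z s -> square_rel (shift cycle_chain g z) (@Ract G k g s).
Proof.
move=> [zd dz [y [yd yA ->]]]; split; first by move=> p; exact: zd.
  by rewrite total_diff_shift dz.
have E1 : shift cycle_chain g z - D (shift cycle_chain g y) = shift cycle_chain g (z - D y).
  by rewrite total_diff_shift.
exists (shift cycle_chain g y); rewrite E1; split; first by move=> p; exact: yd.
  by move=> p S A A0; exact: yA.
have [bd db] := square_rel_part zd dz yd.
rewrite -SRact_sq; first exact: (qliftE (@SRact_rel G k g)).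
by apply: (face_inv_noA yA (v0 := v0)); rewrite db.
Qed.

Lemma square_rel_bnd z : square_rel z 0 -> exists2 y, homog k (k%:Z - 1) y & z = D y.
Proof.
move=> [zd dz [y [yd yA /esym/Rcls_eq0[t tE]]]].
have [bd db] := square_rel_part zd dz yd.
have bI : face_inv (z - D y) by apply: (face_inv_noA yA (v0 := v0)); rewrite db.
have [y' yd' yE] := sq_boundary v0 G_connected bd yA bI tE.
exists (y + y'); last by rewrite total_diffD yE addrC subrK.
by move=> p S; exact: col_degD (yd p S) (yd' p S).
Qed.

Lemma bnd_square_rel y : homog k (k%:Z - 1) y -> square_rel (D y) 0.
Proof.
move=> yd; split; [exact: homog_diff|exact: total_diff_sq|].
exists y; rewrite subrr; split=> //.
rewrite -[LHS](raddf0 Rcls); apply: (congr1 Rcls); apply/funext => x.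
by rewrite /sq /toSR /mono_of; case: ifP.
Qed.

(** [y] itself may have components with nonempty A. Since [D y] has none, [clear_noA] removes them
    without changing [D y], and [sq_diff] applies. *)
Lemma square_rel0 s : square_rel 0 s -> s = 0.
Proof.
move=> [_ _ [y [yd yA ->]]]; apply/Rcls_eq0.
have dyA : noA (D y).
  by move=> p S A A0; have := yA p S A A0; rewrite sub0r => /eqP; rewrite -[(- D y) p S A]/(- D y p S A) oppr_eq0 => /eqP.
have [y1 yd1 yA1] := clear_noA yd dyA.
have E1 : D (y - D y1) = D y by rewrite total_diffB total_diff_sq subr0.
have yd2 : homog k (k%:Z - 1) (y - D y1) by exact: homogB yd (homog_diff v0 yd1).
have [t tE] : exists t, @sq G k (D (y - D y1)) = mulH1_tensor G k t.
  by apply: (sq_diff G_connected yd2 yA1); rewrite E1.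
exists (- t); rewrite (raddfN (mulH1_tensor G k)) -tE E1 sqB.
have -> : @sq G k (0 : W) = 0 by apply/funext => x; rewrite /sq /toSR /mono_of; case: ifP.
by rewrite sub0r.
Qed.

(** The abstract comparison for the double complex, with H_1(G) translating positions by cycles; the
    retraction of chains onto cycles provides the acyclicity. *)
Lemma periodic_relation n : exists H : cochain (H1 G) R n -> W -> Prop,
 [/\ (forall c z c' z', H c z -> H c' z' -> H (c - c') (z - z')),
     (forall c z, H c z -> [/\ cochain_diff (@Ract G k) c = 0, homog k (n%:Z + k%:Z) z, D z = 0 & cycle_inv z]),
     (forall z, homog k (n%:Z + k%:Z) z -> D z = 0 -> cycle_inv z -> exists c, H c z),
     (forall c, cochain_diff (@Ract G k) c = 0 -> exists z, H c z) &
     (forall c z, H c z -> @coboundary (cochain_complex (@Ract G k)) n c <->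
        exists2 y, homog k (n%:Z + k%:Z - 1) y & cycle_inv y /\ z = D y)].
Proof.
pose i0 : {additive H1 G -> X} := cycle_chain.
pose d : {additive W -> W} := total_diff v0.
have ex m z : deg (face_deg k) m z -> d z = 0 -> m != k%:Z ->
  exists2 y, deg (face_deg k) (m - 1) y & z = d y := @total_exact G v0 k m z.
have dd m w : deg (face_deg k) m w -> deg (face_deg k) (m + 1) (d w) := @total_diff_deg G v0 k m w.
have rc z s : square_rel z s -> deg (face_deg k) k%:Z z /\ d z = 0 by case.
exists (hyper_rel i0 d (face_deg k) k%:Z square_rel (n := n)); split.
- move=> c z c' z'; exact: (hyper_relB (@face_degB G k) square_relB).
- move=> c z H; have [H1 H2 H3 H4] := hyper_rel_invariant (i0 := i0) cycle_retrD (@total_diff_sq G v0)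
    total_diff_shift (@face_deg0 G k) (@face_degB G k) dd square_relB square_rel_act bnd_square_rel square_rel0 H.
  by split=> //; apply/invariant_cycle.
- move=> z zd dz zI; have zI' : invariant i0 z by apply/invariant_cycle.
  exact: (hyper_rel_onto (i0 := i0) (d := d) cycle_retrD (@total_diff_sq G v0)
    total_diff_shift (@face_deg0 G k) (@face_degB G k) dd ex square_rel_tot zd dz zI').
- move=> c dc; exact: (hyper_rel_total (i0 := i0) (d := d) cycle_retrD (@total_diff_sq G v0)
    total_diff_shift (@face_deg0 G k) (@face_degB G k) (@face_deg_neg G k) dd ex rc square_relB
    square_rel_onto square_rel_act square_rel_bnd bnd_square_rel dc).
move=> c z H; have [H1 H2] := hyper_rel_coboundary (i0 := i0) (d := d) cycle_retrD (@total_diff_sq G v0)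
    total_diff_shift (@face_deg0 G k) (@face_degB G k) (@face_deg_neg G k) dd ex rc square_relB
    square_rel_tot square_rel_onto square_rel_act square_rel_bnd bnd_square_rel square_rel0 H.
split=> [/H1[y yd [yI yE]]|[y yd [yI yE]]].
  by exists y => //; split=> //; apply/invariant_cycle.
by apply: H2; exists y => //; split=> //; apply/invariant_cycle.
Qed.
End PeriodicRelation.

(** * Projection of invariant columns to exterior powers of H^1 *)

Section ThetaSupport.
Variables (G : graph) (v0 : vertex G) (S : {set edge G}).
Hypothesis cS : conn S.
Local Notation E := (edge G).
Local Notation X := {ffun E -> int}.

Lemma retr_delt_in e : e \in S -> retr v0 S (delt e) = 0.
Proof.
move=> eS.
have H (s : seq E) : e \in s -> elems [seq (delt f, delt f) | f <- s] (delt e) = 0.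
  have fixS (t : seq E) : e \notin t -> elems [seq (delt f, delt f) | f <- t] (delt e) = delt e.
    elim: t => //= f t IH; rewrite inE negb_or => /andP[ef et]; rewrite IH // /elem /=.
    by rewrite pairX_delt ffunE eq_sym (negPf ef) mulr0z subr0.
  elim: s => //= f s IH; rewrite inE; have [es _|/fixS -> ] := boolP (e \in s).
    by rewrite IH // raddf0.
  by rewrite orbF => /eqP <-; rewrite /elem /= pairX_delt ffunE eqxx mulr1z subrr.
have E1 : elems [seq (delt f, delt f) | f <- enum S] (delt e) = 0 by rewrite H // mem_enum.
transitivity (elems [seq (path_chain v0 S v, incX v) | v <- enum (vertex G)] 0); last exact: raddf0.
by rewrite [LHS]/= /elems /retr_steps foldr_cat; apply: (congr1 (foldr elem ^~ _)).
Qed.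

Lemma split_coclass_in (c : coH1 (delete S)) e : e \in S -> split_coclass v0 cS c e = 0.
Proof.
move=> eS; have [d <-] := cls_surj c; rewrite [split_coclass _ _ _](qliftE (transpose_retr_rel v0 cS)).
by rewrite ffunE big1 // => e' _; rewrite retr_delt_in // ffunE mulr0.
Qed.

Lemma untheta_disjoint (La : zmodType) (l : int) t (A : {set E}) :
  @untheta G v0 S cS La l t A != 0 -> [disjoint A & S].
Proof.
move=> n0; rewrite disjoints_subset; apply/subsetP => e eA; rewrite inE.
apply: contraNN n0 => eS; apply/eqP; move: t.
have evB : zmod_morphism (fun t => @untheta G v0 S cS La l t A) by move=> x y; rewrite raddfB.
pose f : {additive _ -> La} := HB.pack (fun t => @untheta G v0 S cS La l t A) (GRing.isZmodMorphism.Build _ La _ evB).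
have zB : zmod_morphism (fun _ : tensor La (ext_power (coH1 (delete S)) l) => 0 : La) by move=> x y; rewrite subr0.
pose z : {additive _ -> La} := HB.pack (fun _ : tensor La (ext_power (coH1 (delete S)) l) => 0 : La) (GRing.isZmodMorphism.Build _ La _ zB).
suff H : f =1 z by move=> t; exact: H.
apply: tensor_ext => a w; rewrite -[LHS]/(@untheta G v0 S cS La l (tens a w) A) -[RHS]/(0 : La) untheta_tens.
rewrite (_ : ext_form _ l w A = 0) ?mulr0z //; move: w.
have wordS s : word_form (split_coclass v0 cS) s A = 0.
  have anns : ann e (word_form (split_coclass v0 cS) s) = 0.
    rewrite ann_word_form big1 // => i _; by rewrite split_coclass_in // mulr0 mulr0z.
  have := congr1 (fun u => u (A :\ e)) anns; rewrite /ann !inE eqxx /= setD1K //.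
  by move=> /(congr1 (fun u => u *~ sg e (A :\ e))); rewrite -mulrzA sg_sq mulr1z mul0rz.
apply: (@ext_ext _ _ _ (fun w => ext_form (split_coclass v0 cS) l w A) (fun=> 0)) => [x y|x y|s].
- by rewrite raddfB.
- by rewrite subr0.
- by rewrite ext_formE; case: ifP.
Qed.
End ThetaSupport.

Section ThetaMap.
Variables (G : graph) (S T : {set edge G}) (La Lb : zmodType) (l : int).
Variable f : {additive La -> Lb}.
Hypothesis ST : S \subset T.

Lemma coH1_proj_edge_class e : coH1_proj S T (edge_class S e) = edge_class T e.
Proof.
apply: etrans (qliftE _ _) _; rewrite /= /coH1_proj_cochain ST; apply: (congr1 (cls _)).
apply/ffunP => e'; rewrite !ffunE.
have eS : val e' \notin S by apply: contra (valP e') => /(subsetP ST).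
by rewrite (insubT (fun e => e \notin S) eS) /= ffunE.
Qed.

Lemma theta_map (x : {set edge G} -> La) :
  tensor_map f (ext_map (coH1_proj S T) l) (theta S l x) = theta T l (fun A => f (x A)).
Proof.
rewrite /theta /wedge_sum (raddf_sum (tensor_map f _)); apply: eq_bigr => A _.
rewrite tensor_mapE ext_mapE -map_comp; apply: (congr1 (fun s => tens _ (wedge l s))).
by apply: eq_map => e; exact: coH1_proj_edge_class.
Qed.
End ThetaMap.

Lemma wedge0 (M : zmodType) (q : int) (s t : seq M) : wedge q (s ++ 0 :: t) = 0.
Proof.
have := wedgeD q s 0 0 t; rewrite addr0 => /eqP.
by rewrite -[X in X == _]addr0 (inj_eq (addrI _)) eq_sym => /eqP.
Qed.

Lemma additive_sum_ker (A B : zmodType) (f : {additive A -> B}) (I : finType) (P : pred I)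
    (F : I -> A) (y : A) (n : int) :
  f y = 0 -> f (\sum_(i | P i) F i + y *~ n) = \sum_(i | P i) f (F i).
Proof. by move=> fy; rewrite raddfD raddfMz /= fy mul0rz addr0 raddf_sum. Qed.

Section ThetaColumns.
Variables (G : graph) (v0 : vertex G) (k : nat).
Hypothesis c0 : conn (set0 : {set edge G}).
Local Notation E := (edge G).
Local Notation X := {ffun E -> int}.
Local Notation Om := ({set E} -> int).
Local Notation V := ({set E} -> {set E} -> Om).
Local Notation W := (X -> V).
Local Notation K := (X -> ({set E} -> Om)).
Local Notation D := (total_diff v0).

Lemma edge_class_in (S : {set E}) e : e \in S -> edge_class S e = 0.
Proof.
move=> eS; rewrite /edge_class (_ : [ffun e' => _] = 0) ?raddf0 //.
apply/ffunP => e'; rewrite !ffunE; case: eqP => // ee.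
by have := valP e'; rewrite /= ee eS.
Qed.

(** Words of the wrong length vanish, and edges of [S] have zero class. *)
Lemma theta_supp (S : {set E}) (La : zmodType) (l : int) (x x' : {set E} -> La) :
  (forall A : {set E}, [disjoint A & S] -> #|A|%:Z = l -> x A = x' A) -> theta S l x = theta S l x'.
Proof.
move=> xx; rewrite /theta /wedge_sum; apply: eq_bigr => A _.
have [Al|Al] := eqVneq #|A|%:Z l; last first.
  have w0 : wedge l [seq edge_class S i | i <- enum A] = 0.
    by apply: wedge_size; rewrite size_map -cardE.
  rewrite w0; exact: etrans (@tensr0 _ _ _) (esym (@tensr0 _ _ _)).
have [AS|] := boolP [disjoint A & S]; first by rewrite xx.
rewrite -setI_eq0 => /set0Pn[e]; rewrite inE => /andP[eA eS].
have [s1 [s2 [_ /(_ eA) AE _ _]]] := enum_split e A.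
have w0 : wedge l [seq edge_class S i | i <- enum A] = 0.
  by rewrite AE map_cat map_cons edge_class_in //; exact: wedge0.
rewrite w0; exact: etrans (@tensr0 _ _ _) (esym (@tensr0 _ _ _)).
Qed.

Lemma kos_map (S : {set E}) (U U' : zmodType) (f : {additive U -> U'}) (u : X -> ({set E} -> U)) :
  kos v0 S (fun p A => f (u p A)) = fun p A => f (kos v0 S u p A).
Proof.
apply/funext => p; apply/funext => A; rewrite /kos !fct_sumE raddf_sum; apply: eq_bigr => e _.
rewrite /cre /dop; case: ifP => _; last by rewrite raddf0.
rewrite raddfMz /=; apply: (congr1 (fun x => x *~ _)).
exact/esym/raddfB.
Qed.

Lemma theta_kos (S : {set E}) (La : zmodType) (l : int) (y : X -> ({set E} -> La)) p :
  cycle_inv y -> theta S l (kos v0 S y p) = 0.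
Proof.
move=> yI; rewrite kos_cut // (raddf_sum (@theta G S La l)) big1 // => v _.
exact: theta_cut.
Qed.

Definition thetaS (q l : int) (S : {set E}) (x : {set E} -> Om) :
  tensor (ext_power (H1 (delete S)) q) (ext_power (coH1 (delete S)) l) :=
  theta S l (fun A => of_form v0 S q (x A)).

Fact thetaS_additive q l S : zmod_morphism (thetaS q l S).
Proof.
move=> x y; rewrite /thetaS -(raddfB (@theta G S _ l)); apply: theta_supp => A _ _.
exact: (raddfB (of_form v0 S q)).
Qed.
HB.instance Definition _ q l S := GRing.isZmodMorphism.Build
  ({set E} -> Om) _ (thetaS q l S) (thetaS_additive q l S).

(** On invariant cochains the Koszul part is a sum of multiples of cuts, which [theta] kills; the
    face part becomes the CKS differential. *)
Lemma thetaS_diff (T : {set E}) (y : W) (M q q' l : int) : conn T -> cycle_inv y -> homog k M y ->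
  q = q' + 1 -> q' = k%:Z - #|T|%:Z ->
  thetaS q' l T (D y 0 T) = \sum_(e in T)
    tensor_map (interior (T :\ e) T e q q') (ext_map (coH1_proj (T :\ e) T) l) (thetaS q l (T :\ e) (y 0 (T :\ e))).
Proof.
move=> cT yI yd qq q'E.
have DE : D y 0 T = \sum_(e in T) (fun A : {set E} => if e \notin A then ann e (y 0 (T :\ e) A) else 0) +
    kos v0 T (column y T) 0 *~ (-1) ^+ #|T|.
  apply/funext => A; rewrite total_diffE.
  transitivity ((\sum_(e in T) (fun A : {set E} => if e \notin A then ann e (y 0 (T :\ e) A) else 0)) A +
      (kos v0 T (column y T) 0 *~ (-1) ^+ #|T|) A) => //.
  rewrite fct_mulrz; apply: (congr2 +%R); last by [].
  have -> : (\sum_(e in T) (fun A : {set E} => if e \notin A then ann e (y 0 (T :\ e) A) else 0)) A =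
     \sum_(e in T) (if e \notin A then ann e (y 0 (T :\ e) A) else 0).
    by apply/funext => C; rewrite !fct_sumE.
  by rewrite -big_mkcondr.
have k0 : thetaS q' l T (kos v0 T (column y T) 0) = 0.
  transitivity (theta T l (kos v0 T (fun p A => of_form v0 T q' (column y T p A)) 0)).
    by rewrite (kos_map T (of_form v0 T q')).
  apply: theta_kos => c p cb; apply/funext => A; rewrite /column yI //.
rewrite DE; apply: etrans (additive_sum_ker (f := thetaS q' l T) _ _ _ k0) _.
apply: eq_bigr => e eT.
have cS : conn (T :\ e) by apply: conn_mono cT; exact: subD1set.
apply: etrans (esym (@theta_map G (T :\ e) T _ _ l (interior (T :\ e) T e q q') (subD1set T e)
  (fun A => of_form v0 (T :\ e) q (y 0 (T :\ e) A)))).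
apply: theta_supp => A AT _.
have eA : e \notin A by apply/negP => eA; have := disjointFr AT eA; rewrite eT.
rewrite eA (@of_form_interior G v0 (T :\ e) T) ?setD1K ?inE ?eqxx //.
  exact: (proj1 (yd 0 (T :\ e) A)).
move=> C /(proj2 (yd 0 (T :\ e) A))/and4P[_ _ _ /eqP Ck].
by rewrite qq q'E (cardsD1 e T) eT; lia.
Qed.

(** The kernel of [theta] on a column is acyclic: [invariant_column] reduces the cocycle to a
    constant killed by [theta], which is a combination of cuts and so the Koszul differential of a
    linear function. *)
Lemma invariant_clear (S : {set E}) (M q l : int) (z : K) : conn S ->
  q = k%:Z - #|S|%:Z -> l = M - #|S|%:Z -> (forall p, col_deg k S M (z p)) ->
  cycle_inv z -> kos v0 S z = 0 -> thetaS q l S (z 0) = 0 ->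
  exists y : K, [/\ forall p, col_deg k S (M - 1) (y p), cycle_inv y,
    thetaS q (l - 1) S (y 0) = 0 & kos v0 S y = z].
Proof.
move=> cS qE lE zd zI kz tz.
pose La := ext_power (H1 (delete S)) q.
pose zL : X -> ({set E} -> La) := fun p A => of_form v0 S q (z p A).
have zLI : cycle_inv zL by move=> c p cb; rewrite /zL zI.
have kzL : kos v0 S zL = 0.
  rewrite /zL (kos_map S (of_form v0 S q)) kz; apply/funext => p; apply/funext => A.
  exact: (raddf0 (of_form v0 S q)).
have [y0 [zeta [y0I zetaE]]] := invariant_column c0 cS zLI kzL.
(* The truncation to sets of size [l] meets the size hypothesis of [theta_ker] and does not change
   [theta]. *)
pose zeta' : {set E} -> La := fun A => if #|A|%:Z == l then zeta A else 0.
have tzeta : theta S l zeta' = 0.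
  transitivity (theta S l zeta).
    by apply: theta_supp => A _ /eqP Al; rewrite /zeta' Al.
  rewrite -(zetaE 0) -[(zL - _) 0]/(zL 0 - kos v0 S y0 0).
  transitivity (theta S l (zL 0) - theta S l (kos v0 S y0 0)); first exact: (raddfB (@theta G S La l)).
  by rewrite (theta_kos S l 0 y0I) subr0; exact: tz.
have [eta etaE] : exists eta : vertex G -> {set E} -> La, forall A : {set E}, [disjoint A & S] -> zeta' A = (\sum_v cut S v (eta v)) A.
  apply: (theta_ker v0 cS) tzeta => A; rewrite /zeta'; case: ifP => [/eqP //|_]; by rewrite eqxx.
have [y0' y0I' y0E'] := kos_cut_linear v0 c0 S eta.
pose y1 := y0 + y0'.
have y1I : cycle_inv y1 by exact: cycle_invD.
(* Subtracting a constant does not affect [kos]; this one brings the primitive into the kernel of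
   [theta]. *)
pose x0 : {set E} -> La := @untheta G v0 S cS La (l - 1) (theta S (l - 1) (y1 0)).
pose y2 : X -> ({set E} -> La) := fun p => y1 p - x0.
have y2I : cycle_inv y2 by move=> c p cb; rewrite /y2 y1I.
have ty2 : theta S (l - 1) (y2 0) = 0.
  transitivity (theta S (l - 1) (y1 0) - theta S (l - 1) x0); first exact: (raddfB (@theta G S La (l - 1))).
  by rewrite /x0 theta_untheta subrr.
have ky2 : kos v0 S y2 = kos v0 S y1.
  apply/funext => p; apply: eq_bigr => e _; apply: (congr1 (cre e)).
  by rewrite /dop /y2 subrACA subrr subr0.
have zy p (A : {set E}) : [disjoint A & S] -> #|A|%:Z = l -> zL p A = kos v0 S y2 p A.
  move=> AS Al; rewrite ky2 /y1 (raddfD (kos v0 S)).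
  have := congr1 (fun x => x A) (zetaE p); rewrite -[(zL - _) p A]/(zL p A - kos v0 S y0 p A).
  have -> : zeta A = zeta' A by rewrite /zeta' Al eqxx.
  rewrite etaE // -(y0E' p) => /eqP; rewrite subr_eq addrC => /eqP -> //.
have [y [yE ky]] := column_proj v0 S M (fun p A => form_of S q (y2 p A)).
exists y; split.
- move=> p A; rewrite yE; case: ifP => [/andP[AS nE]|_]; last by split; [exact: inO0|].
  split; first exact: form_of_inO.
  move=> C n0; have Cq : #|C|%:Z = q := ext_form_deg n0.
  by rewrite cS AS nE /=; apply/eqP; move: Cq; rewrite qE; lia.
- by move=> c p cb; apply/funext => A; rewrite !yE y2I.
- rewrite /thetaS -[RHS]ty2; apply: theta_supp => A AS Al.
  have nE : #|S|%:Z + #|A|%:Z == M - 1 by apply/eqP; lia.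
  by rewrite yE AS nE form_ofK.
apply/funext => p; apply/funext => A; rewrite ky; case: ifPn => [/andP[AS /eqP nE]|nQ]; last first.
  apply/funext => C; apply/esym; have [//|/(proj2 (zd p A))/and4P[_ AS nE _]] := eqVneq (z p A C) 0.
  by rewrite AS nE in nQ.
have -> : kos v0 S (fun p A => form_of S q (y2 p A)) p A = form_of S q (kos v0 S y2 p A).
  by rewrite (kos_map S (form_of S q)).
rewrite -zy //; last by lia.
apply: of_formK => //; first exact: (proj1 (zd p A)).
move=> C /(proj2 (zd p A))/and4P[_ _ _ /eqP]; rewrite qE; lia.
Qed.
End ThetaColumns.

(** * The chain map from invariants to the CKS complex *)

Section ThetaComplex.
Variables (G : graph) (v0 : vertex G) (k : nat).
Hypothesis c0 : conn (set0 : {set edge G}).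
Hypothesis G_connected : connected G.
Local Notation E := (edge G).
Local Notation X := {ffun E -> int}.
Local Notation Om := ({set E} -> int).
Local Notation V := ({set E} -> {set E} -> Om).
Local Notation W := (X -> V).
Local Notation K := (X -> ({set E} -> Om)).
Local Notation D := (total_diff v0).

Definition theta_null (M : int) (z : W) := forall (S : {set E}) (q l : int), conn S ->
  q = k%:Z - #|S|%:Z -> l = M - #|S|%:Z -> thetaS v0 q l S (z 0 S) = 0.

Lemma theta_nullD M z z' : theta_null M z -> theta_null M z' -> theta_null M (z + z').
Proof.
move=> H H' S q l cS qE lE; rewrite -[(z + z') 0 S]/(z 0 S + z' 0 S).
apply: etrans (raddfD (thetaS v0 q l S) _ _) _.
by apply: etrans (congr2 +%R (H _ _ _ cS qE lE) (H' _ _ _ cS qE lE)) _; rewrite addr0.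
Qed.

Lemma theta_nullN M z : theta_null M z -> theta_null M (- z).
Proof.
move=> H S q l cS qE lE; rewrite -[(- z) 0 S]/(- z 0 S).
apply: etrans (raddfN (thetaS v0 q l S) _) _.
by apply: etrans (congr1 -%R (H _ _ _ cS qE lE)) _; rewrite oppr0.
Qed.

Lemma theta_null_diff M y : cycle_inv y -> homog k M y -> theta_null M y -> theta_null (M + 1) (D y).
Proof.
move=> yI yd yn S q l cS qE lE.
rewrite (thetaS_diff v0 c0 l cS yI yd (erefl (q + 1)) qE) big1 // => e eS.
have cSe : conn (S :\ e) by apply: conn_mono cS; exact: subD1set.
have H : thetaS v0 (q + 1) l (S :\ e) (y 0 (S :\ e)) = 0.
  by apply: yn => //; [rewrite qE|rewrite lE]; rewrite (cardsD1 e S) eS; lia.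
rewrite H; exact: raddf0.
Qed.

Lemma cycle_inv_diff y : cycle_inv y -> cycle_inv (D y).
Proof.
move=> yI c p cb; have := congr1 (fun w : W => w p) (total_diff_translate v0 c y).
have -> : (fun p => y (p + c)) = y by apply/funext => q; exact: yI.
by move=> <-.
Qed.

(** With nothing on smaller faces, the columns with [j] edges are Koszul cocycles in the kernel of
    [theta], to which [invariant_clear] applies. *)
Lemma kernel_step j M z : homog k M z -> cycle_inv z -> D z = 0 -> theta_null M z ->
  (forall p (S : {set E}), (#|S| < j)%N -> z p S = 0) ->
  exists y, [/\ homog k (M - 1) y, cycle_inv y, theta_null (M - 1) y &
    forall p (S : {set E}), (#|S| < j.+1)%N -> (z - D y) p S = 0].
Proof.
move=> zd zI dz zn zj.
have kz (S : {set E}) : #|S| = j -> kos v0 S (column z S) = 0.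
  move=> Sj; apply/funext => p; apply/funext => A.
  have := congr1 (fun w : W => w p S A) dz; rewrite total_diffE big1 ?add0r => [|e /andP[eS _]]; last first.
    by rewrite zj ?raddf0 // -Sj (cardsD1 e S) eS.
  by move=> /(congr1 (fun x => x *~ (-1) ^+ #|S|)); rewrite mulrz_signK mul0rz.
have ySP (S : {set E}) : exists y : K, [/\ forall p, col_deg k S (M - 1) (y p), cycle_inv y,
    forall q l : int, conn S -> q = k%:Z - #|S|%:Z -> l = M - 1 - #|S|%:Z -> thetaS v0 q l S (y 0) = 0 &
    (#|S| = j -> kos v0 S y = column z S)].
  have trivial : #|S| <> j \/ ~~ conn S -> exists y : K, [/\ forall p, col_deg k S (M - 1) (y p), cycle_inv y,
    forall q l : int, conn S -> q = k%:Z - #|S|%:Z -> l = M - 1 - #|S|%:Z -> thetaS v0 q l S (y 0) = 0 &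
    (#|S| = j -> kos v0 S y = column z S)].
    move=> H; exists 0; split=> //; first by move=> p; exact: col_deg0.
      by move=> q l _ _ _; exact: (raddf0 (thetaS v0 q l S)).
    case: H => [//|ncS _]; rewrite (raddf0 (kos v0 S)).
    apply/funext => p; apply/funext => A; apply/funext => C; apply/esym.
    have [//|/(proj2 (zd p S A))] := eqVneq (column z S p A C) 0.
    by rewrite (negPf ncS).
  have [Sj|Sj] := eqVneq #|S| j; last by apply: trivial; left; apply/eqP.
  have [cS|ncS] : conn S \/ ~~ conn S by case: (conn S); [left|right].
    2: by apply: trivial; right.
  have zSI : cycle_inv (column z S) by move=> c p cb; rewrite /column zI.
  have [y [yd yI yn ky]] := invariant_clear c0 cS (erefl _) (erefl _) (fun p => zd p S) zSI (kz S Sj)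
    (zn S _ _ cS (erefl _) (erefl _)).
  exists y; split=> // q l _ -> ->; rewrite (_ : M - 1 - #|S|%:Z = M - #|S|%:Z - 1) //; lia.
have [Y YP] := choice ySP.
pose y : W := fun p S => if #|S| == j then Y S p *~ (-1) ^+ j else 0.
exists y; split.
- move=> p S; rewrite /y; case: ifP => _; last exact: col_deg0.
  by apply: col_degMz; have [H _ _ _] := YP S; exact: H.
- move=> c p cb; apply/funext => S; rewrite /y; have [_ -> //] := YP S.
- move=> S q l cS qE lE; rewrite /y; case: ifP => _; last exact: (raddf0 (thetaS v0 q l S)).
  have [_ _ H _] := YP S; apply: etrans (raddfMz (thetaS v0 q l S) _ _) _.
  by apply: etrans (congr1 (fun x => x *~ _) (H _ _ cS qE lE)) _; rewrite mul0rz.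
move=> p S; rewrite ltnS leq_eqVlt => /orP[/eqP Sj|Sj]; apply/funext => A.
  rewrite -[LHS]/(z p S A - D y p S A) total_diffE big1 ?add0r => [|e /andP[eS _]]; last first.
    rewrite /y ifF ?raddf0 //; apply/eqP; move: Sj; rewrite (cardsD1 e S) eS; lia.
  have -> : column y S = Y S *~ (-1) ^+ j.
    by apply/funext => q; rewrite /column /y Sj eqxx fct_mulrz.
  rewrite (raddfMz (kos v0 S)) Sj.
  have [_ _ _ /(_ Sj) kY] := YP S.
  rewrite -[RHS](subrr (z p S A)); congr (_ - _).
  rewrite 2!fct_mulrz mulrz_signK; exact: (congr1 (fun w : K => w p A) kY).
rewrite -[LHS]/(z p S A - D y p S A) zj // sub0r; apply/eqP; rewrite oppr_eq0; apply/eqP.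
rewrite total_diffE big1 ?add0r => [|e /andP[eS _]]; last first.
  rewrite /y ifF ?raddf0 //; apply/eqP; move: Sj; rewrite (cardsD1 e S) eS; lia.
have -> : column y S = 0.
  by apply/funext => q; rewrite /column /y ifF //; apply/eqP; lia.
by rewrite (raddf0 (kos v0 S)) mul0rz.
Qed.

Lemma kernel_exact M z : homog k M z -> cycle_inv z -> D z = 0 -> theta_null M z ->
  exists y, [/\ homog k (M - 1) y, cycle_inv y, theta_null (M - 1) y & z = D y].
Proof.
move=> zd zI dz zn.
suff [y [yd yI yn yP]] : exists y, [/\ homog k (M - 1) y, cycle_inv y, theta_null (M - 1) y &
    forall p (S : {set E}), (#|S| < #|E|.+1)%N -> (z - D y) p S = 0].
  exists y; split=> //; apply/eqP; rewrite -subr_eq0; apply/eqP.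
  by apply/funext => p; apply/funext => S; apply: yP; rewrite ltnS max_card.
elim: #|E|.+1 => [|j [y [yd yI yn yP]]].
  exists 0; split=> //; first by move=> p; exact: face_deg0.
  by move=> S q l _ _ _; exact: (raddf0 (thetaS v0 q l S)).
have zn1 : theta_null M (z - D y).
  have H := theta_null_diff yI yd yn; rewrite (subrK 1 M) in H.
  exact: (theta_nullD zn (theta_nullN H)).
have [y' [yd' yI' yn' yP']] := kernel_step (homogB zd (homog_diff v0 yd))
  (cycle_invB zI (cycle_inv_diff yI))
  (etrans (total_diffB v0 z (D y)) (etrans (congr2 (fun a b => a - b) dz (total_diff_sq v0 y)) (subrr 0))) zn1 yP.
exists (y + y'); split.
- by move=> p S; exact: col_degD (yd p S) (yd' p S).
- exact: cycle_invD.
- exact: theta_nullD.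
by move=> p S; rewrite total_diffD opprD addrA; exact: yP'.
Qed.

Definition theta_cks (p : nat) (l : int) (w : W) : cks G p (k%:Z - p%:Z) l :=
  finfun (fun S : {S | S \in faces G p} => thetaS v0 (k%:Z - p%:Z) l (val S) (w 0 (val S))).

Lemma theta_cksE p l w S : theta_cks p l w S = thetaS v0 (k%:Z - p%:Z) l (val S) (w 0 (val S)).
Proof. by rewrite ffunE. Qed.

Lemma theta_cksB p l w w' : theta_cks p l (w - w') = theta_cks p l w - theta_cks p l w'.
Proof.
apply/ffunP => S; transitivity (theta_cks p l w S - theta_cks p l w' S); last exact/esym/dsumB.
transitivity (thetaS v0 (k%:Z - p%:Z) l (val S) ((w - w') 0 (val S))); first exact: theta_cksE.
transitivity (thetaS v0 (k%:Z - p%:Z) l (val S) (w 0 (val S)) - thetaS v0 (k%:Z - p%:Z) l (val S) (w' 0 (val S))).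
  exact: (raddfB (thetaS v0 (k%:Z - p%:Z) l (val S)) (w 0 (val S)) (w' 0 (val S))).
by apply: (congr2 (fun a b => a - b)); apply/esym; exact: theta_cksE.
Qed.

Lemma face_conn p (S : {S | S \in faces G p}) : conn (val S) /\ #|val S| = p.
Proof. by case: S => S /=; rewrite facesE // => /andP[/eqP-> ->]. Qed.

Lemma sum_face_pairs (B : zmodType) p (T : {set E}) (F : {set E} -> E -> B) :
  conn T -> #|T| = p.+1 ->
  \sum_(S : {S | S \in faces G p}) \sum_(e | (e \notin val S) && (T == e |: val S)) F (val S) e =
  \sum_(e in T) F (T :\ e) e.
Proof.
move=> cT Tp; under eq_bigr => S _ do rewrite big_mkcond.
rewrite exchange_big [RHS]big_mkcond; apply: eq_bigr => e _.
have [eT|eT] := boolP (e \in T); last first.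
  apply: big1 => S _; case: ifP => // /andP[_ /eqP TE].
  by case/negP: eT; rewrite TE setU11.
have SF : T :\ e \in faces G p.
  rewrite facesE //; apply/andP; split; last by apply: conn_mono cT; exact: subD1set.
  by move: Tp; rewrite (cardsD1 e) eT add1n => -[->].
rewrite (bigD1 (exist (fun S => S \in faces G p) (T :\ e) SF)) //=.
rewrite !inE eqxx /= setD1K // eqxx big1 ?addr0 // => S SE.
case: ifP => // /andP[eS /eqP TE]; case/eqP: SE; apply: val_inj => /=.
by rewrite TE setU1K.
Qed.

Lemma theta_cks_diff p l M y : cycle_inv y -> homog k M y ->
  cks_diff (k%:Z - p.+1%:Z) (theta_cks p l y) = theta_cks p.+1 l (D y).
Proof.
move=> yI yd; apply/ffunP => T; rewrite theta_cksE ffunE; have [cT Tp] := face_conn T.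
have qq : k%:Z - p%:Z = (k%:Z - p.+1%:Z) + 1 by lia.
rewrite (thetaS_diff v0 c0 l cT yI yd qq); last by rewrite Tp.
pose F (S : {set E}) e := tensor_map (interior S (val T) e (k%:Z - p%:Z) (k%:Z - p.+1%:Z))
  (ext_map (coH1_proj S (val T)) l) (thetaS v0 (k%:Z - p%:Z) l S (y 0 S)).
transitivity (\sum_(S : {S | S \in faces G p}) \sum_(e | (e \notin val S) && (val T == e |: val S)) F (val S) e).
  by apply: eq_bigr => S _; apply: eq_bigr => e _; rewrite theta_cksE.
exact: (sum_face_pairs F cT Tp).
Qed.

Lemma theta_cks0 l y M : cycle_inv y -> homog k M y -> theta_cks 0 l (D y) = 0.
Proof.
move=> yI yd; apply/ffunP => S; rewrite theta_cksE; have [cS S0] := face_conn S.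
have SE : val S = set0 by apply/eqP; rewrite -cards_eq0 S0.
rewrite (thetaS_diff v0 c0 l cS yI yd (erefl (k%:Z - 0%:Z + 1))); last by rewrite S0.
rewrite big1 => [|e]; first by rewrite ffunE.
by rewrite {1}SE inE.
Qed.

Lemma thetaS_onto (S : {set E}) (M q l : int) t : conn S -> q = k%:Z - #|S|%:Z -> l = M - #|S|%:Z ->
  exists v, col_deg k S M v /\ thetaS v0 q l S v = t.
Proof.
move=> cS qE lE; pose u := @untheta G v0 S cS _ l t.
exists (fun A => form_of S q (u A)); split; last first.
  rewrite /thetaS -[RHS](theta_untheta v0 cS t); apply: theta_supp => A _ _; exact: form_ofK.
move=> A; split; first exact: form_of_inO.
move=> C n0; have Cq : #|C|%:Z = q := ext_form_deg n0.
have uA : u A != 0 by apply: contraNneq n0 => ->; rewrite raddf0.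
have Al := untheta_deg uA; rewrite cS (untheta_disjoint uA) /=.
by apply/andP; split; apply/eqP; move: Cq Al; rewrite qE lE; lia.
Qed.

(** One [z] lifts the whole family because different [p] concern faces of different sizes. *)
Lemma theta_cks_onto (M : int) (m : nat) (lf : nat -> int) (x : forall p, cks G p (k%:Z - p%:Z) (lf p)) :
  (forall p, (p < m)%N -> lf p = M - p%:Z) ->
  exists z, [/\ homog k M z, cycle_inv z & forall p, (p < m)%N -> theta_cks p (lf p) z = x p].
Proof.
move=> lfE.
have vP (S : {set E}) : exists v, col_deg k S M v /\
    forall p (pm : (p < m)%N) (pf : S \in faces G p), thetaS v0 (k%:Z - p%:Z) (lf p) S v = x p (exist _ S pf).
  have [/andP[Sm SF]|nS] := boolP ((#|S| < m)%N && (S \in faces G #|S|)); last first.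
    exists 0; split=> [|p pm pf]; first exact: col_deg0.
    case/negP: nS; move: (pf); rewrite facesE // => /andP[/eqP Sp cS].
    by rewrite facesE // eqxx cS Sp pm.
  have cS : conn S by move: SF; rewrite facesE // => /andP[].
  have [v [vd vE]] := thetaS_onto (x #|S| (exist _ S SF)) cS (erefl _) (lfE _ Sm).
  exists v; split=> // p pm pf.
  have pE : p = #|S| by move: (pf); rewrite facesE // => /andP[/eqP].
  by subst p; rewrite vE (bool_irrelevance pf SF).
have [v vE] := choice vP.
(* The lift is constant in the position, hence invariant. *)
exists (fun _ S => v S); split=> //; first by move=> p S; have [] := vE S.
move=> p pm; apply/ffunP => S.
transitivity (thetaS v0 (k%:Z - p%:Z) (lf p) (val S) (v (val S))); first exact: theta_cksE.
by case: S => S pf; have [_ H] := vE S; exact: (H p pm pf).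
Qed.
End ThetaComplex.

(** * Isomorphisms from additive relations, and representatives of classes *)

Lemma additive_bijection_of_relation (A B : zmodType) (F : A -> B -> Prop) :
  (forall a, exists b, F a b) -> (forall b, exists a, F a b) ->
  (forall a b a' b', F a b -> F a' b' -> F (a - a') (b - b')) ->
  (forall b, F 0 b -> b = 0) -> (forall a, F a 0 -> a = 0) ->
  exists f : {additive A -> B}, bijective f.
Proof.
move=> tot onto FB F0 F0'.
have uniqr a b b' : F a b -> F a b' -> b = b'.
  move=> H H'; apply/eqP; rewrite -subr_eq0; apply/eqP/F0.
  by rewrite -(subrr a); exact: FB.
have uniql a a' b : F a b -> F a' b -> a = a'.
  move=> H H'; apply/eqP; rewrite -subr_eq0; apply/eqP/F0'.
  by rewrite -(subrr b); exact: FB.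
have [f fF] := choice tot; have [g gF] := choice onto.
have fB : zmod_morphism f by move=> a a'; apply: uniqr (fF _) (FB _ _ _ _ (fF _) (fF _)).
pose h : {additive A -> B} := HB.pack f (GRing.isZmodMorphism.Build A B f fB).
exists h; exists g => [a|b] /=.
  exact: uniql (gF _) (fF _).
exact: uniqr (fF _) (gF _).
Qed.

Section Represents.
Variables (C : complex) (p : nat).

Definition represents (u : C p) (x : cohomology C p) :=
  exists kap : ker (diff C p), ker_val kap = u /\ x = cls _ kap.

Lemma coboundary0 : @coboundary C p 0.
Proof. by case: p => //= q; exists 0; rewrite raddf0. Qed.

Lemma coboundaryB (u v : C p) : coboundary u -> coboundary v -> coboundary (u - v).
Proof.
case: p u v => /= [u v -> ->|q u v [y ->] [y' ->]]; first by rewrite subrr.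
by exists (y - y'); rewrite raddfB.
Qed.

Lemma represents_exists u : diff C p u = 0 -> exists x, represents u x.
Proof.
move=> du; have ku : u \in kernel (diff C p) by rewrite unfold_in; apply/eqP.
by exists (cls _ (Ker ku)); exists (Ker ku).
Qed.

Lemma represents_surj x : exists u, represents u x.
Proof. by have [kap <-] := cls_surj x; exists (ker_val kap); exists kap. Qed.

Lemma represents_cocycle u x : represents u x -> diff C p u = 0.
Proof. by move=> [kap [<- _]]; apply/eqP; case: kap. Qed.

Lemma representsB u x u' x' : represents u x -> represents u' x' -> represents (u - u') (x - x').
Proof.
move=> [kap [<- ->]] [kap' [<- ->]]; exists (kap - kap'); split=> //.
by rewrite raddfB.
Qed.

Lemma represents_eq u u' x x' : represents u x -> u = u' -> x = x' -> represents u' x'.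
Proof. by move=> H <- <-. Qed.

Lemma represents0 u : represents u 0 -> coboundary u.
Proof.
move=> [kap [<- H]].
apply: (@span_closed _ (fun z : ker (diff C p) => coboundary (ker_val z)) kap).
- exact: coboundary0.
- by move=> x y; exact: coboundaryB.
by rewrite -[kap]subr0; apply/clsP; rewrite raddf0 -H.
Qed.

Lemma represents_coboundary u x : represents u x -> coboundary u -> x = 0.
Proof. by move=> [kap [<- ->]] cu; exact: cls_rel. Qed.
End Represents.

(** * The comparison isomorphism *)

Section Comparison.
Variables (G : graph) (v0 : vertex G) (k n : nat).
Hypothesis G_connected : connected G.
Local Notation E := (edge G).
Local Notation X := {ffun E -> int}.
Local Notation Om := ({set E} -> int).
Local Notation W := (X -> ({set E} -> {set E} -> Om)).
Local Notation D := (total_diff v0).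
Local Notation N := (n + k)%N.
Local Notation piece p := (cks_piece G k (N - p)).
Local Notation Th p z := (@theta_cks G v0 k p (N - p)%N%:Z z).

Let c0 : conn (set0 : {set E}) := connected_conn0 G_connected.

Lemma theta_cks_zero p l : @theta_cks G v0 k p l 0 = 0.
Proof. by rewrite -(subrr (0 : W)) theta_cksB subrr. Qed.

Lemma theta_cks_coboundary p l M y : cycle_inv y -> homog k M y ->
  @coboundary (cks_piece G k l) p (@theta_cks G v0 k p l (D y)).
Proof.
move=> yI yd; case: p => [|p]; first exact: (theta_cks0 v0 c0 G_connected l yI yd).
exists (@theta_cks G v0 k p l y); apply/esym.
exact: (theta_cks_diff v0 c0 G_connected p l yI yd).
Qed.

Lemma theta_null_of_cks (N' : nat) z : homog k N'%:Z z ->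
  (forall p, (p <= N')%N -> @theta_cks G v0 k p (N' - p)%N z = 0) -> theta_null v0 k N'%:Z z.
Proof.
move=> zd H S q l cS qE lE; have [SN|SN] := leqP #|S| N'; last first.
  rewrite (_ : z 0 S = 0); first exact: (raddf0 (thetaS v0 q l S)).
  apply/funext => A; apply/funext => C.
  have [//|/(proj2 (zd 0 S A))/and4P[_ _ /eqP nE _]] := eqVneq (z 0 S A C) 0.
  by move: nE SN; lia.
have SF : S \in faces G #|S| by rewrite facesE // eqxx.
have HS := congr1 (fun x : cks G #|S| (k%:Z - #|S|%:Z) (N' - #|S|)%N => x (exist _ S SF)) (H _ SN).
have lE' : l = (N' - #|S|)%N%:Z by rewrite lE; lia.
rewrite qE lE'; apply: etrans (esym (theta_cksE v0 k _ z (exist _ S SF))) _.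
by apply: etrans HS _; rewrite ffunE.
Qed.

Lemma cks_of_theta_null (N' p : nat) z : (p <= N')%N -> theta_null v0 k N'%:Z z ->
  @theta_cks G v0 k p (N' - p)%N z = 0.
Proof.
move=> pN zn; apply/ffunP => S; have [cS Sp] := face_conn G_connected S.
transitivity (thetaS v0 (k%:Z - p%:Z) (N' - p)%N (val S) (z 0 (val S))); first exact: theta_cksE.
apply: (etrans (zn _ _ _ cS _ _)); first by rewrite Sp.
  by rewrite Sp; lia.
by rewrite ffunE.
Qed.

(** A class on the left is related to a family on the right when some invariant cocycle [z] of total
    degree n + k corresponds to the first under [H] and has the second as its images under
    [theta_cks]. That [theta_cks] is surjective with acyclic kernel gives totality on the right and
    injectivity. *)
Lemma group_cohomology_cks_iso :
  exists f : {additive group_cohomology (@Ract G k) n ->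
                dsum (fun p : 'I_N.+1 => cohomology (piece p) p)}, bijective f.
Proof.
have [H [HB Hinv Honto Htot Hcob]] := periodic_relation v0 k G_connected n.
pose F (a : group_cohomology (@Ract G k) n) (x : dsum (fun p : 'I_N.+1 => cohomology (piece p) p)) :=
  exists c z, [/\ @represents (cochain_complex (@Ract G k)) n c a, H c z &
    forall p : 'I_N.+1, @represents (piece p) p (Th p z) (x p)].
have pN (p : 'I_N.+1) : (p <= N)%N by rewrite -ltnS.
apply: (@additive_bijection_of_relation _ _ F).
- move=> a; have [c cr] := represents_surj a; have dc := represents_cocycle cr.
  have [z Hcz] := Htot c dc; have [_ zd dz zI] := Hinv _ _ Hcz.
  have xP (p : 'I_N.+1) : exists x, @represents (piece p) p (Th p z) x.
    apply: represents_exists; apply: etrans (theta_cks_diff v0 c0 G_connected p _ zI zd) _.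
    by rewrite dz; exact: theta_cks_zero.
  exists (finfun (fun p => projT1 (cid (xP p)))); exists c, z; split=> // p.
  by rewrite ffunE; case: (cid (xP p)).
- move=> x.
  have uP (p : 'I_N.+1) : exists u, @represents (piece p) p u (x p) := represents_surj (x p).
  pose u (p : 'I_N.+1) := projT1 (cid (uP p)).
  have ur (p : 'I_N.+1) : @represents (piece p) p (u p) (x p) by rewrite /u; case: (cid (uP p)).
  (* The family is extended by zero beyond n + k, since [theta_cks_onto] takes one indexed by all
     naturals. *)
  have yP (p : nat) : exists y : cks G p (k%:Z - p%:Z) (N - p)%N, forall pf : (p < N.+1)%N, y = u (Ordinal pf).
    have [pf|npf] : (p < N.+1)%N \/ ~~ (p < N.+1)%N by case: (p < N.+1)%N; [left|right].
      2: by exists 0 => pf; rewrite pf in npf.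
    by exists (u (Ordinal pf)) => pf'; rewrite (bool_irrelevance pf' pf).
  pose y p := projT1 (cid (yP p)).
  have yE p (pf : (p < N.+1)%N) : y p = u (Ordinal pf) by rewrite /y; case: (cid (yP p)).
  have lfE p : (p < N.+1)%N -> (N - p)%N%:Z = N%:Z - p%:Z by lia.
  have [z0 [zd0 zI0 zE0]] := theta_cks_onto v0 c0 G_connected y lfE.
  have zu (p : 'I_N.+1) : Th p z0 = u p.
    by case: p => p pf; apply: etrans (zE0 p pf) _; exact: yE.
  have dTh p (pf : (p < N.+1)%N) :
      @cks_diff G p (k%:Z - p%:Z) (k%:Z - p.+1%:Z) (N - p)%N (Th p z0) = 0.
    have du : diff (piece p) p (u (Ordinal pf)) = 0 := represents_cocycle (ur (Ordinal pf)).
    exact: etrans (congr1 (diff (piece p) p) (zu (Ordinal pf))) du.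
  have dzd : homog k N.+1%:Z (D z0) by rewrite -addn1 PoszD; exact: total_diff_deg.
  have dzn : theta_null v0 k N.+1%:Z (D z0).
    apply: theta_null_of_cks => // -[|p] pN1; first exact: (theta_cks0 v0 c0 G_connected _ zI0 zd0).
    apply: etrans (esym (theta_cks_diff v0 c0 G_connected p _ zI0 zd0)) _.
    exact: (dTh p pN1).
  (* [D z0] maps to zero because the [u p] are cocycles; it is therefore the differential of an
     element of the kernel, whose removal from [z0] keeps the images. *)
  have [y' [yd' yI' yn' yE']] := kernel_exact c0 dzd (cycle_inv_diff v0 zI0) (total_diff_sq v0 z0) dzn.
  have N1 : N.+1%:Z - 1 = N%:Z by lia.
  rewrite N1 in yd' yn'.
  pose z := z0 - y'.
  have zd : homog k N%:Z z := homogB zd0 yd'.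
  have zI : cycle_inv z := cycle_invB zI0 yI'.
  have dz : D z = 0 by rewrite /z total_diffB -yE' subrr.
  have zd' : homog k (n%:Z + k%:Z) z by rewrite -PoszD.
  have [c Hcz] := Honto z zd' dz zI.
  have [dc _ _ _] := Hinv _ _ Hcz.
  have [a ar] := @represents_exists (cochain_complex (@Ract G k)) n c dc.
  exists a, c, z; split=> // p.
  have -> : Th p z = u p.
    by rewrite /z theta_cksB zu (cks_of_theta_null (pN p) yn') subr0.
  exact: ur.
- move=> a x a' x' [c [z [cr Hcz zr]]] [c' [z' [cr' Hcz' zr']]].
  exists (c - c'), (z - z'); split=> [||p]; first exact: representsB.
    exact: HB.
  apply: (represents_eq (representsB (zr p) (zr' p))); first exact/esym/theta_cksB.
  exact/esym/dsumB.
- move=> x [c [z [cr Hcz zr]]]; have cb := represents0 cr.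
  have [/(_ cb)[y yd [yI zE]] _] := Hcob _ _ Hcz.
  apply/ffunP => p; transitivity (0 : cohomology (piece p) p); last by rewrite ffunE.
  apply: represents_coboundary (zr p) _.
  by rewrite zE; exact: theta_cks_coboundary yI yd.
move=> a [c [z [cr Hcz zr]]]; apply: represents_coboundary cr _.
have [_ zd dz zI] := Hinv _ _ Hcz.
have zcob (p : 'I_N.+1) : @coboundary (piece p) p (Th p z).
  have x0 : (0 : dsum (fun p : 'I_N.+1 => cohomology (piece p) p)) p = 0 by rewrite ffunE.
  exact: represents0 (represents_eq (zr p) (erefl _) x0).
(* A primitive in degree [p] lies in the piece of the class in degree [p.+1], hence the second
   degree [N - p.+1]. *)
have yP (p : nat) : exists y : cks G p (k%:Z - p%:Z) (N - p.+1)%N,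
    (p < N)%N -> Th p.+1 z = cks_diff (k%:Z - p.+1%:Z) y.
  have [pf|npf] := boolP (p < N)%N; last by exists 0.
  by have [y yE] := zcob (Ordinal (pf : (p.+1 < N.+1)%N)); exists y.
pose y p := projT1 (cid (yP p)).
have yE p : (p < N)%N -> Th p.+1 z = cks_diff (k%:Z - p.+1%:Z) (y p) by rewrite /y; case: (cid (yP p)).
have lfE p : (p < N)%N -> (N - p.+1)%N%:Z = N%:Z - 1 - p%:Z by lia.
(* The primitives lift to a single invariant [y1] of total degree one less, and [z - D y1] falls in
   the acyclic kernel. *)
have [y1 [yd1 yI1 yE1]] := @theta_cks_onto G v0 k c0 G_connected (N%:Z - 1) N (fun p => (N - p.+1)%N%:Z) y lfE.
have zd' : homog k N%:Z z by rewrite PoszD.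
have z1d : homog k N%:Z (z - D y1) := homogB zd' (homog_diff v0 yd1).
have z1n : theta_null v0 k N%:Z (z - D y1).
  apply: theta_null_of_cks => // p pN1; rewrite theta_cksB; apply/eqP; rewrite subr_eq0; apply/eqP.
  case: p pN1 => [|p] pN1.
    rewrite (theta_cks0 v0 c0 G_connected _ yI1 yd1); exact: (zcob ord0).
  apply: etrans (yE p pN1) _; rewrite -(yE1 p pN1).
  exact: (theta_cks_diff v0 c0 G_connected p _ yI1 yd1).
have dz1 : D (z - D y1) = 0 by rewrite total_diffB total_diff_sq dz subr0.
have [y2 [yd2 yI2 yn2 yE2]] := kernel_exact c0 z1d (cycle_invB zI (cycle_inv_diff v0 yI1)) dz1 z1n.
apply/(Hcob _ _ Hcz); exists (y1 + y2).
  by rewrite -PoszD => p S; exact: col_degD (yd1 p S) (yd2 p S).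
split; first exact: cycle_invD.
by rewrite total_diffD -yE2 addrC subrK.
Qed.
End Comparison.

Local Close Scope ring_scope.

Theorem mainTheorem3 (G : graph) (G_connected : connected G) (n k : nat) :
  exists f : {additive group_cohomology (@Ract G k) n ->
                dsum (fun p : 'I_(n + k).+1 =>
                        cohomology (cks_piece G k (n + k - p)) p)},
    bijective f.
Proof.
have [v0 _] := connected_vertex G_connected.
exact: group_cohomology_cks_iso v0 k n G_connected.
Qed.
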